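(* Assume the following. (1) $F^{-1}$ is Lipschitz in some neighborhood $U_\alpha$ of $\alpha$ and in some neighborhood $U_{1-\beta}$ of $1-\beta$. (2) $\max(|\alpha_n-\alpha|,|\beta_n-\beta|)=O\bigl(n^{-1/3}\bigr)$ as $n\to\infty$. (3) $J$ is a real function defined in an open set $I$ with $[\alpha,1-\beta]\subset I\subseteq(0,1)$, and $J$ is Lipschitz in $I$: there is a constant $C\ge 0$ with $|J(u)-J(v)|\le C|u-v|$ for all $u,v\in I$. (4) The weights $c_{i,n}$ satisfy $\sum_{i=k_n+1}^{n-m_n}|c_{i,n}-c^0_{i,n}|=O\bigl(n^{1/3}\bigr)$ as $n\to\infty$, where $c^0_{i,n}=n\int_{(i-1)/n}^{i/n}J(u)\,du$. (5) $\sigma>0$. Then for every sequence $a_n\to 0$ and each $A>0$, $$1-F_{L_n}(x)=[1-\Phi(x)](1+o(1)),\qquad F_{L_n}(-x)=\Phi(-x)(1+o(1)),$$ as $n\to\infty$, uniformly in the range $-A\le x\le a_n n^{1/6}$.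
   Context: $X_1,X_2,\dots$ are independent identically distributed real random variables with distribution function $F$, and $X_{1:n}\le\dots\le X_{n:n}$ are the order statistics of $X_1,\dots,X_n$. The left-continuous inverse of $F$ is $F^{-1}(u)=\inf\{x:F(x)\ge u\}$ for $0<u\le 1$, and $F^{-1}(0)=F^{-1}(0^+)$. $k_n,m_n$ are integer sequences with $0\le k_n<n-m_n\le n$; $\alpha_n=k_n/n$, $\beta_n=m_n/n$. Throughout, $\alpha_n\to\alpha$ and $\beta_n\to\beta$ as $n\to\infty$, where $0<\alpha<1-\beta<1$ and $\beta>0$ (heavy trimming). The trimmed $L$-statistic is $L_n=n^{-1}\sum_{i=k_n+1}^{n-m_n}c_{i,n}X_{i:n}$ with $c_{i,n}\in\mathbb{R}$ (non-random). The centering constants are $\mu_n=\int_{\alpha_n}^{1-\beta_n}J(u)F^{-1}(u)\,du$ (well defined, as are the $c^0_{i,n}$ for $k_n<i\le n-m_n$, for all sufficiently large $n$). The scale $\sigma\ge0$ is given by $\sigma^2=\int_{\alpha}^{1-\beta}\int_{\alpha}^{1-\beta}J(u)J(v)(\min(u,v)-uv)\,dF^{-1}(u)\,dF^{-1}(v)$, where $\int_a^b=\int_{[a,b)}$ when integrating with respect to the left-continuous integrator $F^{-1}$. $F_{L_n}(x)=\mathbf{P}\{\sqrt{n}(L_n-\mu_n)/\sigma\le x\}$, and $\Phi$ is the standard normal distribution function. *)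

(* Defs.v *)
From HB Require Import structures.
From mathcomp Require Import all_boot all_order all_algebra.
From mathcomp Require Import all_classical all_reals all_analysis.

Set Implicit Arguments.
Unset Strict Implicit.
Unset Printing Implicit Defensive.

Import Order.TTheory GRing.Theory Num.Theory.
Import numFieldNormedType.Exports.

Local Open Scope classical_set_scope.
Local Open Scope ring_scope.

(* A sequence X : nat -> {RV P >-> R} is indexed from 0: the X_1, ..., X_n of
   the text are X 0, ..., X n.-1. *)

Definition mutually_independent (d : measure_display) (T : measurableType d)
    (R : realType) (P : probability T R) (X : nat -> {RV P >-> R}) : Prop :=
  forall (s : seq nat) (B : nat -> set R), uniq s ->
    (forall i, measurable (B i)) ->
    P (\bigcap_(i in [set` s]) (X i @^-1` B i)) =
    (\prod_(i <- s) P (X i @^-1` B i))%E.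

(* Equality of laws is required on measurable sets only, as the values of a
   measure on the other sets are unspecified. *)
Definition identically_distributed (d : measure_display) (T : measurableType d)
    (R : realType) (P : probability T R) (X : nat -> {RV P >-> R}) : Prop :=
  forall (i : nat) (B : set R), measurable B ->
    distribution P (X i) B = distribution P (X 0%N) B.

(* X_{i:n} for 1 <= i <= n. *)
Definition order_stat (R : realType) (x : nat -> R) (n i : nat) : R :=
  nth 0 (sort (fun y z : R => y <= z) (mkseq x n)) i.-1.

(* Extended-valued: at 0 and 1 the inverse of a distribution function may be
   infinite. *)
Definition quantile (R : realType) (F : R -> \bar R) (u : R) : \bar R :=
  let q v := ereal_inf [set x%:E | x in [set x : R | (v%:E <= F x)%E]] in
  if u == 0 then lim (q v @[v --> 0^'+]) else q u.

Section quantile_measure.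
Context (d : measure_display) (T : measurableType d) (R : realType).
Context (P : probability T R) (X : {RV P >-> R}).

Let Q (u : R) : R := fine (quantile (cdf X) u).

Let q (u : R) : \bar R :=
  ereal_inf [set x%:E | x in [set x : R | (u%:E <= cdf X x)%E]].

Let quantileq u : 0 < u -> quantile (cdf X) u = q u.
Proof. by rewrite /quantile; case: eqP => [->|//]; rewrite ltxx. Qed.

Let cdfE x : (fine (cdf X x))%:E = cdf X x.
Proof. by rewrite fineK// fin_num_measure. Qed.

Let le_q u v : u <= v -> (q u <= q v)%E.
Proof.
move=> uv; apply: ereal_inf_le_tmp => _ [x /= vx <-]; exists x => //=.
by apply: le_trans vx; rewrite lee_fin.
Qed.

Let lt_cdf u x : (x%:E < q u)%E -> (cdf X x < u%:E)%E.
Proof.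
rewrite ltNge => /negP xq; rewrite ltNge; apply/negP => ux; apply: xq.
by apply: ereal_inf_lbound; exists x.
Qed.

Let ge_q u x : (cdf X x < u%:E)%E -> (x%:E <= q u)%E.
Proof.
move=> xu; apply: le_ereal_inf_tmp => _ [y /= uy <-]; rewrite lee_fin leNgt.
apply/negP => yx; have := lt_le_trans xu uy.
by rewrite ltNge (cdf_nondecreasing X (ltW yx)).
Qed.

Lemma quantile_fin_num u : 0 < u -> u < 1 ->
  quantile (cdf X) u \is a fin_num.
Proof.
move=> u0 u1; rewrite quantileq// fin_real//; apply/andP; split.
- have /fine_cvg/cvgr_lt/(_ _ u0)[x [_ xu]] := cvg_cdfNy0 X.
  have {}xu : (cdf X (x - 1) < u%:E)%E.
    by rewrite -cdfE lte_fin xu// ltrBlDr ltrDl.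
  exact: lt_le_trans (ltNyr _) (ge_q xu).
- have /fine_cvg/cvgr_gt/(_ _ u1)[x [_ xu]] := cvg_cdfy1 X.
  have {}xu : (u%:E < cdf X (x + 1))%E.
    by rewrite -cdfE lte_fin xu// ltrDl.
  rewrite ltNge; apply/negP; rewrite leye_eq => /eqP qy.
  have xq : ((x + 1)%:E < q u)%E by rewrite qy ltry.
  by have := lt_trans (lt_cdf xq) xu; rewrite ltxx.
Qed.

Let QE u : 0 < u -> u < 1 -> (Q u)%:E = q u.
Proof. by move=> u0 u1; rewrite fineK ?quantile_fin_num// quantileq. Qed.

Let le_Q u v : 0 < u -> u <= v -> v < 1 -> Q u <= Q v.
Proof.
move=> u0 uv v1; rewrite -lee_fin (QE u0 (le_lt_trans uv v1)).
by rewrite (QE (lt_le_trans u0 uv) v1) le_q.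
Qed.

(* As lebesgue_stieltjes_measure takes a right-continuous integrator, we reflect
   the left-continuous quantile function: t |-> - F^{-1}(- t) is nondecreasing
   and right-continuous. The argument is truncated to [a, b], outside of which
   F^{-1} may be infinite or undefined. *)
Definition quantile_reflection (a b t : R) : R :=
  if [&& 0 < a, a <= b & b < 1] then - Q (Num.max a (Num.min b (- t))) else 0.

Lemma quantile_reflection_nondecreasing a b :
  nondecreasing (quantile_reflection a b).
Proof.
move=> s t st; rewrite /quantile_reflection; case: ifP => // /and3P[a0 ab b1].
rewrite lerN2 le_Q//.
- by rewrite lt_max a0.
- rewrite ge_max le_max lexx/= le_max; apply/orP; right.
  by rewrite le_min !ge_min lexx/= lerN2 st orbT.
- by rewrite gt_max (le_lt_trans ab b1) gt_min b1.
Qed.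

Lemma quantile_reflection_right_continuous a b :
  right_continuous (quantile_reflection a b).
Proof.
move=> t; rewrite /quantile_reflection; case: ifP => [/and3P[a0 ab b1]|_]; last first.
  exact: cvg_cst.
apply: cvgN.
set c := fun t : R => Num.max a (Num.min b (- t)).
have c0 s : 0 < c s by rewrite lt_max a0.
have c1 s : c s < 1 by rewrite gt_max (le_lt_trans ab b1) gt_min b1.
have cc : {for t, continuous c}.
  apply: (@continuous_max _ _ (fun=> a) (fun s => Num.min b (- s))).
    exact: cvg_cst.
  apply: (@continuous_min _ _ (fun=> b) (fun s => (- s))).
    exact: cvg_cst.
  exact: opp_continuous.
apply/cvgrPdist_le => e e0.
have xq : ((Q (c t) - e)%:E < q (c t))%E by rewrite -QE// lte_fin ltrBlDr ltrDl.
have Fc := lt_cdf xq.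
have Fc' : fine (cdf X (Q (c t) - e)) < c t.
  by rewrite -lte_fin cdfE.
near=> s.
have ts : t < s by near: s; exact: nbhs_right_gt.
have cst : c s <= c t.
  rewrite /c ge_max le_max lexx/= le_max; apply/orP; right.
  by rewrite le_min !ge_min lexx/= lerN2 (ltW ts) orbT.
rewrite ger0_norm ?subr_ge0; last by rewrite -/(c s) -/(c t) le_Q.
rewrite lerBlDr -lerBlDl -lee_fin (QE (c0 s) (c1 s)) ge_q//.
rewrite -cdfE lte_fin.
near: s; have /cvg_at_right_filter/cvgr_gt := cc; exact.
Unshelve. all: by end_near. Qed.

HB.instance Definition _ (a b : R) := isCumulative.Build R _ R
  (quantile_reflection a b) (@quantile_reflection_nondecreasing a b)
  (@quantile_reflection_right_continuous a b).

(* The Lebesgue-Stieltjes measure dF^{-1} on [a, b). *)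
Definition quantile_measure (a b : R) : set (measurableTypeR R) -> \bar R :=
  pushforward (lebesgue_stieltjes_measure (quantile_reflection a b))
    (-%R : measurableTypeR R -> measurableTypeR R).

Let measurable_opp :
  measurable_fun [set: measurableTypeR R]
    (-%R : measurableTypeR R -> measurableTypeR R).
Proof. by []. Qed.

Let quantile_measure0 a b : quantile_measure a b set0 = 0%E.
Proof. exact: (measure0 (pushforward _ _)). Qed.

Let quantile_measure_ge0 a b A : (0 <= quantile_measure a b A)%E.
Proof. exact: (measure_ge0 (pushforward _ _)). Qed.

Let quantile_measure_sigma_additive a b :
  semi_sigma_additive (quantile_measure a b).
Proof. exact: (@measure_semi_sigma_additive _ _ _ (pushforward _ _)). Qed.

HB.instance Definition _ (a b : R) := isMeasure.Build _ _ _
  (quantile_measure a b) (@quantile_measure0 a b) (@quantile_measure_ge0 a b)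
  (@quantile_measure_sigma_additive a b).


Lemma quantile_measure_itvco (a b u v : R) : 0 < a -> b < 1 ->
    a <= u -> u <= v -> v <= b ->
  quantile_measure a b `[u, v[%classic =
  (quantile (cdf X) v - quantile (cdf X) u)%E.
Proof.
move=> a0 b1 au uv vb.
have u0 : 0 < u by exact: lt_le_trans au.
have v1 : v < 1 by exact: le_lt_trans b1.
rewrite /quantile_measure /pushforward opp_preimage_itvbndbnd/=.
rewrite /lebesgue_stieltjes_measure /measure_extension/=.
rewrite measurable_mu_extE/=; last exact: is_ocitv.
rewrite wlength_itv_bnd ?lerN2// /quantile_reflection.
rewrite a0 b1 (le_trans au (le_trans uv vb))/= !opprK.
rewrite (min_r (le_trans uv vb)) (max_r au) (min_r vb) (max_r (le_trans au uv)).
rewrite EFinD EFinN addeC !fineK// quantile_fin_num//.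
  exact: le_lt_trans v1.
exact: lt_le_trans uv.
Qed.

End quantile_measure.

(* The integrand is extended-valued only at u = 0 or u = 1. *)
Definition centering (R : realType) (F : R -> \bar R) (J : R -> R) (a b : R) :
    R :=
  fine (\int[lebesgue_measure]_(u in `[a, b]) ((J u)%:E * quantile F u))%E.

Definition scale (d : measure_display) (T : measurableType d) (R : realType)
    (P : probability T R) (X : {RV P >-> R}) (J : R -> R) (a b : R) : R :=
  let dQ := quantile_measure X a b in
  Num.sqrt (\int[dQ]_(v in `[a, b[) \int[dQ]_(u in `[a, b[)
    (J u * J v * (Num.min u v - u * v))).

Definition weight0 (R : realType) (J : R -> R) (i n : nat) : R :=
  n%:R * \int[lebesgue_measure]_(u in `[(i.-1)%:R / n%:R, i%:R / n%:R]) J u.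

Definition trimmed_L (R : realType) (k m : nat -> nat) (c : nat -> nat -> R)
    (x : nat -> R) (n : nat) : R :=
  n%:R^-1 * \sum_((k n).+1 <= i < (n - m n).+1) c i n * order_stat x n i.

Definition normal_cdf (R : realType) (x : R) : R :=
  fine (normal_prob 0 1 `]-oo, x]).

(* f n x = g n x * (1 + o(1)) as n -> oo, uniformly in x \in D n. *)
Definition unif_equivalent (R : realType) (D : nat -> set R)
    (f g : nat -> R -> R) : Prop :=
  exists r : nat -> R -> R,
    (forall e : R, 0 < e ->
       \forall n \near \oo, forall x, D n x -> `|r n x| <= e) /\
    (\forall n \near \oo, forall x, D n x -> f n x = g n x * (1 + r n x)).

(* Main.v *)
Require Import Defs.
From mathcomp Require Import all_boot all_order all_algebra.
From mathcomp Require Import all_classical all_reals all_analysis.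
From mathcomp Require Import measurable_realfun.
From mathcomp Require Import ring lra.

Set Implicit Arguments.
Unset Strict Implicit.
Unset Printing Implicit Defensive.

Import Order.TTheory GRing.Theory Num.Theory.
Import numFieldNormedType.Exports.

Local Open Scope classical_set_scope.
Local Open Scope ring_scope.

(* Write H for the antiderivative of J. Up to the weight error, summation by parts
   turns L_n - mu_n into minus the integral of H(F_n(t)) - H(F(t)), with arguments
   clipped to the trimmed range, where F_n is the empirical distribution function.
   Off an event of probability O(n^{1/3} exp(- n^{1/3} / 20)) one has
   |F_n - F| = O(n^{-1/3}) uniformly, so that, J and (near the trimming points) F^{-1}
   being Lipschitz, replacing the integrand by its first-order part costs only
   O(n^{-2/3}). The first-order part is an average of bounded centered independent
   variables Y_i, and their variance is sigma^2 because dF^{-1} is the image of the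
   Lebesgue measure by F. After scaling, the error O(n^{-1/6}) shifts x by an amount
   that does not matter for x = o(n^{1/6}).
   For the sum of the Y_i, the tail is compared with the Gaussian one by Lindeberg's
   replacement method in its heat-equation form, where each remainder carries an
   exponential tilt exp(lam (S - x)), lam = max(x, 0), integrated by the moment
   generating function: this makes the errors relative to exp(- x^2 / 2). *)

(** * Gaussian tails and the heat equation *)

(** The exponents come from one balance. Against a tail of size exp(- x^2 / 2) with x = o(n^{1/6}),
    an exceptional event must have probability of order exp(- c n^{1/3}), and exponential
    inequalities for F_n - F give this at deviations of order n^{-1/3}. The quadratic error n^{-2/3}
    becomes n^{-1/6} after multiplication by sqrt n, and a shift h of x costs a factor exp(x h),
    bounded as long as x = O(n^{1/6}). The rates assumed for the trimming and for the weights
    produce errors of this same order. An absolute normal approximation says nothing in this range: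
    each remainder must be small relative to the tail. Tilting yields errors delta * exp(- x^2 / 2),
    and the Mills-type lower bound for 1 - Phi then loses a factor 1 + lam; the scales (p =
    n^{1/12}, smoothing width p^{-3}, cut-off p) leave room for it. The X_i may have no moments: all
    integrals in t run between the quantiles of order alpha / 2 and 1 - beta / 2, which keeps the
    influence function bounded and exponential moments available. *)

Section gaussian.
Context {R : realType}.
Implicit Types x y z : R.
Notation mu := (@lebesgue_measure R).

Definition gauss_pdf x : R := normal_peak 1 * expR (- (x ^+ 2 / 2)).

Definition normal_tail x : R := 1 - normal_cdf x.

Lemma normal_pdf01E : normal_pdf 0 1 = gauss_pdf.
Proof.
apply/funext => x; rewrite normal_pdfE ?oner_neq0// /gauss_pdf /normal_fun.
by rewrite subr0 expr1n mulNr.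
Qed.

Lemma normal_peak1_gt0 : 0 < normal_peak 1 :> R.
Proof. by rewrite normal_peak_gt0 ?oner_neq0. Qed.

Lemma normal_peak1_le1 : normal_peak 1 <= 1 :> R.
Proof.
rewrite /normal_peak invf_le1 ?sqrtr_gt0; last first.
  by rewrite expr1n mul1r mulrn_wgt0// pi_gt0.
rewrite -[leLHS]sqrtr1 ler_wsqrtr// expr1n mul1r.
by have := pi_ge2 R; lra.
Qed.

Lemma gauss_pdf_gt0 x : 0 < gauss_pdf x.
Proof. by rewrite mulr_gt0 ?normal_peak1_gt0 ?expR_gt0. Qed.

Lemma gauss_pdf_le x : gauss_pdf x <= expR (- (x ^+ 2 / 2)).
Proof. by rewrite ler_piMl ?expR_ge0 ?normal_peak1_le1. Qed.

Lemma continuous_gauss_pdf : continuous gauss_pdf.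
Proof. by rewrite -normal_pdf01E; exact: continuous_normal_pdf (oner_neq0 _). Qed.

Lemma measurable_gauss_pdf : measurable_fun setT gauss_pdf.
Proof. by rewrite -normal_pdf01E; exact: measurable_normal_pdf. Qed.

Lemma integrable_gauss_pdf (A : set R) : measurable A ->
  mu.-integrable A (EFin \o gauss_pdf).
Proof.
move=> mA; rewrite -normal_pdf01E.
by apply: (integrableS measurableT) => //; exact: integrable_normal_pdf.
Qed.

Lemma normal_cdfE x : normal_cdf x = \int[mu]_(t in `]-oo, x]) gauss_pdf t.
Proof. by rewrite /normal_cdf /normal_prob normal_pdf01E. Qed.

Lemma is_derive_normal_cdf x : is_derive x 1 (@normal_cdf R) (gauss_pdf x).
Proof.
have -> : @normal_cdf R = fun x => \int[mu]_(t in [set` `]-oo, x]]) gauss_pdf t.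
  by apply/funext => ?; exact: normal_cdfE.
have xx1 : x < x + 1 by rewrite ltrDl.
have [|d e] := @continuous_FTC1 R gauss_pdf -oo%O x (x + 1) xx1
  (integrable_gauss_pdf (measurable_itv _)) _ (@continuous_gauss_pdf x).
  by rewrite ltNyr.
split; first exact: d.
by rewrite -e derive1E.
Qed.

Lemma is_derive_normal_tail x : is_derive x 1 normal_tail (- gauss_pdf x).
Proof.
have d := is_derive_normal_cdf x.
rewrite -[- _]sub0r.
exact: (@is_deriveB R R^o R^o (cst 1) (@normal_cdf R) x 1 0 _ (is_derive_cst _ _ _) d).
Qed.

Lemma normal_tailE x : normal_tail x = \int[mu]_(t in `]x, +oo[) gauss_pdf t.
Proof.
have := probability_setT (normal_prob (0 : R) 1).
rewrite -(itv_setU_setT false x) measureU//=; last first.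
  by apply/seteqP; split => // t [] /=; rewrite !in_itv/= andbT leNgt => /negP.
rewrite -[X in (X + _)%E]fineK ?fin_num_measure//.
rewrite -[X in (_ + X)%E]fineK ?fin_num_measure//.
move=> [] e; rewrite /normal_tail -e /normal_cdf [X in X - _]addrC addrK.
by rewrite /normal_prob normal_pdf01E.
Qed.

Lemma normal_cdfN x : normal_cdf (- x) = normal_tail x.
Proof.
rewrite normal_cdfE normal_tailE /Rintegral ge0_integration_by_substitutionNy//.
- rewrite integral_itv_obnd_cbnd; last first.
    apply/measurable_EFinP/measurable_funTS.
    exact: measurable_gauss_pdf.
  by congr fine; apply: eq_integral => t _ /=; rewrite /gauss_pdf sqrrN.
- exact/continuous_subspaceT/continuous_gauss_pdf.
- by move=> t _; rewrite ltW ?gauss_pdf_gt0.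
Qed.


Lemma normal_tail_gt0_le1 x : 0 <= normal_tail x <= 1.
Proof.
have c0 : 0 <= normal_cdf x by rewrite fine_ge0.
have c1 : normal_cdf x <= 1.
  by rewrite -lee_fin fineK ?fin_num_measure// probability_le1.
by rewrite /normal_tail; lra.
Qed.

Lemma normal_tail_decr x y : x <= y -> normal_tail y <= normal_tail x.
Proof.
move=> xy; rewrite lerB// fine_le ?fin_num_measure//.
rewrite le_measure ?inE//; apply: subset_itvl.
by rewrite bnd_simp.
Qed.

Lemma normal_tail_MVT x y : x <= y ->
  exists2 t, t \in `[x, y]%R & normal_tail x - normal_tail y = gauss_pdf t * (y - x).
Proof.
move=> xy.
have [||t txy e] := @MVT_segment R normal_tail (fun t => - gauss_pdf t) x y xy.
- by move=> t _; exact: is_derive_normal_tail.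
- apply: continuous_subspaceT => t; apply: differentiable_continuous.
  by apply/derivable1_diffP; have [] := is_derive_normal_tail t.
by exists t => //; rewrite -opprB e mulNr opprK.
Qed.

(* Shifting the density, [1_{t > z} phi(t) <= e^{-z^2/2} phi(t - z)]. *)
Lemma normal_tail_expR z : 0 <= z -> normal_tail z <= expR (- (z ^+ 2 / 2)).
Proof.
move=> z0; rewrite normal_tailE.
have iz := @integrable_normal_pdf R z 1.
apply: (@le_trans _ _ (\int[mu]_(t in `]z, +oo[) (expR (- (z ^+ 2 / 2)) * normal_pdf z 1 t))).
  apply: le_Rintegral => //; first exact: integrable_gauss_pdf.
    apply: (@eq_integrable _ _ _ mu _ _ (fun t => (expR (- (z ^+ 2 / 2)))%:E * (normal_pdf z 1 t)%:E)%E) => //.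
    by apply: integrableZl => //; exact: (integrableS measurableT).
  move=> t /=; rewrite in_itv/= andbT => zt.
  rewrite normal_pdfE ?oner_neq0// /normal_fun mulrCA.
  rewrite ler_wpM2l ?normal_peak_ge0// -expRD ler_expR expr1n.
  have : 0 <= z * (t - z) by rewrite mulr_ge0 ?subr_ge0// ltW.
  by rewrite -subr_ge0 => h; rewrite -subr_ge0; lra.
rewrite RintegralZl//; last exact: (integrableS measurableT).
rewrite ler_piMr ?expR_ge0// -[leRHS]/(fine 1%:E) fine_le//.
- rewrite ge0_fin_numE; last by apply: integral_ge0 => t _; rewrite lee_fin normal_pdf_ge0.
  apply: (@le_lt_trans _ _ 1%E); last exact: ltry.
  rewrite -(@integral_normal_pdf R z 1); apply: ge0_subset_integral => //.
    by apply/measurable_EFinP; exact: measurable_normal_pdf.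
  by move=> t _; rewrite lee_fin normal_pdf_ge0.
- rewrite -(@integral_normal_pdf R z 1); apply: ge0_subset_integral => //.
    by apply/measurable_EFinP; exact: measurable_normal_pdf.
  by move=> t _; rewrite lee_fin normal_pdf_ge0.
Qed.

End gaussian.

(** * Taylor remainders from the mean value inequality *)

Section taylor.
Context {R : realType}.
Implicit Types (f g : R -> R) (u v t M : R).

(** The hypotheses concern the whole ball around [u] of radius [|v - u|], so that [v] may lie on
    either side of [u] and the bound can be applied again inside the same ball. *)
Lemma mean_value_le f df u v M :
  (forall t, `|t - u| <= `|v - u| -> is_derive t 1 f (df t)) ->
  (forall t, `|t - u| <= `|v - u| -> `|df t| <= M) ->
  `|f v - f u| <= M * `|v - u|.
Proof.
move=> fd dfM.
have between t : t \in `[Num.min u v, Num.max u v]%R -> `|t - u| <= `|v - u|.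
  rewrite in_itv/= => /andP[].
  by case: (leP u v) => uv ? ?; [rewrite !ger0_norm|rewrite !ler0_norm]; lra.
have [|||t tuv e] := @MVT_segment R f df (Num.min u v) (Num.max u v).
- by rewrite ge_min le_max lexx.
- move=> t /subset_itv_oo_cc /between; exact: fd.
- apply: derivable_within_continuous => t /between /fd [].
  by [].
have : `|f (Num.max u v) - f (Num.min u v)| <= M * `|Num.max u v - Num.min u v|.
  by rewrite e normrM ler_wpM2r// dfM// between.
by case: (leP u v) => uv //; rewrite distrC [`|u - v|]distrC.
Qed.

Lemma taylor2_le g g1 g2 u v M :
  (forall t, `|t - u| <= `|v - u| -> is_derive t 1 g (g1 t)) ->
  (forall t, `|t - u| <= `|v - u| -> is_derive t 1 g1 (g2 t)) ->
  (forall t, `|t - u| <= `|v - u| -> `|g2 t| <= M) ->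
  `|g v - g u - (v - u) * g1 u| <= M * `|v - u| ^+ 2.
Proof.
move=> gd g1d g2M.
have dd t : `|t - u| <= `|v - u| ->
    is_derive t 1 (fun t => g t - (t - u) * g1 u) (g1 t - g1 u).
  move=> tu; have ? := gd t tu.
  by apply: is_derive_eq; rewrite /GRing.scale/= subr0 !mulr1 mulr0 add0r.
have := mean_value_le (M := M * `|v - u|) dd _.
rewrite subrr mul0r subr0 -mulrA -expr2 => h.
rewrite addrAC; apply: h => t tu.
apply: (@le_trans _ _ (M * `|t - u|)).
  apply: (@mean_value_le _ g2) => w wt; [apply: g1d|apply: g2M]; exact: le_trans tu.
rewrite ler_wpM2l//; apply: le_trans (g2M u _) => //.
by rewrite subrr normr0.
Qed.

Lemma taylor3_le g g1 g2 g3 u v M :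
  (forall t, `|t - u| <= `|v - u| -> is_derive t 1 g (g1 t)) ->
  (forall t, `|t - u| <= `|v - u| -> is_derive t 1 g1 (g2 t)) ->
  (forall t, `|t - u| <= `|v - u| -> is_derive t 1 g2 (g3 t)) ->
  (forall t, `|t - u| <= `|v - u| -> `|g3 t| <= M) ->
  `|g v - g u - (v - u) * g1 u - (v - u) ^+ 2 / 2 * g2 u| <= M * `|v - u| ^+ 3.
Proof.
move=> gd g1d g2d g3M.
have dd t : `|t - u| <= `|v - u| ->
    is_derive t 1 (fun t => g t - (t - u) * g1 u - (t - u) ^+ 2 / 2 * g2 u)
      (g1 t - g1 u - (t - u) * g2 u).
  move=> tu; have ? := gd t tu.
  apply: is_derive_eq; rewrite /GRing.scale/= subr0 !mulr1 !mulr0 !add0r.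
  by field.
have := mean_value_le (M := M * `|v - u| ^+ 2) dd _.
rewrite subrr mul0r !subr0 expr0n/= !mul0r subr0 -[leRHS]mulrA -exprSr => h.
rewrite (_ : _ - _ - _ - _ = g v - (v - u) * g1 u - (v - u) ^+ 2 / 2 * g2 u - g u); last by ring.
apply: h => t tu.
apply: (@le_trans _ _ (M * `|t - u| ^+ 2)).
  apply: (@taylor2_le _ _ g3) => w wt; [apply: g1d|apply: g2d|apply: g3M]; exact: le_trans tu.
rewrite ler_wpM2l//; last by rewrite lerXn2r ?nnegrE.
by apply: le_trans (g3M u _) => //; rewrite subrr normr0.
Qed.

End taylor.

(** * The heat equation and exponentially tilted bounds *)

Section heat.
Context {R : realType}.
Implicit Types (x z q u s t lam : R).

Lemma is_derive_gauss_pdf z : is_derive z 1 (@gauss_pdf R) (- (z * gauss_pdf z)).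
Proof.
have h : is_derive z 1 (fun x : R => expR (- (x ^+ 2 / 2)))
    (expR (- (z ^+ 2 / 2)) * (- z)).
  apply: (@is_derive1_comp R expR (fun x : R => - (x ^+ 2 / 2))).
  apply: is_derive_eq; rewrite /GRing.scale/=.
  by field.
rewrite (_ : - _ = normal_peak 1 *: (expR (- (z ^+ 2 / 2)) * (- z))); last first.
  by rewrite /GRing.scale/= /gauss_pdf; ring.
exact: (@is_deriveZ R R^o R^o _ _ _ _ _ h).
Qed.

(* [e^{-z^2/2} = e^{- q z + q^2/2} e^{-(z - q)^2/2}]: the factor [e^{- q z}] will
   be integrated with the moment generating function, while [z - q] stays of
   order one. *)
Let tilt z q : expR (- (z ^+ 2 / 2)) =
  expR (- (q * z) + q ^+ 2 / 2) * expR (- ((z - q) ^+ 2 / 2)).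
Proof. by rewrite -expRD; congr expR; field. Qed.

Let sqr_expR (d : R) : d ^+ 2 * expR (- (d ^+ 2 / 2)) <= 2.
Proof.
rewrite expRN ler_pdivrMr ?expR_gt0//.
by have := expR_ge1Dx (d ^+ 2 / 2); lra.
Qed.

Let pow4_expR (d : R) : d ^+ 4 * expR (- (d ^+ 2 / 2)) <= 8.
Proof.
rewrite expRN ler_pdivrMr ?expR_gt0//.
have d0 : 0 <= d ^+ 2 / 2 by rewrite divr_ge0// sqr_ge0.
have := expR_ge1Dxn 1 d0; rewrite (_ : d ^+ 4 = (d ^+ 2) ^+ 2); last by ring.
by rewrite expr_div_n; set y := _ ^+ 2; set e := expR _; rewrite (_ : (2`!%:R : R) = 2)//; lra.
Qed.

(** Write [z = q + d]: after the tilt the factor exp(- d^2 / 2) remains and absorbs the powers of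
    [d], so that only powers of [q] survive. *)
Lemma tilt_sqr_le z q : `|1 - z ^+ 2| * gauss_pdf z <=
  6 * (1 + q ^+ 2) * expR (- (q * z) + q ^+ 2 / 2).
Proof.
apply: (@le_trans _ _ ((1 + z ^+ 2) * expR (- (z ^+ 2 / 2)))).
  apply: ler_pM => //; first exact/ltW/gauss_pdf_gt0.
    by rewrite (le_trans (ler_normB _ _))// normr1 ger0_norm ?sqr_ge0.
  exact: gauss_pdf_le.
rewrite (tilt z q) mulrCA [leRHS]mulrC ler_wpM2l ?expR_ge0//.
set d := z - q; have zE : z = q + d by rewrite /d; ring.
have := sqr_expR d; have : expR (- (d ^+ 2 / 2)) <= 1.
  by rewrite -expR0 ler_expR oppr_le0 divr_ge0// sqr_ge0.
have := expR_ge0 (- (d ^+ 2 / 2)); set e := expR _ => e0 e1 ed.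
have : z ^+ 2 * e <= (2 * q ^+ 2 + 2 * d ^+ 2) * e.
  rewrite ler_wpM2r// zE -subr_ge0.
  by rewrite (_ : _ - _ = (q - d) ^+ 2) ?sqr_ge0//; ring.
have : q ^+ 2 * e <= q ^+ 2 by rewrite ler_piMr ?sqr_ge0.
by have := sqr_ge0 q; lra.
Qed.

Lemma tilt_pow4_le z q : (1 + z ^+ 4) * gauss_pdf z <=
  65 * (1 + q ^+ 4) * expR (- (q * z) + q ^+ 2 / 2).
Proof.
have pow4 (a : R) : 0 <= a ^+ 4 by rewrite (_ : a ^+ 4 = (a ^+ 2) ^+ 2) ?sqr_ge0//; ring.
apply: (@le_trans _ _ ((1 + z ^+ 4) * expR (- (z ^+ 2 / 2)))).
  by rewrite ler_wpM2l ?addr_ge0 ?gauss_pdf_le.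
rewrite (tilt z q) mulrCA [leRHS]mulrC ler_wpM2l ?expR_ge0//.
set d := z - q; have zE : z = q + d by rewrite /d; ring.
have := pow4_expR d; have : expR (- (d ^+ 2 / 2)) <= 1.
  by rewrite -expR0 ler_expR oppr_le0 divr_ge0// sqr_ge0.
have := expR_ge0 (- (d ^+ 2 / 2)); set e := expR _ => e0 e1 ed.
have : z ^+ 4 * e <= (8 * q ^+ 4 + 8 * d ^+ 4) * e.
  rewrite ler_wpM2r// zE -subr_ge0.
  rewrite (_ : _ - _ = 4 * (q ^+ 2 - d ^+ 2) ^+ 2 +
    (2 * q ^+ 2 + 2 * d ^+ 2 + (q + d) ^+ 2) * (q - d) ^+ 2); last by ring.
  by do ?[exact: sqr_ge0 | exact: ler0n | apply: addr_ge0 | apply: mulr_ge0].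
have : q ^+ 4 * e <= q ^+ 4 by rewrite ler_piMr.
by have := pow4 q; lra.
Qed.

(* The probability that a centered Gaussian of variance [s] exceeds [u]; it solves
   the heat equation [2 d/ds = d^2/du^2], with derivatives in [u] as follows. *)
Definition heat u s : R := normal_tail (u / Num.sqrt s).

Definition heat_u u s : R := - (gauss_pdf (u / Num.sqrt s) / Num.sqrt s).

Definition heat_uu u s : R :=
  (u / Num.sqrt s) * gauss_pdf (u / Num.sqrt s) / s.

Let heat_uuu u s : R :=
  (1 - (u / Num.sqrt s) ^+ 2) * gauss_pdf (u / Num.sqrt s) / (s * Num.sqrt s).

(** The second derivative in [s], equal by the heat equation to a quarter of the fourth derivative
    in [u]. *)
Let heat_ss u s : R :=
  ((u / Num.sqrt s) ^+ 3 - 3 * (u / Num.sqrt s)) * gauss_pdf (u / Num.sqrt s)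
  / (4 * s ^+ 2).

Let is_derive_div (r u : R) : is_derive u 1 (fun u => u / r) r^-1.
Proof.
by apply: is_derive_eq; rewrite /GRing.scale/= mulr0 add0r mulr1.
Qed.

Let is_derive_pdf_div (r u : R) :
  is_derive u 1 (fun u => gauss_pdf (u / r)) (- (u / r * gauss_pdf (u / r)) * r^-1).
Proof.
apply: (@is_derive1_comp R (@gauss_pdf R) (fun u : R => u / r)).
  exact: is_derive_gauss_pdf.
exact: is_derive_div.
Qed.

Let is_derive_heat u s : 0 < s -> is_derive u 1 (heat^~ s) (heat_u u s).
Proof.
move=> s0; rewrite /heat_u -mulNr.
apply: (@is_derive1_comp R (@normal_tail R) (fun u : R => u / Num.sqrt s)).
  exact: is_derive_normal_tail.
exact: is_derive_div.
Qed.

Let is_derive_heat_u u s : 0 < s -> is_derive u 1 (heat_u^~ s) (heat_uu u s).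
Proof.
move=> s0; have r0 : 0 < Num.sqrt s by rewrite sqrtr_gt0.
have h := is_derive_pdf_div (Num.sqrt s) u.
rewrite /heat_u; apply: is_derive_eq; rewrite /GRing.scale/= /heat_uu.
have -> : s^-1 = (Num.sqrt s ^+ 2)^-1 by rewrite sqr_sqrtr// ltW.
field; by rewrite gt_eqF.
Qed.

Let is_derive_heat_uu u s : 0 < s -> is_derive u 1 (heat_uu^~ s) (heat_uuu u s).
Proof.
move=> s0; have r0 : 0 < Num.sqrt s by rewrite sqrtr_gt0.
have h := is_derive_pdf_div (Num.sqrt s) u.
rewrite /heat_uu; apply: is_derive_eq; rewrite /GRing.scale/= /heat_uuu; field.
by rewrite !gt_eqF.
Qed.

Let is_derive_z u s : 0 < s ->
  is_derive s 1 (fun s => u / Num.sqrt s) (- (u / Num.sqrt s) / (2 * s)).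
Proof.
move=> s0; have r0 : 0 < Num.sqrt s by rewrite sqrtr_gt0.
have h := is_derive1_sqrt s0.
have h2 := @is_deriveV R Num.sqrt s _ 1 (lt0r_neq0 r0) h.
apply: is_derive_eq; rewrite /GRing.scale/=.
have -> : (2 * s)^-1 = (2 * Num.sqrt s ^+ 2)^-1 by rewrite sqr_sqrtr// ltW.
field; by rewrite gt_eqF.
Qed.

Let is_derive_pdf_z u s : 0 < s ->
  is_derive s 1 (fun s => gauss_pdf (u / Num.sqrt s))
    (- (u / Num.sqrt s * gauss_pdf (u / Num.sqrt s)) * (- (u / Num.sqrt s) / (2 * s))).
Proof.
move=> s0; apply: (@is_derive1_comp R (@gauss_pdf R) (fun s : R => u / Num.sqrt s)).
  exact: is_derive_gauss_pdf.
exact: is_derive_z.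
Qed.

(** The heat equation: it lets the second-order term of the expansion in [u] be compensated by the
    first-order term in the variance. *)
Let is_derive_heat_s u s : 0 < s ->
  is_derive s 1 (heat u) (heat_uu u s / 2).
Proof.
move=> s0; rewrite (_ : _ / 2 =
  (- gauss_pdf (u / Num.sqrt s)) * (- (u / Num.sqrt s) / (2 * s))); last first.
  by rewrite /heat_uu; field; rewrite !gt_eqF// sqrtr_gt0.
apply: (@is_derive1_comp R (@normal_tail R) (fun s : R => u / Num.sqrt s)).
  exact: is_derive_normal_tail.
exact: is_derive_z.
Qed.

Let is_derive_heat_uu_s u s : 0 < s ->
  is_derive s 1 (fun s => heat_uu u s / 2) (heat_ss u s).
Proof.
move=> s0; have r0 : 0 < Num.sqrt s by rewrite sqrtr_gt0.
have h1 := is_derive_z u s0; have h2 := is_derive_pdf_z u s0.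
have h3 := @is_deriveV R id s _ 1 (lt0r_neq0 s0) (is_derive_id _ _).
rewrite /heat_uu; apply: is_derive_eq; rewrite /GRing.scale/= /heat_ss; field.
by rewrite !gt_eqF.
Qed.


(** With [q = lam * Num.sqrt s] the tilt is linear in [u], with a slope independent of [s]: the form
    needed to integrate it with a moment generating function. *)
Let tiltE u s lam : 0 < s ->
  expR (- (lam * Num.sqrt s * (u / Num.sqrt s)) + (lam * Num.sqrt s) ^+ 2 / 2) =
  expR (- (lam * u) + lam ^+ 2 * s / 2).
Proof.
move=> s0; have r0 : 0 < Num.sqrt s by rewrite sqrtr_gt0.
rewrite exprMn sqr_sqrtr ?ltW//; congr expR; congr (- _ + _).
by field; rewrite gt_eqF.
Qed.

Let heat_uuu_le u s lam : 0 < s -> `|heat_uuu u s| <=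
  6 * (1 + lam ^+ 2 * s) / (s * Num.sqrt s) * expR (- (lam * u) + lam ^+ 2 * s / 2).
Proof.
move=> s0; have r0 : 0 < Num.sqrt s by rewrite sqrtr_gt0.
have sr0 : 0 < s * Num.sqrt s by rewrite mulr_gt0.
rewrite /heat_uuu 2!normrM normfV (gtr0_norm sr0) [leRHS]mulrAC ler_wpM2r ?invr_ge0 ?(ltW sr0)//.
rewrite (gtr0_norm (gauss_pdf_gt0 _)).
have := tilt_sqr_le (u / Num.sqrt s) (lam * Num.sqrt s).
by rewrite tiltE// [(lam * _) ^+ 2]exprMn sqr_sqrtr// ltW.
Qed.

Let heat_ss_le u s lam : 0 < s -> `|heat_ss u s| <=
  65 * (1 + lam ^+ 4 * s ^+ 2) / s ^+ 2 * expR (- (lam * u) + lam ^+ 2 * s / 2).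
Proof.
move=> s0; have s2 : 0 < s ^+ 2 by rewrite exprn_gt0.
rewrite /heat_ss 2!normrM normfV (gtr0_norm (gauss_pdf_gt0 _)).
have s42 : 0 < 4 * s ^+ 2 by rewrite mulr_gt0.
rewrite (gtr0_norm s42) invfM [leLHS]mulrA [leRHS]mulrAC ler_wpM2r ?invr_ge0 ?(ltW s2)//.
have := tilt_pow4_le (u / Num.sqrt s) (lam * Num.sqrt s).
rewrite tiltE// [(lam * _) ^+ 4]exprMn (_ : Num.sqrt s ^+ 4 = (Num.sqrt s ^+ 2) ^+ 2); last by ring.
rewrite sqr_sqrtr; last exact: ltW.
apply: le_trans.
set z := u / _; rewrite mulrAC ler_wpM2r ?(ltW (gauss_pdf_gt0 _))//.
rewrite ler_pdivrMr//.
(* Odd powers of [z] are absorbed by even ones, giving |z|^3 + 3 |z| <= 4 (1 + z^4). *)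
have h1 : `|z| * 2 <= 1 + z ^+ 2.
  rewrite -(real_normK (num_real z)) -subr_ge0.
  by rewrite (_ : _ - _ = (1 - `|z|) ^+ 2) ?sqr_ge0//; ring.
have h2 : z ^+ 2 * 2 <= 1 + z ^+ 4.
  by rewrite -subr_ge0 (_ : _ - _ = (1 - z ^+ 2) ^+ 2) ?sqr_ge0//; ring.
have h3 : `|z| ^+ 3 * 2 <= z ^+ 2 + z ^+ 4.
  have -> : z ^+ 4 = (z ^+ 2) ^+ 2 by ring.
  rewrite -(real_normK (num_real z)) -subr_ge0.
  by rewrite (_ : _ - _ = (`|z| - `|z| ^+ 2) ^+ 2) ?sqr_ge0//; ring.
rewrite (le_trans (ler_normB _ _))// normrX (_ : `|3 * z| = 3 * `|z|); last first.
  by rewrite normrM normr_nat.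
have h4 : 0 <= z ^+ 4 by rewrite (_ : z ^+ 4 = (z ^+ 2) ^+ 2) ?sqr_ge0//; ring.
by lra.
Qed.

(* Locked so that the numeral is never unfolded in unary. *)
Definition heat_cst : R := locked 6000.

Lemma heat_cst_ge0 : 0 <= heat_cst.
Proof. by rewrite /heat_cst -lock; lra. Qed.

(* One Lindeberg step: a bounded increment [xi] against a Gaussian one of
   variance [t], up to terms that vanish in mean when [xi] is centered of
   variance [t]. *)
Lemma heat_step u xi s t lam eta :
  0 < t -> 2 * t <= s -> `|xi| <= eta -> 0 <= lam -> lam * eta <= 1 ->
  `|heat (u - xi) s - heat u (s + t) + xi * heat_u u s
     - (xi ^+ 2 - t) / 2 * heat_uu u s| <=
  heat_cst * expR (- (lam * u) + lam ^+ 2 * (s + t) / 2) *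
    (eta ^+ 3 * (1 + lam ^+ 2 * s) / (s * Num.sqrt s)
     + t ^+ 2 * (1 + lam ^+ 4 * s ^+ 2) / s ^+ 2).
Proof.
move=> t0 ts xieta lam0 lameta; have s0 : 0 < s by lra.
have r0 : 0 < Num.sqrt s by rewrite sqrtr_gt0.
have sr0 : 0 < s * Num.sqrt s by rewrite mulr_gt0.
have e4 : expR 1 <= 4 :> R.
  have -> : expR 1 = (expR (- (1 / 2)))^-1 ^+ 2 :> R.
    by rewrite -expRN -expRM_natl; congr expR; field.
  have h := @expR_ge1Dx R (- (1 / 2)).
  have hi : (expR (- (1 / 2)))^-1 <= 2 :> R.
    by rewrite invf_ple ?posrE ?expR_gt0//; lra.
  by rewrite (_ : 4 = 2 ^+ 2 :> R) ?lerXn2r ?nnegrE ?invr_ge0 ?expR_ge0//; ring.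
set E := expR _; have E0 : 0 <= E by exact: expR_ge0.
(* Here 24 is 6 times the bound 4 on exp(1), which pays for moving [u] by at most [eta] under the
   tilt. In [B], the variance stays between s / 2 and 2 s, which costs the factors 16 and 4 over
   65. *)
pose A := 24 * E * (1 + lam ^+ 2 * s) / (s * Num.sqrt s).
pose B := 65 * 64 * E * (1 + lam ^+ 4 * s ^+ 2) / s ^+ 2.
have stepA : `|heat (u - xi) s - heat u s + xi * heat_u u s - xi ^+ 2 / 2 * heat_uu u s|
    <= A * `|xi| ^+ 3.
  have := @taylor3_le R (heat^~ s) (heat_u^~ s) (heat_uu^~ s) (heat_uuu^~ s) u (u - xi) A
    (fun t _ => is_derive_heat t s0) (fun t _ => is_derive_heat_u t s0)
    (fun t _ => is_derive_heat_uu t s0).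
  rewrite (_ : u - xi - u = - xi); last by ring.
  rewrite normrN sqrrN mulNr opprK; apply => v vu.
  apply: le_trans (heat_uuu_le v lam s0) _.
  have -> : A = 6 * (1 + lam ^+ 2 * s) / (s * Num.sqrt s) * (4 * E) by rewrite /A; ring.
  apply: ler_wpM2l.
    by rewrite !mulr_ge0 ?invr_ge0 ?addr_ge0 ?mulr_ge0 ?exprn_ge0// ltW.
  apply: (@le_trans _ _ (expR 1 * E)); last by rewrite ler_wpM2r.
  rewrite -expRD ler_expR.
  have h1 : lam * (u - v) <= 1.
    apply: le_trans lameta; rewrite ler_wpM2l// (le_trans (ler_norm _))//.
    by rewrite distrC (le_trans vu).
  have h2 : 0 <= lam ^+ 2 * t by rewrite mulr_ge0 ?sqr_ge0// ltW.
  by lra.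
have stepB : `|heat u (s + t) - heat u s - t * (heat_uu u s / 2)| <= B * t ^+ 2.
  have pos v : `|v - s| <= `|s + t - s| -> s / 2 <= v <= s + t.
    rewrite (_ : s + t - s = t); last by ring.
    by rewrite (gtr0_norm t0) ler_distlC => /andP[]; lra.
  have := @taylor2_le R (heat u) (fun s => heat_uu u s / 2) (heat_ss u) s (s + t) B.
  rewrite (_ : s + t - s = t); last by ring.
  rewrite (gtr0_norm t0); apply => v.
  - move=> vs; apply: is_derive_heat_s; have := pos v.
    by rewrite (_ : s + t - s = t) ?(gtr0_norm t0); [move=> /(_ vs); lra|ring].
  - move=> vs; apply: is_derive_heat_uu_s; have := pos v.
    by rewrite (_ : s + t - s = t) ?(gtr0_norm t0); [move=> /(_ vs); lra|ring].
  move=> vs; have /andP[v1 v2] : s / 2 <= v <= s + t.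
    by apply: pos; rewrite (_ : s + t - s = t) ?(gtr0_norm t0)//; ring.
  have v0 : 0 < v by lra.
  apply: le_trans (heat_ss_le u lam v0) _.
  rewrite /B.
  have -> : 65 * 64 * E * (1 + lam ^+ 4 * s ^+ 2) / s ^+ 2 =
    (65 * (16 * (1 + lam ^+ 4 * s ^+ 2)) * (4 / s ^+ 2)) * E by ring.
  apply: ler_pM.
  - by rewrite !mulr_ge0 ?invr_ge0 ?addr_ge0 ?mulr_ge0 ?exprn_ge0// ltW.
  - exact: expR_ge0.
  - apply: ler_pM.
    + by rewrite !mulr_ge0 ?addr_ge0 ?mulr_ge0 ?exprn_ge0// ltW.
    + by rewrite invr_ge0 exprn_ge0// ltW.
    + rewrite ler_wpM2l//.
      have vs4 : v ^+ 2 <= 4 * s ^+ 2.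
        rewrite (_ : 4 * s ^+ 2 = (2 * s) ^+ 2); last by ring.
        by rewrite lerXn2r ?nnegrE//; lra.
      have := ler_wpM2l (exprn_ge0 4 lam0) vs4.
      have : 0 <= lam ^+ 4 * s ^+ 2 by rewrite mulr_ge0 ?exprn_ge0// ltW.
      by lra.
    + rewrite -invf_div lef_pV2 ?posrE ?divr_gt0 ?exprn_gt0//.
      rewrite (_ : s ^+ 2 / 4 = (s / 2) ^+ 2); last by field.
      by rewrite lerXn2r ?nnegrE//; lra.
  - rewrite ler_expR lerD2l ler_wpM2r// ler_wpM2l ?sqr_ge0//.
(* Both expansions are centred at [(u, s)]; by the heat equation the second-order term in space and
   the first-order term in time carry the same [heat_uu]. *)
have split_step (h0 h1 h2 a b : R) : h1 - h2 + a - (xi ^+ 2 - t) / 2 * b =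
    (h1 - h0 + a - xi ^+ 2 / 2 * b) - (h2 - h0 - t * (b / 2)) by ring.
rewrite (split_step (heat u s)).
rewrite (le_trans (ler_normB _ _))// (le_trans (lerD stepA stepB))//.
have A0 : 0 <= A.
  by rewrite !mulr_ge0 ?invr_ge0 ?addr_ge0 ?mulr_ge0 ?exprn_ge0// ltW.
have eta0 : 0 <= eta by rewrite (le_trans _ xieta).
have xi3 : `|xi| ^+ 3 <= eta ^+ 3 by rewrite lerXn2r ?nnegrE// (le_trans _ xieta).
rewrite (le_trans (lerD (ler_wpM2l A0 xi3) (lexx _)))//.
rewrite mulrDr; apply: lerD.
  have Y0 : 0 <= E * (eta ^+ 3 * (1 + lam ^+ 2 * s) / (s * Num.sqrt s)).
    by rewrite !mulr_ge0 ?invr_ge0 ?addr_ge0 ?mulr_ge0 ?exprn_ge0 ?(ltW sr0) ?(ltW s0) ?(ltW r0).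
  by rewrite /A /heat_cst -lock; lra.
have Y0 : 0 <= E * (t ^+ 2 * (1 + lam ^+ 4 * s ^+ 2) / s ^+ 2).
  by rewrite !mulr_ge0 ?invr_ge0 ?addr_ge0 ?mulr_ge0 ?exprn_ge0 ?(ltW t0) ?(ltW s0) ?(ltW r0).
by rewrite /B /heat_cst -lock; lra.
Qed.


Lemma measurable_normal_tail : measurable_fun setT (@normal_tail R).
Proof.
apply: continuous_measurable_fun => t; apply: differentiable_continuous.
by apply/derivable1_diffP; have [] := is_derive_normal_tail t.
Qed.

Lemma measurable_heat s : measurable_fun setT (heat^~ s).
Proof.
by apply: (measurableT_comp measurable_normal_tail); apply: measurable_funM.
Qed.

Lemma measurable_heat_u s : measurable_fun setT (heat_u^~ s).
Proof.
apply: measurableT_comp => //; apply: measurable_funM => //.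
by apply: (measurableT_comp measurable_gauss_pdf); apply: measurable_funM.
Qed.

Lemma measurable_heat_uu s : measurable_fun setT (heat_uu^~ s).
Proof.
apply: measurable_funM => //; apply: measurable_funM; first exact: measurable_funM.
by apply: (measurableT_comp measurable_gauss_pdf); apply: measurable_funM.
Qed.

Lemma heat_ge0_le1 u s : 0 <= heat u s <= 1.
Proof. exact: normal_tail_gt0_le1. Qed.

Lemma heat_u_le u s : 0 < s -> `|heat_u u s| <= (Num.sqrt s)^-1.
Proof.
move=> s0; have r0 : 0 < Num.sqrt s by rewrite sqrtr_gt0.
rewrite /heat_u normrN normrM normfV (gtr0_norm r0) ler_piMl ?invr_ge0 ?(ltW r0)//.
rewrite (gtr0_norm (gauss_pdf_gt0 _)) (le_trans (gauss_pdf_le _))//.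
by rewrite -expR0 ler_expR oppr_le0 divr_ge0// sqr_ge0.
Qed.

Lemma heat_uu_le u s : 0 < s -> `|heat_uu u s| <= 2 / s.
Proof.
move=> s0; rewrite /heat_uu; set z := u / _.
rewrite normrM normfV (gtr0_norm s0) ler_wpM2r ?invr_ge0 ?(ltW s0)//.
rewrite normrM (gtr0_norm (gauss_pdf_gt0 _)).
apply: (@le_trans _ _ ((1 + z ^+ 2) / 2 * gauss_pdf z)).
  rewrite ler_wpM2r ?(ltW (gauss_pdf_gt0 _))// ler_pdivlMr//.
  rewrite -(real_normK (num_real z)) -subr_ge0.
  by rewrite (_ : _ - _ = (1 - `|z|) ^+ 2) ?sqr_ge0//; ring.
apply: (@le_trans _ _ ((1 + z ^+ 2) / 2 * expR (- (z ^+ 2 / 2)))).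
  by rewrite ler_wpM2l ?gauss_pdf_le// divr_ge0// addr_ge0// sqr_ge0.
rewrite expRN ler_pdivrMr ?expR_gt0//.
by have := expR_ge1Dx (z ^+ 2 / 2); have := sqr_ge0 z; lra.
Qed.

(* [e^{-x_+^2/2}] is the common scale of all the error terms. *)
Definition gauss_env x : R := expR (- (Num.max x 0 ^+ 2 / 2)).

Lemma gauss_env_gt0 x : 0 < gauss_env x.
Proof. exact: expR_gt0. Qed.

Lemma gauss_pdf_le_env x t : x <= t -> gauss_pdf t <= gauss_env x.
Proof.
move=> xt; rewrite (le_trans (gauss_pdf_le _))// ler_expR lerN2 ler_wpM2r//.
case: (leP x 0) => x0; first by rewrite expr0n sqr_ge0.
by rewrite lerXn2r ?nnegrE// ltW// (lt_le_trans x0).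
Qed.

Lemma normal_tail_sub x d : 0 <= d ->
  normal_tail x - normal_tail (x + d) <= d * gauss_env x.
Proof.
move=> d0; have [|t] := @normal_tail_MVT R x (x + d); first by rewrite lerDl.
rewrite in_itv/= => /andP[xt _] ->; rewrite mulrC addrAC subrr add0r.
by rewrite ler_wpM2l// gauss_pdf_le_env.
Qed.

(** The price of a shift: for [d] of order n^{-1/6} the extra factor stays bounded as long as [x] is
    at most of order n^{1/6}. *)
Lemma gauss_env_sub x d : 0 <= d ->
  gauss_env (x - d) <= gauss_env x * expR (Num.max x 0 * d).
Proof.
move=> d0; rewrite -expRD ler_expR.
case: (leP x 0) => x0.
  rewrite max_r; last by lra.
  by rewrite expr0n/= !mul0r; lra.
case: (leP (x - d) 0) => xd0.
  have : x * x <= x * d by rewrite ler_wpM2l//; lra.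
  by rewrite expr2; have := mulr_ge0 (ltW x0) (ltW x0); lra.
have -> : (x - d) ^+ 2 = x ^+ 2 - 2 * (x * d) + d ^+ 2 by ring.
by have := sqr_ge0 d; lra.
Qed.

Definition mills_cst : R := normal_peak 1 * expR (- 2).

Lemma mills_cst_gt0 : 0 < mills_cst.
Proof. by rewrite mulr_gt0 ?normal_peak1_gt0 ?expR_gt0. Qed.

(** A Mills-type bound: on a window of length 1 / (1 + y) to the right of [y = Num.max x 0], t^2
    exceeds y^2 by at most 3, so the density loses at most the factor exp(- 2) put into
    [mills_cst]. *)
Lemma normal_tail_lb x :
  mills_cst * gauss_env x <= (1 + Num.max x 0) * normal_tail x.
Proof.
set y := Num.max x 0; have y0 : 0 <= y by rewrite le_max lexx orbT.
have xy : x <= y by rewrite le_max lexx.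
apply: (@le_trans _ _ ((1 + y) * normal_tail y)); last first.
  by rewrite ler_wpM2l ?normal_tail_decr// addr_ge0.
have y1 : 0 < 1 + y by lra.
have [|t] := @normal_tail_MVT R y (y + (1 + y)^-1).
  by rewrite lerDl invr_ge0 ltW.
rewrite in_itv/= => /andP[yt ty] e.
have tE : normal_tail y >= gauss_pdf t / (1 + y).
  have /andP[+ _] := normal_tail_gt0_le1 (y + (1 + y)^-1).
  by move: e; rewrite [y + _ - y]addrAC subrr add0r => <-; lra.
apply: (@le_trans _ _ (gauss_pdf t)); last by rewrite mulrC -ler_pdivrMr.
rewrite /mills_cst -mulrA ler_wpM2l ?(ltW normal_peak1_gt0)//.
rewrite /gauss_env -/y -expRD ler_expR.
have : t ^+ 2 <= (y + (1 + y)^-1) ^+ 2 by rewrite lerXn2r ?nnegrE//; lra.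
have i1 : (1 + y)^-1 <= 1 by rewrite invf_le1//; lra.
have i0 : 0 <= (1 + y)^-1 by rewrite invr_ge0 ltW.
have i2 : (1 + y)^-1 ^+ 2 <= 1 by rewrite expr_le1.
have i3 : y * (1 + y)^-1 <= 1 by rewrite ler_pdivrMr//; lra.
have -> : (y + (1 + y)^-1) ^+ 2 = y ^+ 2 + 2 * (y * (1 + y)^-1) + (1 + y)^-1 ^+ 2 by ring.
by lra.
Qed.

Lemma normal_tail_gt0 x : 0 < normal_tail x.
Proof.
have y0 : 0 <= Num.max x 0 by rewrite le_max lexx orbT.
have := lt_le_trans (mulr_gt0 mills_cst_gt0 (gauss_env_gt0 x)) (normal_tail_lb x).
by rewrite pmulr_rgt0//; lra.
Qed.

End heat.

(** * Moderate deviations of bounded sums *)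

Section bounded_rv.
Context d (T : measurableType d) (R : realType) (P : probability T R).
Implicit Types f g : T -> R.

(** The bound holds everywhere and does not refer to [P], so the same predicate serves random
    variables and, on compact intervals, Lebesgue integrands. Its closure properties replace
    integrability arguments. *)
Definition bounded_rv f :=
  measurable_fun setT f /\ exists M, forall w, `|f w| <= M.

Lemma bounded_rv_integrable f : bounded_rv f -> P.-integrable setT (EFin \o f).
Proof.
move=> [mf [M fM]]; apply: measurable_bounded_integrable => //.
  by rewrite (le_lt_trans (probability_le1 P measurableT))// ltry.
by exists M; split; [exact: num_real|move=> N MN w _ /=; rewrite (le_trans (fM w))// ltW].
Qed.

Lemma bounded_rv_cst c : bounded_rv (fun=> c).
Proof. by split => //; exists `|c|. Qed.

Lemma bounded_rvN f : bounded_rv f -> bounded_rv (fun w => - f w).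
Proof.
move=> [mf [M fM]]; split; first exact: measurableT_comp.
by exists M => w; rewrite normrN.
Qed.

Lemma bounded_rvD f g : bounded_rv f -> bounded_rv g ->
  bounded_rv (fun w => f w + g w).
Proof.
move=> [mf [M fM]] [mg [N gN]]; split; first exact: measurable_funD.
by exists (M + N) => w; rewrite (le_trans (ler_normD _ _))// lerD.
Qed.

Lemma bounded_rvB f g : bounded_rv f -> bounded_rv g ->
  bounded_rv (fun w => f w - g w).
Proof. by move=> bf bg; apply: bounded_rvD => //; exact: bounded_rvN. Qed.

Lemma bounded_rvM f g : bounded_rv f -> bounded_rv g ->
  bounded_rv (fun w => f w * g w).
Proof.
move=> [mf [M fM]] [mg [N gN]]; split; first exact: measurable_funM.
by exists (M * N) => w; rewrite normrM ler_pM.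
Qed.

Lemma bounded_rv_norm f : bounded_rv f -> bounded_rv (fun w => `|f w|).
Proof.
move=> [mf [M fM]]; split; first exact: measurableT_comp.
by exists M => w; rewrite normr_id.
Qed.

Lemma bounded_rvX f n : bounded_rv f -> bounded_rv (fun w => f w ^+ n).
Proof.
move=> bf; elim: n => [|n ih]; first exact: bounded_rv_cst.
by under eq_fun do rewrite exprS; exact: bounded_rvM.
Qed.

Lemma bounded_rv_expR f : bounded_rv f -> bounded_rv (fun w => expR (f w)).
Proof.
move=> [mf [M fM]]; split; first exact: measurableT_comp.
exists (expR M) => w; rewrite ger0_norm ?expR_ge0// ler_expR.
exact: le_trans (ler_norm _) _.
Qed.

Lemma bounded_rv_indic (A : set T) : measurable A -> bounded_rv (\1_A).
Proof.
move=> mA; split; first exact: measurable_indic.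
by exists 1 => w; rewrite indicE; case: (_ \in _); rewrite ?normr1 ?normr0.
Qed.

Lemma bounded_rv_sum n (F : 'I_n -> T -> R) : (forall i, bounded_rv (F i)) ->
  bounded_rv (fun w => \sum_(i < n) F i w).
Proof.
elim: n F => [|n ih] F bF.
  by under eq_fun do rewrite big_ord0; exact: bounded_rv_cst.
under eq_fun do rewrite big_ord_recr/=.
by apply: bounded_rvD => //; exact: ih.
Qed.

Lemma mean_cst c : \int[P]_w (fun=> c) w = c :> R.
Proof.
have e : fine (P setT) = 1 by have -> := probability_setT P.
by rewrite Rintegral_cst// [fine _]e mulr1.
Qed.

Lemma meanD f g : bounded_rv f -> bounded_rv g ->
  \int[P]_w (f w + g w) = \int[P]_w f w + \int[P]_w g w.
Proof. by move=> bf bg; rewrite RintegralD//; exact: bounded_rv_integrable. Qed.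

Lemma meanB f g : bounded_rv f -> bounded_rv g ->
  \int[P]_w (f w - g w) = \int[P]_w f w - \int[P]_w g w.
Proof. by move=> bf bg; rewrite RintegralB//; exact: bounded_rv_integrable. Qed.

Lemma meanZ c f : bounded_rv f -> \int[P]_w (c * f w) = c * \int[P]_w f w.
Proof. by move=> bf; rewrite RintegralZl//; exact: bounded_rv_integrable. Qed.

Lemma mean_le f g : bounded_rv f -> bounded_rv g -> (forall w, f w <= g w) ->
  \int[P]_w f w <= \int[P]_w g w.
Proof.
by move=> bf bg fg; apply: le_Rintegral => //; exact: bounded_rv_integrable.
Qed.

Lemma mean_norm_le f g : bounded_rv f -> bounded_rv g ->
  (forall w, `|f w| <= g w) -> `|\int[P]_w f w| <= \int[P]_w g w.
Proof.
move=> bf bg fg; apply: le_trans (le_normr_Rintegral _ _) _ => //.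
  exact: bounded_rv_integrable.
exact/mean_le/fg/bg/bounded_rv_norm.
Qed.

Lemma mean_indic (A : set T) : measurable A -> \int[P]_w \1_A w = fine (P A).
Proof. by move=> mA; rewrite /Rintegral integral_indic// setIT. Qed.

End bounded_rv.

(** * Expectation of a product of independent bounded variables *)

Section independent_pair.
Context d (T : measurableType d) (R : realType) (P : probability T R).

(** Truncation at the bounds of [U] and [V] makes multiplication a bounded function on the plane
    without changing its value at the pair [(U w, V w)]. *)
Let clip (M a : R) := Num.max (- M) (Num.min M a).

Let measurable_clip M : measurable_fun setT (clip M).
Proof. by apply: measurable_maxr => //; exact: measurable_minr. Qed.

Let clip_le M a : 0 <= M -> `|clip M a| <= M.
Proof.
move=> M0; rewrite ler_norml /clip le_max lexx/= ge_max ge_min lexx/= andbT.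
by rewrite (le_trans _ M0)// oppr_le0.
Qed.

Let clip_id M a : `|a| <= M -> clip M a = a.
Proof.
by rewrite ler_norml /clip => /andP[h1 h2]; rewrite (min_idPr h2) (max_idPr h1).
Qed.

(** The product formula on rectangles identifies the law of the pair with the product of the two
    laws; Fubini then separates the factors. *)
Lemma mean_mul_independent (U V : T -> R) :
  bounded_rv U -> bounded_rv V ->
  (forall A B, measurable A -> measurable B ->
     P (U @^-1` A `&` V @^-1` B) = (P (U @^-1` A) * P (V @^-1` B))%E) ->
  \int[P]_w (U w * V w) = \int[P]_w U w * \int[P]_w V w.
Proof.
move=> bU bV UV; have [mU [M UM]] := bU; have [mV [N VN]] := bV.
have M0 : 0 <= M := le_trans (normr_ge0 _) (UM point).
have N0 : 0 <= N := le_trans (normr_ge0 _) (VN point).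
pose U' : {RV P >-> R} := MeasurableFun.Pack (MeasurableFun.Class (isMeasurableFun.Build _ _ _ _ _ mU)).
pose V' : {RV P >-> R} := MeasurableFun.Pack (MeasurableFun.Class (isMeasurableFun.Build _ _ _ _ _ mV)).
have mUV : measurable_fun setT (fun w => (U w, V w)) by exact/measurable_fun_pair.
pose W' : {RV P >-> (R * R)%type} :=
  MeasurableFun.Pack (MeasurableFun.Class (isMeasurableFun.Build _ _ _ _ _ mUV)).
pose f (z : R * R) := clip M z.1 * clip N z.2.
have mf : measurable_fun setT f.
  by apply: measurable_funM; apply: measurableT_comp.
have fMN z : `|f z| <= M * N by rewrite normrM ler_pM// clip_le.
have bf : bounded_rv f by split => //; exists (M * N).
rewrite (_ : (fun w => U w * V w) = f \o W'); last first.
  by apply/funext => w /=; rewrite /f/= !clip_id.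
have -> : \int[P]_w (f \o W') w = \int[distribution P W']_z f z.
  rewrite /Rintegral integral_distribution//; first exact/measurable_EFinP.
  apply: bounded_rv_integrable; split; first exact: measurableT_comp.
  by exists (M * N) => w; exact: fMN.
have -> : \int[distribution P W']_z f z =
          \int[(distribution P U' \x distribution P V')%E]_z f z.
  congr fine; apply: eq_measure_integral => A mA _.
  by apply/esym; apply: product_measure_unique => // B C mB mC; exact: UV.
have ->: \int[P]_w U w = \int[distribution P U']_a clip M a.
  rewrite /Rintegral integral_distribution//.
  - by congr fine; apply: eq_integral => w _ /=; rewrite clip_id.
  - exact/measurable_EFinP.
  - apply: bounded_rv_integrable; split; first exact: measurableT_comp.
    by exists M => w; exact: clip_le.
have ->: \int[P]_w V w = \int[distribution P V']_a clip N a.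
  rewrite /Rintegral integral_distribution//.
  - by congr fine; apply: eq_integral => w _ /=; rewrite clip_id.
  - exact/measurable_EFinP.
  - apply: bounded_rv_integrable; split; first exact: measurableT_comp.
    by exists N => w; exact: clip_le.
have bM : bounded_rv (clip M) by split => //; exists M => a; exact: clip_le.
have bN : bounded_rv (clip N) by split => //; exists N => a; exact: clip_le.
have inner a : (\int[distribution P V']_b (f (a, b))%:E =
    (clip M a * \int[distribution P V']_b clip N b)%:E)%E.
  rewrite /f/=; under eq_integral do rewrite EFinM.
  rewrite integralZl//; last exact: bounded_rv_integrable.
  rewrite EFinM fineK//; apply: integrable_fin_num => //.
  exact: bounded_rv_integrable.
rewrite -RintegralZr//; last exact: bounded_rv_integrable.
rewrite /Rintegral -integral12_prod_meas1; last exact: bounded_rv_integrable.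
by congr fine; apply: eq_integral => a _; rewrite /fubini_F inner.
Qed.

End independent_pair.

(** * Independence and exponential moments of partial sums *)

Section partial_sums.
Context d (T : measurableType d) (R : realType) (P : probability T R).
Variable X : nat -> {RV P >-> R}.
Hypothesis indX : mutually_independent X.
Hypothesis idX : identically_distributed X.
Implicit Types (y : R -> R) (n j : nat).

Definition psum y n (w : T) : R := \sum_(i < n) y (X i w).

Let cylinders j : set (set T) := [set C | exists2 B : nat -> set R,
  (forall i, measurable (B i)) & C = \bigcap_(i in [set` iota 0 j]) (X i @^-1` B i)].

Let cylinders_setI j : setI_closed (cylinders j).
Proof.
move=> _ _ [B mB ->] [C mC ->]; exists (fun i => B i `&` C i).
  by move=> i; exact: measurableI.
by rewrite -bigcapI; apply: eq_bigcapr => i _; rewrite preimage_setI.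
Qed.

Let cylinders_measurable j : cylinders j `<=` measurable.
Proof.
move=> _ [B mB ->]; apply: fin_bigcap_measurable => //.
by move=> i _; rewrite -[X in measurable X]setTI; exact: measurable_funP.
Qed.

Let cylinders_setT j : cylinders j setT.
Proof.
exists (fun=> setT) => //; apply/esym; rewrite -subTset => w _ i _.
exact: I.
Qed.

Let sub_cylinder j i (B : set R) : (i < j)%N -> measurable B -> cylinders j (X i @^-1` B).
Proof.
move=> ij mB; exists (fun k => if k == i then B else setT).
  by move=> k; case: ifP.
apply/seteqP; split=> w /=.
  by move=> XB k _ /=; case: eqP => [->|].
move=> /(_ i); rewrite /= eqxx; apply.
by rewrite mem_iota.
Qed.

Let measurable_preim i (B : set R) : measurable B -> measurable (X i @^-1` B).
Proof. by move=> mB; rewrite -[X in measurable X]setTI; exact: measurable_funP. Qed.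

(** As functions of [C] both sides are finite measures: [P] restricted to the preimage of [B], and
    [P] scaled by the probability of that preimage. They agree on cylinders, by independence along
    [j :: iota 0 j], and cylinders are stable under intersection. *)
Let cylinder_indep j (B : set R) : measurable B ->
  forall C, <<s cylinders j >> C -> P (C `&` X j @^-1` B) = (P (X j @^-1` B) * P C)%E.
Proof.
move=> mB; have mXB : measurable (X j @^-1` B) by exact: measurable_preim.
have r0 : 0 <= fine (P (X j @^-1` B)) by exact: fine_ge0.
pose m2 := mscale (NngNum r0) P.
have m2E C : m2 C = (P (X j @^-1` B) * P C)%E.
  by rewrite /m2 /mscale/= fineK ?fin_num_measure.
move=> C sC; rewrite -m2E.
apply: (@g_sigma_algebra_measure_unique _ R T (cylinders j) (@cylinders_measurable j)
   (fun=> setT) (fun=> @cylinders_setT j) _ (mrestr P mXB) m2 (@cylinders_setI j)) => //.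
- by apply/seteqP; split => // w _; exists 0%N.
- move=> _ [D mD ->]; apply: etrans (esym (m2E _)); rewrite /mrestr.
  pose D' i := if i == j then B else D i.
  have mD' i : measurable (D' i) by rewrite /D'; case: ifP.
  have uj : uniq (j :: iota 0 j) by rewrite /= mem_iota ltnn iota_uniq.
  have DD' i : i \in iota 0 j -> D' i = D i.
    by rewrite mem_iota/= add0n /D'; case: eqP => [->|//]; rewrite ltnn.
  have := indX uj mD'; rewrite big_cons.
  rewrite (_ : D' j = B); last by rewrite /D' eqxx.
  have -> : (\prod_(i <- iota 0 j) P (X i @^-1` D' i) =
             P (\bigcap_(i in [set` iota 0 j]) X i @^-1` D i))%E.
    rewrite (indX (iota_uniq 0 j) mD) !big_seq.
    by apply: eq_bigr => i ij; rewrite DD'.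
  move=> <-; congr (P _); apply/seteqP; split => w /=.
    move=> [h1 h2] i /=; rewrite inE => /predU1P[->|ij].
      by rewrite /= /D' eqxx.
    by rewrite /= DD'//; exact: h1.
  move=> h; split.
    by move=> i ij /=; rewrite -DD'//; apply: h; rewrite /= inE ij orbT.
  by have := h j; rewrite /= /D' eqxx; apply; rewrite inE eqxx.
- by move=> k; rewrite (le_lt_trans (probability_le1 P _)) ?ltry//; exact: measurableI.
Qed.

Let measurable_psum_cylinders y j : measurable_fun setT y ->
  forall A, measurable A -> <<s cylinders j >> (psum y j @^-1` A).
Proof.
move=> my A mA.
pose G := cylinders j.
have mX i : (i < j)%N ->
    @measurable_fun _ _ (g_sigma_algebraType G) _ setT (X i : g_sigma_algebraType G -> R).
  move=> ij _ B mB; rewrite setTI; apply: sub_sigma_algebra.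
  exact: sub_cylinder.
have mS : @measurable_fun _ _ (g_sigma_algebraType G) _ setT
    ((fun w => \sum_(i < j) y (X i w)) : g_sigma_algebraType G -> R).
  apply: measurable_sum => i; apply: measurableT_comp => //; exact: mX.
by have := mS measurableT A mA; rewrite setTI.
Qed.

Lemma psum_indep y j (A B : set R) : measurable_fun setT y ->
  measurable A -> measurable B ->
  P (psum y j @^-1` A `&` X j @^-1` B) = (P (psum y j @^-1` A) * P (X j @^-1` B))%E.
Proof.
move=> my mA mB; rewrite muleC; apply: cylinder_indep => //.
exact: measurable_psum_cylinders.
Qed.

Lemma measurable_psum y n : measurable_fun setT y -> measurable_fun setT (psum y n).
Proof.
by move=> my; apply: measurable_sum => i; apply: measurableT_comp.
Qed.

Lemma bounded_rv_psum y n B : measurable_fun setT y -> (forall x, `|y x| <= B) ->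
  bounded_rv (psum y n).
Proof.
move=> my yB; apply: bounded_rv_sum => i; split; first exact: measurableT_comp.
by exists B => w.
Qed.

Lemma bounded_rv_comp (k : R -> R) (f : T -> R) :
  bounded_rv k -> measurable_fun setT f -> bounded_rv (fun w => k (f w)).
Proof.
by move=> [mk [M kM]] mf; split; [exact: measurableT_comp|exists M => w].
Qed.

Lemma mean_id (k : R -> R) i : bounded_rv k ->
   \int[P]_w k (X i w) = \int[P]_w k (X 0%N w).
Proof.
move=> bk; have [mk _] := bk.
have bkX j : bounded_rv (fun w => k (X j w)) by exact: bounded_rv_comp.
rewrite /Rintegral.
rewrite -(@integral_distribution _ _ _ _ _ P (X i) (EFin \o k)); last 2 first.
  exact/measurable_EFinP.
  exact: bounded_rv_integrable (bkX _).
rewrite -(@integral_distribution _ _ _ _ _ P (X 0%N) (EFin \o k)); last 2 first.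
  exact/measurable_EFinP.
  exact: bounded_rv_integrable (bkX _).
by congr fine; apply: eq_measure_integral => A mA _; exact: idX.
Qed.

Lemma psumS y n w : psum y n.+1 w = psum y n w + y (X n w).
Proof. by rewrite /psum big_ord_recr. Qed.

(** Used with exponentials, to factor the moment generating function, and with derivatives of [heat]
    against a centred [k], to make the first- and second-order terms vanish. *)
Lemma mean_psum_mul y (g k : R -> R) j : measurable_fun setT y ->
  measurable_fun setT g -> bounded_rv (fun w => g (psum y j w)) -> bounded_rv k ->
  \int[P]_w (g (psum y j w) * k (X j w)) =
  \int[P]_w g (psum y j w) * \int[P]_w k (X 0%N w).
Proof.
move=> my mg bg bk; have [mk _] := bk.
rewrite mean_mul_independent//.
- by rewrite mean_id.
- exact: bounded_rv_comp.
- move=> A B mA mB.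
  have := @psum_indep y j (g @^-1` A) (k @^-1` B) my.
  by apply; rewrite -[X in measurable X]setTI; [exact: mg|exact: mk].
Qed.

Lemma bounded_rv_of y B : measurable_fun setT y -> (forall x, `|y x| <= B) ->
  bounded_rv y.
Proof. by move=> my yB; split => //; exists B. Qed.

Lemma mean_expR_psum y n B lam : measurable_fun setT y -> (forall x, `|y x| <= B) ->
  \int[P]_w expR (lam * psum y n w) = (\int[P]_w expR (lam * y (X 0%N w))) ^+ n.
Proof.
move=> my yB; have by_ := bounded_rv_of my yB.
have be : bounded_rv (fun x => expR (lam * y x)).
  by apply: bounded_rv_expR; apply: bounded_rvM => //; exact: bounded_rv_cst.
elim: n => [|n ih].
  rewrite expr0 -[RHS](@mean_cst _ _ _ P); apply: eq_Rintegral => w _.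
  by rewrite /psum big_ord0 mulr0 expR0.
rewrite exprSr -ih.
rewrite -(@mean_psum_mul y (fun s => expR (lam * s)) (fun x => expR (lam * y x)) n)//.
- by apply: eq_Rintegral => w _; rewrite psumS mulrDr expRD.
- by apply: measurableT_comp => //; exact: measurable_funM.
- apply: bounded_rv_expR; apply: bounded_rvM; first exact: bounded_rv_cst.
  exact: bounded_rv_psum yB.
Qed.

Lemma expR_taylor3 (u : R) : `|u| <= 1 -> expR u <= 1 + u + u ^+ 2 / 2 + 4 * `|u| ^+ 3.
Proof.
move=> u1; have e4 : expR 1 <= 4 :> R.
  have -> : expR 1 = (expR (- (1 / 2)))^-1 ^+ 2 :> R.
    by rewrite -expRN -expRM_natl; congr expR; field.
  have h := @expR_ge1Dx R (- (1 / 2)).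
  have hi : (expR (- (1 / 2)))^-1 <= 2 :> R.
    by rewrite invf_ple ?posrE ?expR_gt0//; lra.
  by rewrite (_ : 4 = 2 ^+ 2 :> R) ?lerXn2r ?nnegrE ?invr_ge0 ?expR_ge0//; ring.
have := @taylor3_le R expR expR expR expR 0 u 4 (fun t _ => is_derive_expR t)
  (fun t _ => is_derive_expR t) (fun t _ => is_derive_expR t).
rewrite expR0 subr0 => h.
suff /h : forall t, `|t - 0| <= `|u| -> `|expR t| <= 4.
  by rewrite ler_norml => /andP[_]; lra.
move=> t; rewrite subr0 => tu; rewrite ger0_norm ?expR_ge0// (le_trans _ e4)//.
by rewrite ler_expR (le_trans (ler_norm _))// (le_trans tu).
Qed.

(** The linear term vanishes in mean, so one summand contributes at most 1 + z, with z the bracket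
    on the right, and 1 + z <= exp(z). *)
Lemma mean_expR_psum_le y n B lam : measurable_fun setT y -> (forall x, `|y x| <= B) ->
  \int[P]_w y (X 0%N w) = 0 -> `|lam| * B <= 1 ->
  \int[P]_w expR (lam * psum y n w) <=
  expR (n%:R * (lam ^+ 2 * \int[P]_w (y (X 0%N w) ^+ 2) / 2 + 4 * (`|lam| * B) ^+ 3)).
Proof.
move=> my yB y0 lamB; have by_ := bounded_rv_of my yB.
have B0 : 0 <= B by rewrite (le_trans _ (yB 0)).
rewrite (mean_expR_psum _ _ my yB) expRM_natl lerXn2r ?nnegrE ?expR_ge0//.
  by apply: Rintegral_ge0 => w _; exact: expR_ge0.
set v := \int[P]_w (_ ^+ 2).
apply: le_trans (expR_ge1Dx _).
have byX : bounded_rv (fun w => y (X 0%N w)) by exact: bounded_rv_comp.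
have by2 : bounded_rv (fun w => y (X 0%N w) ^+ 2) by exact: bounded_rvX.
have c := @bounded_rv_cst _ T R.
have blin : bounded_rv (fun w => 1 + 4 * (`|lam| * B) ^+ 3 + lam * y (X 0%N w)).
  by apply: bounded_rvD => //; exact: bounded_rvM.
have bquad : bounded_rv (fun w => lam ^+ 2 / 2 * y (X 0%N w) ^+ 2) by exact: bounded_rvM.
apply: (@le_trans _ _ (\int[P]_w (1 + 4 * (`|lam| * B) ^+ 3 + lam * y (X 0%N w)
    + lam ^+ 2 / 2 * y (X 0%N w) ^+ 2))).
  apply: mean_le => //.
  - by apply: bounded_rv_expR; exact: bounded_rvM.
  - exact: bounded_rvD.
  - move=> w; have yw := yB (X 0%N w).
    have lyB : `|lam * y (X 0%N w)| <= `|lam| * B by rewrite normrM ler_wpM2l.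
    apply: le_trans (expR_taylor3 (le_trans lyB lamB)) _.
    have : `|lam * y (X 0%N w)| ^+ 3 <= (`|lam| * B) ^+ 3.
      by rewrite lerXn2r ?nnegrE// mulr_ge0.
    by rewrite exprMn; lra.
rewrite meanD// meanD//; last exact: bounded_rvM.
rewrite meanZ// meanZ// mean_cst y0 -/v; lra.
Qed.

Lemma chernoff y n B lam x : measurable_fun setT y -> (forall x, `|y x| <= B) ->
  \int[P]_w y (X 0%N w) = 0 -> 0 <= lam -> lam * B <= 1 ->
  fine (P [set w | x <= psum y n w]) <=
  expR (- (lam * x) +
    n%:R * (lam ^+ 2 * \int[P]_w (y (X 0%N w) ^+ 2) / 2 + 4 * (lam * B) ^+ 3)).
Proof.
move=> my yB y0 lam0 lamB.
have mA : measurable [set w | x <= psum y n w].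
  rewrite -[X in measurable X]setTI.
  have -> : [set w | x <= psum y n w] = psum y n @^-1` `[x, +oo[.
    by apply/seteqP; split=> w /=; rewrite in_itv/= andbT.
  exact: measurable_psum.
have bS := bounded_rv_psum n my yB; have c := @bounded_rv_cst _ T R.
have be : bounded_rv (fun w => expR (lam * psum y n w)).
  by apply: bounded_rv_expR; exact: bounded_rvM.
rewrite -mean_indic//.
apply: (@le_trans _ _ (\int[P]_w (expR (- (lam * x)) * expR (lam * psum y n w)))).
  apply: mean_le.
  - exact: bounded_rv_indic.
  - exact: bounded_rvM.
  - move=> w; rewrite indicE; case: (boolP (w \in _)) => [|_]; last first.
      by rewrite mulr_ge0 ?expR_ge0.
    rewrite inE/= => xS; rewrite -expRD -[leLHS]expR0 ler_expR.
    by have := ler_wpM2l lam0 xS; lra.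
rewrite meanZ// expRD ler_wpM2l ?expR_ge0//.
by have := @mean_expR_psum_le y n B lam my yB y0; rewrite (ger0_norm lam0) => h; exact: h.
Qed.

End partial_sums.

(** * Lindeberg replacement *)

Section lindeberg.
Context d (T : measurableType d) (R : realType) (P : probability T R).
Variable X : nat -> {RV P >-> R}.
Hypothesis indX : mutually_independent X.
Hypothesis idX : identically_distributed X.
Variables (y : R -> R) (eta t : R).
Hypothesis my : measurable_fun setT y.
Hypothesis yeta : forall x, `|y x| <= eta.
Hypothesis mean_y : \int[P]_w y (X 0%N w) = 0.
Hypothesis mean_y2 : \int[P]_w (y (X 0%N w) ^+ 2) = t.
Hypothesis t_gt0 : 0 < t.

Let S := psum X y.

Let c := @bounded_rv_cst _ T R.

Let bS n : bounded_rv (S n).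
Proof. exact: bounded_rv_psum yeta. Qed.

Let bxS n x : bounded_rv (fun w => x - S n w).
Proof. exact: bounded_rvB. Qed.

Lemma bounded_rv_heat (f : T -> R) s : measurable_fun setT f ->
  bounded_rv (fun w => heat (f w) s).
Proof.
move=> mf; split; first exact: (measurableT_comp (@measurable_heat R s)).
exists 1 => w; have := heat_ge0_le1 (f w) s.
by rewrite ler_norml; lra.
Qed.

Let bheat_u n x s : 0 < s -> bounded_rv (fun w => heat_u (x - S n w) s).
Proof.
move=> s0; split.
  by apply: (measurableT_comp (@measurable_heat_u R s)); case: (bxS n x).
by exists (Num.sqrt s)^-1 => w; exact: heat_u_le.
Qed.

Let bheat_uu n x s : 0 < s -> bounded_rv (fun w => heat_uu (x - S n w) s).
Proof.
move=> s0; split.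
  by apply: (measurableT_comp (@measurable_heat_uu R s)); case: (bxS n x).
by exists (2 / s) => w; exact: heat_uu_le.
Qed.

Let step_cst s lam := eta ^+ 3 * (1 + lam ^+ 2 * s) / (s * Num.sqrt s)
     + t ^+ 2 * (1 + lam ^+ 4 * s ^+ 2) / s ^+ 2.

Let eta0 : 0 <= eta. Proof. exact: le_trans (yeta 0). Qed.

(** [heat_step] is applied conditionally on the first [n] summands. The terms in [heat_u] and
    [heat_uu] have mean zero by independence, and the tilted remainder is integrated with the moment
    generating function of [S n]. *)
Lemma mean_heat_step n x s lam : 2 * t <= s -> 0 <= lam -> lam * eta <= 1 ->
  `|\int[P]_w heat (x - S n.+1 w) s - \int[P]_w heat (x - S n w) (s + t)| <=
  heat_cst * step_cst s lam *
  expR (- (lam * x) + lam ^+ 2 * (s + t) / 2 +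
        n%:R * (lam ^+ 2 * t / 2 + 4 * (lam * eta) ^+ 3)).
Proof.
move=> ts lam0 lameta; have s0 : 0 < s by have := t_gt0; lra.
have by_ := bounded_rv_of my yeta.
have byX i : bounded_rv (fun w => y (X i w)).
  by apply: bounded_rv_comp => //; exact: measurable_funP.
have bH1 : bounded_rv (fun w => heat (x - S n.+1 w) s).
  by apply: bounded_rv_heat; case: (bxS n.+1 x).
have bH0 : bounded_rv (fun w => heat (x - S n w) (s + t)).
  by apply: bounded_rv_heat; case: (bxS n x).
have bA := bounded_rvM (bheat_u n x s0) (byX n).
have bV : bounded_rv (fun w => (y (X n w) ^+ 2 - t) / 2).
  by apply: bounded_rvM => //; apply: bounded_rvB => //; exact: bounded_rvX.
have bC := bounded_rvM (bheat_uu n x s0) bV.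
have A0 : \int[P]_w (heat_u (x - S n w) s * y (X n w)) = 0.
  rewrite (@mean_psum_mul _ _ _ _ X indX idX y (fun a => heat_u (x - a) s) y n)//.
  - by rewrite mean_y mulr0.
  - apply: (measurableT_comp (@measurable_heat_u R s)); exact: measurable_funB.
  - exact: bheat_u.
have C0 : \int[P]_w (heat_uu (x - S n w) s * ((y (X n w) ^+ 2 - t) / 2)) = 0.
  rewrite (@mean_psum_mul _ _ _ _ X indX idX y (fun a => heat_uu (x - a) s) (fun a => (y a ^+ 2 - t) / 2) n)//.
  - under [X in _ * X]eq_Rintegral do rewrite mulrC.
    have b2 : bounded_rv (fun w => y (X 0%N w) ^+ 2) by exact: bounded_rvX.
    rewrite meanZ; last exact: bounded_rvB.
    by rewrite meanB// mean_cst mean_y2 subrr !mulr0.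
  - apply: (measurableT_comp (@measurable_heat_uu R s)); exact: measurable_funB.
  - exact: bheat_uu.
  - by apply: bounded_rvM (@bounded_rv_cst _ _ _ _); apply: bounded_rvB (@bounded_rv_cst _ _ _ _); exact: bounded_rvX.
set rem := fun w => heat (x - S n.+1 w) s - heat (x - S n w) (s + t)
  + heat_u (x - S n w) s * y (X n w)
  - heat_uu (x - S n w) s * ((y (X n w) ^+ 2 - t) / 2).
have brem : bounded_rv rem by apply: bounded_rvB => //; apply: bounded_rvD => //; exact: bounded_rvB.
rewrite (_ : _ - _ = \int[P]_w rem w); last first.
  rewrite /rem meanB//; last by apply: bounded_rvD => //; exact: bounded_rvB.
  by rewrite meanD//; [rewrite meanB// A0 C0 addr0 subr0|exact: bounded_rvB].
have beS : bounded_rv (fun w => expR (lam * S n w)).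
  by apply: bounded_rv_expR; exact: bounded_rvM.
set K := heat_cst * step_cst s lam * expR (- (lam * x) + lam ^+ 2 * (s + t) / 2).
apply: (@le_trans _ _ (\int[P]_w (K * expR (lam * S n w)))).
  apply: mean_norm_le => //; first exact: bounded_rvM.
  move=> w; have := @heat_step R (x - S n w) (y (X n w)) s t lam eta t_gt0 ts (yeta _) lam0 lameta.
  have xS : x - S n w - y (X n w) = x - S n.+1 w by rewrite /S psumS; ring.
  rewrite xS [y _ * heat_u _ _]mulrC [_ / 2 * heat_uu _ _]mulrC -/(rem w).
  move=> h; apply: le_trans h _.
  rewrite /K -/S -/(step_cst s lam) -!mulrA ler_wpM2l ?heat_cst_ge0// mulrC ler_wpM2l//.
    by rewrite addr_ge0// !mulr_ge0 ?invr_ge0 ?addr_ge0 ?mulr_ge0 ?exprn_ge0 ?sqrtr_ge0// ?(ltW s0) ?(ltW t_gt0).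
  by rewrite -expRD ler_expR; lra.
rewrite meanZ// expRD mulrA ler_wpM2l//.
  rewrite !mulr_ge0 ?expR_ge0 ?heat_cst_ge0//.
  by rewrite addr_ge0// !mulr_ge0 ?invr_ge0 ?addr_ge0 ?mulr_ge0 ?exprn_ge0 ?sqrtr_ge0// ?(ltW s0) ?(ltW t_gt0).
have := @mean_expR_psum_le _ _ _ _ X indX idX y n eta lam my yeta mean_y.
by rewrite (ger0_norm lam0) mean_y2 => h; exact: h.
Qed.


Let rt (eps : R) i := Num.sqrt (eps ^+ 2 + i%:R * t).

(** Discrete form of integrating s^{-3/2} and s^{-1/2}: with [r] and [q] consecutive square roots of
    the variance, t / r^3 and t / r are dominated by increments of - 1 / sqrt(s) and sqrt(s), which
    telescope. *)
Let step_cst_le eps lam i : 0 < eps -> 2 * t <= eps ^+ 2 ->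
  step_cst (eps ^+ 2 + i%:R * t) lam <=
  (6 * eta ^+ 3 / t + 6 * t / eps) * ((rt eps i)^-1 - (rt eps i.+1)^-1)
  + 3 * eta ^+ 3 / t * lam ^+ 2 * (rt eps i.+1 - rt eps i) + t ^+ 2 * lam ^+ 4.
Proof.
move=> eps0 teps; set r := rt eps i; set q := rt eps i.+1.
have it0 : 0 <= i%:R * t by rewrite mulr_ge0// ltW.
have e2 : 0 < eps ^+ 2 by rewrite exprn_gt0.
have sE : eps ^+ 2 + i%:R * t = r ^+ 2 by rewrite /r /rt sqr_sqrtr//; lra.
have r0 : 0 < r by rewrite sqrtr_gt0; lra.
have qE : q ^+ 2 = r ^+ 2 + t.
  rewrite -sE /q /rt sqr_sqrtr; first by rewrite -natr1; ring.
  by rewrite -natr1 mulrDl; have := t_gt0; lra.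
have q0 : 0 < q by rewrite sqrtr_gt0 -natr1 mulrDl; have := t_gt0; lra.
have er : eps <= r.
  by rewrite -(ger0_norm (ltW eps0)) -sqrtr_sqr ler_wsqrtr// lerDl.
have q2 : q <= 2 * r.
  rewrite -(@ler_pXn2r _ 2)// ?nnegrE ?mulr_ge0 ?(ltW q0) ?(ltW r0)//.
  by rewrite qE exprMn; lra.
have tq : t = (q - r) * (q + r) by rewrite -[LHS](addKr (r ^+ 2)) -qE; ring.
have qr0 : 0 <= q - r.
  have : 0 < (q - r) * (q + r) by rewrite -tq.
  by rewrite (pmulr_lgt0 _ (addr_gt0 q0 r0)); exact: ltW.
rewrite /step_cst sE sqrtr_sqr (gtr0_norm r0).
have I1 : t / (r ^+ 2 * r) <= 6 * (r^-1 - q^-1).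
  have -> : 6 * (r^-1 - q^-1) = (q - r) * (6 / (r * q)).
    by field; rewrite !gt_eqF.
  rewrite tq -mulrA ler_wpM2l// ler_pdivlMr ?mulr_gt0//.
  rewrite mulrAC ler_pdivrMr ?mulr_gt0 ?exprn_gt0//.
  (* The 6 of [I1] is 2 * 3, both factors coming from [q <= 2 * r]. *)
  have h : q * (q + r) <= 2 * r * (3 * r) by rewrite ler_pM// ?addr_ge0 ?(ltW q0) ?(ltW r0)//; lra.
  by have := ler_wpM2l (ltW r0) h; rewrite expr2; lra.
have I2 : t / r <= 3 * (q - r).
  rewrite tq mulrC [leRHS]mulrC mulrCA ler_wpM2l//.
  by rewrite mulrC ler_pdivrMr//; lra.
have I3 : t ^+ 2 / r ^+ 4 <= t / eps * (6 * (r^-1 - q^-1)).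
  apply: (@le_trans _ _ (t / eps * (t / (r ^+ 2 * r)))); last first.
    by rewrite ler_wpM2l// divr_ge0// ltW.
  have -> : t ^+ 2 / r ^+ 4 = t / r * (t / (r ^+ 2 * r)) by field; rewrite gt_eqF.
  rewrite ler_wpM2r ?divr_ge0 ?mulr_ge0 ?exprn_ge0 ?(ltW r0) ?(ltW t_gt0)//.
  by rewrite ler_wpM2l ?(ltW t_gt0)// lef_pV2 ?posrE.
have e3t : 0 <= eta ^+ 3 / t by rewrite divr_ge0 ?exprn_ge0// ltW.
have J1 := ler_wpM2l e3t I1.
have J2 := ler_wpM2l (mulr_ge0 e3t (sqr_ge0 lam)) I2.
have -> : eta ^+ 3 * (1 + lam ^+ 2 * r ^+ 2) / (r ^+ 2 * r) +
  t ^+ 2 * (1 + lam ^+ 4 * (r ^+ 2) ^+ 2) / (r ^+ 2) ^+ 2 =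
  eta ^+ 3 / t * (t / (r ^+ 2 * r)) + eta ^+ 3 / t * lam ^+ 2 * (t / r) +
  t ^+ 2 / r ^+ 4 + t ^+ 2 * lam ^+ 4.
  by field; rewrite !gt_eqF.
by lra.
Qed.

Let sum_step_cst_le eps lam n : 0 < eps -> eps <= 1 -> 2 * t <= eps ^+ 2 -> n%:R * t = 1 ->
  \sum_(i < n) step_cst (eps ^+ 2 + i%:R * t) lam <=
  eta ^+ 3 / t * (6 / eps + 6 * lam ^+ 2) + t * (6 / eps ^+ 2 + lam ^+ 4).
Proof.
move=> eps0 eps1 teps nt.
(* A discrete antiderivative of the bound in [step_cst_le]; only its increment from variance eps^2
   to 1 + eps^2 remains. *)
pose V i := - (6 * eta ^+ 3 / t + 6 * t / eps) / rt eps i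
  + 3 * eta ^+ 3 / t * lam ^+ 2 * rt eps i + i%:R * (t ^+ 2 * lam ^+ 4).
have stepV i : step_cst (eps ^+ 2 + i%:R * t) lam <= V i.+1 - V i.
  by have := step_cst_le lam i eps0 teps; rewrite /V -natr1; lra.
have e3t : 0 <= eta ^+ 3 / t by rewrite divr_ge0 ?exprn_ge0// ltW.
apply: (@le_trans _ _ (V n - V 0%N)).
  elim: n {nt} => [|n ih]; first by rewrite big_ord0 subrr.
  by rewrite big_ord_recr/=; have := stepV n; lra.
have rt0 : rt eps 0 = eps.
  by rewrite /rt mul0r addr0 sqrtr_sqr gtr0_norm.
have rtn : rt eps n <= 2.
  rewrite /rt nt -[leRHS]ger0_norm// -sqrtr_sqr ler_wsqrtr//.
  have : eps ^+ 2 <= 1 by rewrite expr_le1// ltW.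
  by rewrite (_ : 2 ^+ 2 = 4 :> R)//; [lra|ring].
have rtn0 : 0 <= (rt eps n)^-1 by rewrite invr_ge0 sqrtr_ge0.
rewrite /V rt0 mul0r addr0.
have -> : n%:R * (t ^+ 2 * lam ^+ 4) = t * lam ^+ 4.
  by rewrite [t ^+ 2]expr2 -!mulrA mulrA nt mul1r.
have h1 : 0 <= (6 * eta ^+ 3 / t + 6 * t / eps) / rt eps n.
  rewrite mulr_ge0// addr_ge0//; first by rewrite -mulrA mulr_ge0.
  by rewrite divr_ge0 ?mulr_ge0// ltW.
have h2 := ler_wpM2l (mulr_ge0 e3t (sqr_ge0 lam)) rtn.
have h3 : 0 <= eta ^+ 3 / t * lam ^+ 2 * eps.
  exact: mulr_ge0 (mulr_ge0 e3t (sqr_ge0 lam)) (ltW eps0).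
have -> : t * (6 / eps ^+ 2 + lam ^+ 4) = 6 * t / eps / eps + t * lam ^+ 4.
  by field; rewrite gt_eqF.
by lra.
Qed.

Lemma mean_heat_psum n x lam eps : n%:R * t = 1 -> 0 < eps -> eps <= 1 ->
  2 * t <= eps ^+ 2 -> 0 <= lam -> lam * eta <= 1 ->
  `|\int[P]_w heat (x - S n w) (eps ^+ 2) - heat x (1 + eps ^+ 2)| <=
  heat_cst * (eta ^+ 3 / t * (6 / eps + 6 * lam ^+ 2) + t * (6 / eps ^+ 2 + lam ^+ 4))
  * expR (- (lam * x) + lam ^+ 2 * (1 + eps ^+ 2) / 2 + n%:R * (4 * (lam * eta) ^+ 3)).
Proof.
move=> nt eps0 eps1 teps lam0 lameta; set E := expR _.
(* The last [i] summands have been traded for Gaussian variance; eps^2 is the smoothing present from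
   the start, so [a 0] concerns the sum and [a n] is purely Gaussian. *)
pose a i := \int[P]_w heat (x - S (n - i)%N w) (eps ^+ 2 + i%:R * t).
have aS i : (i < n)%N ->
    `|a i - a i.+1| <= heat_cst * step_cst (eps ^+ 2 + i%:R * t) lam * E.
  move=> ni; have := @mean_heat_step (n - i.+1)%N x (eps ^+ 2 + i%:R * t) lam _ lam0 lameta.
  rewrite -addrA -[i%:R * t + t](_ : i.+1%:R * t = _); last by rewrite -natr1; ring.
  rewrite subnSK// => h; apply: le_trans (h _) _.
    by have : 0 <= i%:R * t; [rewrite mulr_ge0//; exact: ltW|lra].
  have sc0 : 0 <= step_cst (eps ^+ 2 + i%:R * t) lam.
    have : 0 <= eps ^+ 2 + i%:R * t by rewrite addr_ge0 ?sqr_ge0 ?mulr_ge0 ?(ltW t_gt0).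
    by move=> ?; rewrite addr_ge0// !mulr_ge0 ?invr_ge0 ?addr_ge0 ?mulr_ge0 ?exprn_ge0 ?sqrtr_ge0 ?(ltW t_gt0).
  (* One exponent serves all steps: the variance left in the sum and the Gaussian variance always
     total 1 + eps^2. *)
  rewrite ler_wpM2l ?mulr_ge0 ?heat_cst_ge0// ler_expR.
  have c0 : 0 <= 4 * (lam * eta) ^+ 3 by rewrite mulr_ge0// exprn_ge0// mulr_ge0.
  have := ler_wpM2r c0 (_ : (n - i.+1)%:R <= n%:R :> R); rewrite ler_nat leq_subr => /(_ isT).
  rewrite natrB// !mulrDr.
  have : n%:R * (lam ^+ 2 * t) = lam ^+ 2 by rewrite mulrCA nt mulr1.
  by lra.
have aE k : (k <= n)%N -> `|a 0%N - a k| <=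
    heat_cst * (\sum_(i < k) step_cst (eps ^+ 2 + i%:R * t) lam) * E.
  elim: k => [_|k ih kn]; first by rewrite big_ord0 subrr normr0 mulr0 mul0r.
  rewrite big_ord_recr/= mulrDr mulrDl.
  apply: le_trans (ler_distD (a k) _ _) _.
  by apply: lerD; [exact/ih/ltnW|exact: aS].
have := aE n (leqnn _).
rewrite /a subn0 mul0r addr0 subnn nt.
have -> : \int[P]_w heat (x - S 0 w) (eps ^+ 2 + 1) = heat x (1 + eps ^+ 2).
  rewrite -[RHS](@mean_cst _ _ _ P); apply: eq_Rintegral => w _.
  by rewrite /S /psum big_ord0 subr0 addrC.
move=> h; apply: le_trans h _; rewrite ler_wpM2r ?expR_ge0//.
by rewrite ler_wpM2l ?heat_cst_ge0// sum_step_cst_le.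
Qed.

End lindeberg.

(** * Between sharp and smoothed indicators *)

Section desmoothing.
Context {R : realType}.
Implicit Types (x y M eps lam : R).

Lemma normal_tailN x : normal_tail (- x) = 1 - normal_tail x :> R.
Proof. by rewrite -normal_cdfN opprK /normal_tail; ring. Qed.

Let heatE u eps : 0 < eps -> heat u (eps ^+ 2) = normal_tail (u / eps).
Proof. by move=> eps0; rewrite /heat sqrtr_sqr gtr0_norm. Qed.

(** For [y > x] the smoothed indicator with threshold lowered by [M * eps] is at least 1 - exp(- M^2
    / 2), and the tilt factor is at least 1, which pays for the deficit. *)
Lemma step_le_heat x y M eps lam : 0 <= M -> 0 < eps -> 0 <= lam ->
  (x < y)%R%:R <= heat (x - M * eps - y) (eps ^+ 2) + expR (- (M ^+ 2 / 2)) * expR (lam * (y - x)).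
Proof.
move=> M0 eps0 lam0; rewrite heatE//.
have [xy|yx] := ltP x y; last first.
  have /andP[h _] := normal_tail_gt0_le1 ((x - M * eps - y) / eps).
  by rewrite addr_ge0// mulr_ge0// expR_ge0.
have h1 : normal_tail (- M) <= normal_tail ((x - M * eps - y) / eps).
  apply: normal_tail_decr; rewrite ler_pdivrMr//; lra.
have := normal_tail_expR M0; rewrite normal_tailN in h1 => h2.
have : expR (- (M ^+ 2 / 2)) <= expR (- (M ^+ 2 / 2)) * expR (lam * (y - x)).
  rewrite ler_peMr ?expR_ge0// -[leLHS]expR0 ler_expR mulr_ge0//; lra.
by rewrite mulr1n; lra.
Qed.

(* The Gaussian smoothing the step has standard deviation [eps] and exceeds [M * eps]
   with probability at most [expR (- (M ^+ 2 / 2))]; far from the step this tail is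
   moreover exponentially small in the distance. *)
Lemma heat_le_step x y M eps lam : 0 <= M -> 0 < eps -> 0 <= lam -> lam * eps <= M ->
  heat (x + M * eps - y) (eps ^+ 2) <= (x < y)%R%:R + expR (- (M ^+ 2 / 2)) * expR (lam * (y - x)).
Proof.
move=> M0 eps0 lam0 lM; rewrite heatE//.
have [xy|yx] := ltP x y.
  have /andP[_ h] := normal_tail_gt0_le1 ((x + M * eps - y) / eps).
  by rewrite (le_trans h)// lerDl mulr_ge0 ?expR_ge0.
rewrite add0r; set a := (x - y) / eps.
have a0 : 0 <= a by rewrite divr_ge0 ?(ltW eps0)//; lra.
have -> : (x + M * eps - y) / eps = M + a by rewrite /a; field; rewrite gt_eqF.
apply: le_trans (normal_tail_expR _) _; first by rewrite addr_ge0.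
rewrite -expRD ler_expR.
have : lam * (x - y) <= M * a.
  by rewrite /a mulrA ler_pdivlMr// mulrAC ler_wpM2r//; lra.
by have := sqr_ge0 a; rewrite sqrrD; lra.
Qed.

End desmoothing.

Section tail_bounds.
Context d (T : measurableType d) (R : realType) (P : probability T R).
Variable X : nat -> {RV P >-> R}.
Hypothesis indX : mutually_independent X.
Hypothesis idX : identically_distributed X.
Variables (y : R -> R) (eta t : R).
Hypothesis my : measurable_fun setT y.
Hypothesis yeta : forall x, `|y x| <= eta.
Hypothesis mean_y : \int[P]_w y (X 0%N w) = 0.
Hypothesis mean_y2 : \int[P]_w (y (X 0%N w) ^+ 2) = t.
Hypothesis t_gt0 : 0 < t.

Variables (n : nat) (M eps lam : R).
Hypothesis nt : n%:R * t = 1.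
Hypotheses (eps0 : 0 < eps) (eps1 : eps <= 1) (teps : 2 * t <= eps ^+ 2).
Hypotheses (lam0 : 0 <= lam) (lameta : lam * eta <= 1).
Hypothesis M0 : 0 <= M.

Let S := psum X y n.

Let lindeberg_err :=
  heat_cst * (eta ^+ 3 / t * (6 / eps + 6 * lam ^+ 2) + t * (6 / eps ^+ 2 + lam ^+ 4)).

Let c := @bounded_rv_cst _ T R.

Let bS : bounded_rv S.
Proof. exact: bounded_rv_psum yeta. Qed.

Let mgf : \int[P]_w expR (lam * S w) <=
  expR (lam ^+ 2 / 2 + n%:R * (4 * (lam * eta) ^+ 3)).
Proof.
have := @mean_expR_psum_le _ _ _ _ X indX idX y n eta lam my yeta mean_y.
rewrite (ger0_norm lam0) mean_y2 => /(_ lameta); rewrite mulrDr.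
have -> : n%:R * (lam ^+ 2 * t / 2) = lam ^+ 2 * (n%:R * t) / 2 by ring.
by rewrite nt mulr1.
Qed.

Lemma measurable_lt_rv (f : T -> R) x : measurable_fun setT f ->
  measurable [set w | x < f w].
Proof.
move=> mf; rewrite -[X in measurable X]setTI.
have -> : [set w | x < f w] = f @^-1` `]x, +oo[.
  by apply/seteqP; split=> w /=; rewrite in_itv/= andbT.
exact: mf.
Qed.

Let tail_mean x : fine (P [set w | x < S w]) = \int[P]_w ((x < S w)%R%:R).
Proof.
rewrite -mean_indic; last by apply: measurable_lt_rv; case: bS.
apply: eq_Rintegral => w _; rewrite indicE; congr (_ %:R).
by case: ltP => h; [rewrite mem_set|rewrite memNset//= ltNge h].
Qed.

Let bstep x : bounded_rv (fun w => (x < S w)%R%:R : R).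
Proof.
have -> : (fun w => (x < S w)%R%:R : R) = \1_[set w | x < S w].
  apply/funext => w; rewrite indicE; congr (_ %:R).
  by case: ltP => h; [rewrite mem_set|rewrite memNset//= ltNge h].
by apply: bounded_rv_indic; apply: measurable_lt_rv; case: bS.
Qed.

Let bexp x : bounded_rv (fun w => expR (lam * (S w - x))).
Proof.
by apply: bounded_rv_expR; apply: bounded_rvM => //; exact: bounded_rvB.
Qed.

Let mean_exp x : \int[P]_w (expR (- (M ^+ 2 / 2)) * expR (lam * (S w - x))) <=
  expR (- (M ^+ 2 / 2)) * expR (- (lam * x) + lam ^+ 2 / 2 + n%:R * (4 * (lam * eta) ^+ 3)).
Proof.
rewrite meanZ// ler_wpM2l ?expR_ge0//.
under eq_Rintegral do rewrite mulrBr addrC expRD.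
rewrite meanZ; last by apply: bounded_rv_expR; exact: bounded_rvM.
by rewrite -addrA expRD ler_wpM2l ?expR_ge0.
Qed.

Let bheat x : bounded_rv (fun w => heat (x - S w) (eps ^+ 2)).
Proof. by apply: bounded_rv_heat; case: (bounded_rvB (c x) bS). Qed.

Lemma tail_psum_ub x : fine (P [set w | x < S w]) <=
  heat (x - M * eps) (1 + eps ^+ 2) +
  lindeberg_err * expR (- (lam * (x - M * eps)) + lam ^+ 2 * (1 + eps ^+ 2) / 2
    + n%:R * (4 * (lam * eta) ^+ 3)) +
  expR (- (M ^+ 2 / 2)) * expR (- (lam * x) + lam ^+ 2 / 2 + n%:R * (4 * (lam * eta) ^+ 3)).
Proof.
rewrite tail_mean.
have bM : bounded_rv (fun w => expR (- (M ^+ 2 / 2)) * expR (lam * (S w - x))).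
  exact: bounded_rvM.
apply: (@le_trans _ _ (\int[P]_w (heat (x - M * eps - S w) (eps ^+ 2)
    + expR (- (M ^+ 2 / 2)) * expR (lam * (S w - x))))).
  apply: mean_le => //; first exact: bounded_rvD.
  by move=> w; exact: step_le_heat.
rewrite meanD//; apply: lerD (mean_exp x).
have := mean_heat_psum indX idX my yeta mean_y mean_y2 t_gt0 (x - M * eps) nt eps0 eps1 teps lam0 lameta.
by rewrite ler_norml -/S -/lindeberg_err => /andP[_]; lra.
Qed.

Lemma tail_psum_lb x : lam * eps <= M -> heat (x + M * eps) (1 + eps ^+ 2) <=
  fine (P [set w | x < S w]) +
  lindeberg_err * expR (- (lam * (x + M * eps)) + lam ^+ 2 * (1 + eps ^+ 2) / 2
    + n%:R * (4 * (lam * eta) ^+ 3)) +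
  expR (- (M ^+ 2 / 2)) * expR (- (lam * x) + lam ^+ 2 / 2 + n%:R * (4 * (lam * eta) ^+ 3)).
Proof.
move=> lM; rewrite tail_mean.
have bM : bounded_rv (fun w => expR (- (M ^+ 2 / 2)) * expR (lam * (S w - x))).
  exact: bounded_rvM.
have : \int[P]_w (heat (x + M * eps - S w) (eps ^+ 2)) <= \int[P]_w ((x < S w)%R%:R
    + expR (- (M ^+ 2 / 2)) * expR (lam * (S w - x))).
  apply: mean_le => //; first exact: bounded_rvD.
  by move=> w; exact: heat_le_step.
rewrite (meanD P (bstep x) bM); have := mean_exp x.
have := mean_heat_psum indX idX my yeta mean_y mean_y2 t_gt0 (x + M * eps) nt eps0 eps1 teps lam0 lameta.
by rewrite ler_norml -/S -/lindeberg_err => /andP[+ _]; lra.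
Qed.

End tail_bounds.

Section shift.
Context {R : realType}.
Implicit Types (x u h : R).

Lemma normal_tail_near_ub x u h : 0 <= h -> x - h <= u ->
  normal_tail u <= normal_tail x + h * gauss_env x * expR (Num.max x 0 * h).
Proof.
move=> h0 xu; have := normal_tail_sub (x - h) h0; rewrite subrK.
have := ler_wpM2l h0 (gauss_env_sub x h0); have := normal_tail_decr xu.
by rewrite mulrA; lra.
Qed.

Lemma normal_tail_near_lb x u h : 0 <= h -> u <= x + h ->
  normal_tail x <= normal_tail u + h * gauss_env x.
Proof.
move=> h0 xu; have := normal_tail_sub x h0.
by have := normal_tail_decr xu; lra.
Qed.

(** Controls the renormalization made necessary by smoothing, which raises the variance from 1 to 1
    + eps^2. *)
Lemma div_sqrt1D_near (x e : R) : 0 <= e -> `|x / Num.sqrt (1 + e) - x| <= `|x| * e.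
Proof.
move=> e0; set s := Num.sqrt _.
have s1 : 1 <= s by rewrite -[leLHS]sqrtr1 ler_wsqrtr// lerDl.
have s0 : 0 < s by exact: lt_le_trans s1.
have se : s - 1 <= e.
  have s2 : s ^+ 2 = 1 + e by rewrite sqr_sqrtr// addr_ge0.
  have : (s - 1) * 2 <= (s - 1) * (s + 1) by rewrite ler_wpM2l//; lra.
  have -> : (s - 1) * (s + 1) = s ^+ 2 - 1 by ring.
  by rewrite s2; lra.
have -> : x / s - x = - (x * ((s - 1) / s)) by field; rewrite gt_eqF.
rewrite normrN normrM ler_wpM2l// ger0_norm ?divr_ge0 ?(ltW s0)//; last by lra.
by rewrite ler_pdivrMr// (le_trans se)// ler_peMr.
Qed.

End shift.

(** * Choice of the scales and relative errors *)

Section moderate_deviations.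
Context d (T : measurableType d) (R : realType) (P : probability T R).
Variable X : nat -> {RV P >-> R}.
Hypothesis indX : mutually_independent X.
Hypothesis idX : identically_distributed X.
Variables (y : R -> R) (b : R).
Hypothesis my : measurable_fun setT y.
Hypothesis yb : forall x, `|y x| <= b.
Hypothesis mean_y : \int[P]_w y (X 0%N w) = 0.
Hypothesis mean_y2 : \int[P]_w (y (X 0%N w) ^+ 2) = 1.
Variables (A C : R).
Hypotheses (A0 : 0 <= A) (C0 : 0 <= C).

Let b0 : 0 <= b. Proof. exact: le_trans (yb 0). Qed.

(** Shifts are counted in units of n^{-1/6}: [D] adds to [C] the displacement [M * eps], and [D']
    adds the renormalization of the variance. [K1] bounds the exponentials relative to [gauss_env],
    [K2] the Lindeberg error, and [K3] collects all contributions. *)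
Let D := C + 1.
Let D' := A + 1 + D + D.
Let K1 : R := expR (D + 1 + 4 * b ^+ 3).
Let K2 : R := heat_cst * (12 * b ^+ 3 + 14).
Let K3 : R := D' * expR D' + K2 * K1 + 2 * K1.

Section fixed.
Variables (p mu x : R) (n : nat).
Hypotheses (p2 : 2 <= p) (pb : b <= p) (np : n%:R = p ^+ 12).
Hypotheses (mu0 : 0 <= mu) (mu1 : mu <= 1).
Hypotheses (lamE : Num.max x 0 = mu * p ^+ 2) (Ax : - A <= x).

(** All scales are powers of [q], that is of n^{-1/12}: [q ^+ 6] normalizes the sum, [q ^+ 3] is the
    smoothing width, [q ^+ 2] the unit of shifts. The parameter [mu] is the positive part of [x] in
    units of n^{1/6}. *)
Let q := p^-1.
Let lam := mu * p ^+ 2.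
Let p0 : 0 < p. Proof. exact: lt_le_trans p2. Qed.
Let q0 : 0 < q. Proof. by rewrite invr_gt0. Qed.
Let q12 : q <= 1 / 2. Proof. by rewrite /q div1r lef_pV2 ?posrE. Qed.
Ltac slra := move: p2 mu0 mu1 q0 q12 A0 C0 b0 => /= ? ? ? ? ? ? ? ?; lra.
Let pq : p * q = 1. Proof. by rewrite divff ?gt_eqF. Qed.
Let lam0 : 0 <= lam. Proof. by rewrite mulr_ge0// exprn_ge0// ltW. Qed.

Let Sn := psum X (fun a => y a * q ^+ 6) n.

Let qn k : 0 <= q ^+ k. Proof. by rewrite exprn_ge0// ltW. Qed.
Let qn1 k : q ^+ k <= 1. Proof. by rewrite exprn_ile1//; slra. Qed.

Let mun k : 0 <= mu ^+ k. Proof. exact: exprn_ge0. Qed.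
Let mun1 k : mu ^+ k <= 1. Proof. exact: exprn_ile1. Qed.
#[local] Hint Resolve qn qn1 mun mun1 : core.

Let my' : measurable_fun setT (fun a => y a * q ^+ 6).
Proof. exact: measurable_funM. Qed.

Let yb' a : `|y a * q ^+ 6| <= b * q ^+ 6.
Proof. by rewrite normrM (ger0_norm (qn 6)) ler_wpM2r. Qed.

Let by0 : bounded_rv (fun w => y (X 0%N w)).
Proof. by apply: bounded_rv_comp; [exact: bounded_rv_of my yb|]. Qed.

Let mean_y' : \int[P]_w (y (X 0%N w) * q ^+ 6) = 0.
Proof. by under eq_Rintegral do rewrite mulrC; rewrite meanZ// mean_y mulr0. Qed.

Let mean_y2' : \int[P]_w ((y (X 0%N w) * q ^+ 6) ^+ 2) = q ^+ 12.
Proof.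
under eq_Rintegral do rewrite exprMn mulrC.
rewrite meanZ; last exact: bounded_rvX.
by rewrite mean_y2 mulr1 -exprM.
Qed.

Let t0 : 0 < q ^+ 12. Proof. by rewrite exprn_gt0. Qed.
Let nt : n%:R * q ^+ 12 = 1. Proof. by rewrite np -exprMn pq expr1n. Qed.
Let eps0 : 0 < q ^+ 3. Proof. by rewrite exprn_gt0. Qed.
Let eps1 : q ^+ 3 <= 1. Proof. exact: qn1. Qed.
Let teps : 2 * q ^+ 12 <= (q ^+ 3) ^+ 2.
Proof.
rewrite -exprM (_ : q ^+ 12 = q ^+ 6 * q ^+ 6); last by rewrite -exprD.
rewrite mulrA ler_piMl// (_ : q ^+ 6 = q * q ^+ 5); last by rewrite -exprS.
by have := ler_wpM2l (ltW q0) (qn1 5); slra.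
Qed.
Let lameta : lam * (b * q ^+ 6) <= 1.
Proof.
have -> : lam * (b * q ^+ 6) = mu * (b * q) * (p * q) ^+ 2 * q ^+ 3.
  by rewrite /lam; ring.
rewrite pq expr1n mulr1.
have bq : b * q <= 1 by rewrite ler_pdivrMr// mul1r.
have bq0 : 0 <= b * q by rewrite mulr_ge0// ltW.
by apply: mulr_ile1 => //; [exact: mulr_ge0|exact: mulr_ile1].
Qed.
Let lamM : lam * q ^+ 3 <= p.
Proof.
have -> : lam * q ^+ 3 = mu * q * (p * q) ^+ 2 by rewrite /lam; ring.
rewrite pq expr1n mulr1; apply: (@le_trans _ _ 1); last by slra.
rewrite mulr_ile1//; first exact: ltW.
by slra.
Qed.

(** True also for negative [x], where [lam] is 0. It turns - lam x + lam^2 / 2 into - lam^2 / 2, the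
    exponent of [gauss_env]. *)
Let lamx : lam * x = lam ^+ 2.
Proof.
rewrite /lam -lamE; case: (leP x 0) => x0; first by rewrite mul0r expr0n.
by rewrite expr2.
Qed.

Let envE : gauss_env x = expR (- (lam ^+ 2 / 2)).
Proof. by rewrite /gauss_env lamE. Qed.

Let lamq2 : lam * q ^+ 2 = mu.
Proof. by have -> : lam * q ^+ 2 = mu * (p * q) ^+ 2; [rewrite /lam; ring|rewrite pq expr1n mulr1]. Qed.

(** Taken with [h = 1] for the Lindeberg error, whose variance includes the smoothing, and with
    [h = 0] for the cut-off error. Each correction is bounded because [lam * q ^+ 2 = mu <= 1]. *)
Let exponent (v h : R) : 0 <= h -> h <= 1 -> x - D * q ^+ 2 <= v ->
  expR (- (lam * v) + lam ^+ 2 * (1 + h * (q ^+ 3) ^+ 2) / 2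
    + n%:R * (4 * (lam * (b * q ^+ 6)) ^+ 3)) <= K1 * gauss_env x.
Proof.
move=> h0 h1 xv; rewrite envE /K1 -expRD ler_expR.
have H1 : n%:R * (4 * (lam * (b * q ^+ 6)) ^+ 3) <= 4 * b ^+ 3.
  have -> : n%:R * (4 * (lam * (b * q ^+ 6)) ^+ 3) =
     (n%:R * q ^+ 12) * (4 * b ^+ 3 * (lam * q ^+ 2) ^+ 3) by ring.
  by rewrite nt mul1r lamq2 ler_piMr ?mulr_ge0 ?exprn_ge0.
have H2 : lam ^+ 2 * (q ^+ 3) ^+ 2 <= 1.
  have -> : lam ^+ 2 * (q ^+ 3) ^+ 2 = (lam * q ^+ 2) ^+ 2 * q ^+ 2 by ring.
  by rewrite lamq2 mulr_ile1.
have H3 : h * (lam ^+ 2 * (q ^+ 3) ^+ 2) <= 1.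
  by rewrite mulr_ile1// mulr_ge0// sqr_ge0.
have H4 : lam * (D * q ^+ 2) <= D.
  have -> : lam * (D * q ^+ 2) = D * (lam * q ^+ 2) by ring.
  by rewrite lamq2 ler_piMr// /D addr_ge0.
have := ler_wpM2l lam0 xv; rewrite mulrBr lamx; slra.
Qed.

Let err_ge0 : 0 <= heat_cst * ((b * q ^+ 6) ^+ 3 / q ^+ 12 * (6 / q ^+ 3 + 6 * lam ^+ 2)
   + q ^+ 12 * (6 / (q ^+ 3) ^+ 2 + lam ^+ 4)).
Proof.
apply: mulr_ge0; first exact: heat_cst_ge0.
apply: addr_ge0; apply: mulr_ge0 => //.
- by apply: divr_ge0 => //; apply: exprn_ge0; exact: mulr_ge0.
- by apply: addr_ge0; [exact: divr_ge0|apply: mulr_ge0 => //; exact: sqr_ge0].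
- by apply: addr_ge0; [apply: divr_ge0 => //; exact: sqr_ge0|exact: exprn_ge0].
Qed.

(** The factor [1 + lam] anticipates the loss in [normal_tail_lb]. The error contains a factor
    [q ^+ 2], which turns [1 + lam] into [q ^+ 2 + mu]; what remains is bounded. *)
Let err_le : (1 + lam) * (heat_cst * ((b * q ^+ 6) ^+ 3 / q ^+ 12 * (6 / q ^+ 3 + 6 * lam ^+ 2)
   + q ^+ 12 * (6 / (q ^+ 3) ^+ 2 + lam ^+ 4))) <= K2 * (q + mu).
Proof.
rewrite mulrCA /K2 -[leRHS]mulrA ler_wpM2l ?heat_cst_ge0//.
have -> : (1 + lam) * ((b * q ^+ 6) ^+ 3 / q ^+ 12 * (6 / q ^+ 3 + 6 * lam ^+ 2)
   + q ^+ 12 * (6 / (q ^+ 3) ^+ 2 + lam ^+ 4)) =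
   (q ^+ 2 + lam * q ^+ 2) * (6 * b ^+ 3 * (q + (lam * q ^+ 2) ^+ 2) + 6 * q ^+ 4
   + q ^+ 2 * (lam * q ^+ 2) ^+ 4).
  by field; rewrite gt_eqF.
rewrite lamq2.
have H1 : q ^+ 2 + mu <= q + mu by rewrite lerD2r expr2 ler_piMr ?(ltW q0)//; slra.
have H2 : q + mu ^+ 2 <= 2.
  by have : mu ^+ 2 <= 1; [rewrite exprn_ile1|slra].
have b3 : 0 <= b ^+ 3 by rewrite exprn_ge0.
have H3 : 6 * b ^+ 3 * (q + mu ^+ 2) <= 12 * b ^+ 3.
  by have := ler_wpM2l b3 H2; slra.
have H4 : 6 * q ^+ 4 + q ^+ 2 * mu ^+ 4 <= 14.
  have : q ^+ 2 * mu ^+ 4 <= 1 by exact: mulr_ile1.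
  by have := qn1 4; slra.
rewrite mulrC; apply: ler_pM => //.
- rewrite -addrA addr_ge0//.
    by rewrite !mulr_ge0// addr_ge0// ltW.
  by rewrite addr_ge0// mulr_ge0.
- exact: addr_ge0.
- by slra.
Qed.

Let expM : (1 + lam) * expR (- (p ^+ 2 / 2)) <= 2 * (q + mu).
Proof.
have -> : 1 + lam = (q ^+ 2 + lam * q ^+ 2) * p ^+ 2.
  have -> : (q ^+ 2 + lam * q ^+ 2) * p ^+ 2 = (1 + lam) * (p * q) ^+ 2 by ring.
  by rewrite pq expr1n mulr1.
rewrite lamq2 -mulrA [leRHS]mulrC; apply: ler_pM.
- by rewrite addr_ge0.
- by rewrite mulr_ge0 ?expR_ge0 ?sqr_ge0.
- by rewrite lerD2r expr2 ler_piMr ?(ltW q0)//; slra.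
rewrite expRN ler_pdivrMr ?expR_gt0//.
by have := expR_ge1Dx (p ^+ 2 / 2); slra.
Qed.

Let xp : `|x| <= A + p ^+ 2.
Proof.
have : x <= mu * p ^+ 2 by rewrite -lamE le_max lexx.
have : mu * p ^+ 2 <= p ^+ 2 by rewrite ler_piMl// sqr_ge0.
by have := sqr_ge0 p; have := Ax; rewrite ler_norml; slra.
Qed.

Let rescale (v : R) : `|v - x| <= D * q ^+ 2 ->
  `|v / Num.sqrt (1 + (q ^+ 3) ^+ 2) - x| <= D' * q ^+ 2.
Proof.
move=> vx; have Dge0 : 0 <= D by rewrite addr_ge0.
have h1 := div_sqrt1D_near v (sqr_ge0 (q ^+ 3)).
apply: le_trans (ler_distD v _ _) _.
have -> : D' * q ^+ 2 = (A + 1 + D) * q ^+ 2 + D * q ^+ 2 by rewrite /D'; ring.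
apply: lerD => //; apply: le_trans h1 _.
have hv : `|v| <= (A + 1 + D) * p ^+ 2.
  have : `|v| <= `|x| + `|v - x| by rewrite -{1}(subrK x v) addrC ler_normD.
  have : D * q ^+ 2 <= D by rewrite ler_piMr.
  have : 1 <= p ^+ 2 by rewrite exprn_ege1//; slra.
  move=> p21; have AD : 0 <= A + D by rewrite addr_ge0.
  have := ler_wpM2l AD p21; move: xp vx; slra.
apply: le_trans (ler_wpM2r (sqr_ge0 _) hv) _.
have -> : (A + 1 + D) * p ^+ 2 * (q ^+ 3) ^+ 2 = (A + 1 + D) * q ^+ 2 * (q ^+ 2 * (p * q) ^+ 2) by ring.
rewrite pq expr1n mulr1 ler_piMr// mulr_ge0//.
by rewrite !addr_ge0.
Qed.

Let D'0 : 0 <= D'. Proof. by rewrite /D' /D !addr_ge0. Qed.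

Let D'q : 0 <= D' * q ^+ 2. Proof. by rewrite mulr_ge0. Qed.

Let lamD' : expR (lam * (D' * q ^+ 2)) <= expR D'.
Proof. by rewrite ler_expR mulrCA lamq2 ler_piMr. Qed.

Let q2mu : (1 + lam) * (D' * q ^+ 2) <= D' * (q + mu).
Proof.
have -> : (1 + lam) * (D' * q ^+ 2) = D' * (q ^+ 2 + lam * q ^+ 2) by ring.
rewrite lamq2 ler_wpM2l// lerD2r expr2 ler_piMr ?(ltW q0)//; slra.
Qed.

Let K10 : 0 <= K1. Proof. exact: expR_ge0. Qed.
Let K20 : 0 <= K2.
Proof. by rewrite mulr_ge0 ?heat_cst_ge0// addr_ge0// mulr_ge0// exprn_ge0. Qed.
Let env0 : 0 <= gauss_env x. Proof. exact/ltW/gauss_env_gt0. Qed.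
Let lam10 : 0 <= 1 + lam. Proof. by rewrite addr_ge0. Qed.
(** Common end of the two one-sided bounds: the [D'] term is the shift, [e1 * e2] the Lindeberg
    error, and the term in [e3] the cut-off of the smoothing. *)
Let conclude (a c e1 e2 e3 : R) :
  a <= c + D' * q ^+ 2 * gauss_env x * expR D' + e1 * e2 + expR (- (p ^+ 2 / 2)) * e3 ->
  0 <= e1 -> (1 + lam) * e1 <= K2 * (q + mu) ->
  e2 <= K1 * gauss_env x -> e3 <= K1 * gauss_env x ->
  (1 + lam) * (a - c) <= K3 * (q + mu) * gauss_env x.
Proof.
move=> h e10 he1 he2 he3.
have h2 : (1 + lam) * (e1 * e2) <= K2 * (q + mu) * (K1 * gauss_env x).
  apply: le_trans (_ : (1 + lam) * e1 * (K1 * gauss_env x) <= _).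
    by rewrite -mulrA !ler_wpM2l.
  by rewrite ler_wpM2r// mulr_ge0.
have h3 : (1 + lam) * (expR (- (p ^+ 2 / 2)) * e3) <= 2 * (q + mu) * (K1 * gauss_env x).
  apply: le_trans (_ : (1 + lam) * expR (- (p ^+ 2 / 2)) * (K1 * gauss_env x) <= _).
    by rewrite -mulrA !ler_wpM2l// expR_ge0.
  by rewrite ler_wpM2r// mulr_ge0.
have h1 : (1 + lam) * (D' * q ^+ 2 * gauss_env x * expR D') <= D' * (q + mu) * (gauss_env x * expR D').
  rewrite -[D' * q ^+ 2 * _ * _]mulrA mulrA ler_wpM2r// mulr_ge0// expR_ge0.
have := ler_wpM2l lam10 (_ : a - c <= D' * q ^+ 2 * gauss_env x * expR D' + e1 * e2 + expR (- (p ^+ 2 / 2)) * e3).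
rewrite /K3 => /(_ _); rewrite !mulrDr.
move=> /(_ ltac:(lra)); slra.
Qed.

Lemma moderate_dev_ub : (1 + Num.max x 0) *
  (fine (P [set w | x - C * q ^+ 2 < Sn w]) - normal_tail x) <=
  K3 * (q + mu) * gauss_env x.
Proof.
rewrite lamE -/lam.
have pq2 : p * q ^+ 3 = q ^+ 2 by rewrite exprS mulrA pq mul1r.
have := tail_psum_ub indX idX my' yb' mean_y' mean_y2' t0 nt eps0 eps1 teps
  lam0 lameta (ltW p0) (x - C * q ^+ 2).
rewrite -/Sn pq2; set v := x - C * q ^+ 2 - q ^+ 2.
have vx : `|v - x| <= D * q ^+ 2.
  rewrite (_ : v - x = - (D * q ^+ 2)); last by rewrite /v /D; ring.
  by rewrite normrN ger0_norm// mulr_ge0// addr_ge0.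
have := rescale vx; rewrite ler_distl => /andP[h1 _].
have h2 := normal_tail_near_ub D'q h1.
rewrite lamE -/lam in h2.
set e1 := heat_cst * _; set e2 := expR _ ; set e3 := expR (- (lam * _) + _ + _) => h.
apply: (@conclude _ _ e1 e2 e3) => //.
- apply: le_trans h _; rewrite !lerD2r; apply: le_trans h2 _.
  by rewrite lerD2l ler_wpM2l// mulr_ge0.
- have := @exponent v 1; rewrite mul1r; apply => //.
  by rewrite /v /D; slra.
- have := @exponent (x - C * q ^+ 2) 0; rewrite mul0r addr0 mulr1; apply => //.
  by rewrite /D; have := qn 2; slra.
Qed.

Lemma moderate_dev_lb : (1 + Num.max x 0) *
  (normal_tail x - fine (P [set w | x + C * q ^+ 2 < Sn w])) <=
  K3 * (q + mu) * gauss_env x.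
Proof.
rewrite lamE -/lam.
have pq2 : p * q ^+ 3 = q ^+ 2 by rewrite exprS mulrA pq mul1r.
have := tail_psum_lb indX idX my' yb' mean_y' mean_y2' t0 nt eps0 eps1 teps
  lam0 lameta (ltW p0) (x + C * q ^+ 2) lamM.
rewrite -/Sn pq2; set v := x + C * q ^+ 2 + q ^+ 2.
have vx : `|v - x| <= D * q ^+ 2.
  rewrite (_ : v - x = D * q ^+ 2); last by rewrite /v /D; ring.
  by rewrite ger0_norm// mulr_ge0// addr_ge0.
have := rescale vx; rewrite ler_distl => /andP[_ h1].
have h2 := normal_tail_near_lb D'q h1.
set e1 := heat_cst * _; set e2 := expR _ ; set e3 := expR (- (lam * _) + _ + _) => h.
have Ddom : D' * q ^+ 2 * gauss_env x <= D' * q ^+ 2 * gauss_env x * expR D'.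
  apply: ler_peMr; first exact: mulr_ge0.
  by rewrite -[leLHS]expR0 ler_expR.
apply: (@conclude _ _ e1 e2 e3) => //.
- by apply: le_trans h2 _; move: h Ddom; rewrite /heat; lra.
- have := @exponent v 1; rewrite mul1r; apply => //.
  by rewrite /v /D; move: C0 (qn 2) => c0 q2; have := mulr_ge0 c0 q2; lra.
- have := @exponent (x + C * q ^+ 2) 0; rewrite mul0r addr0 mulr1; apply => //.
  by rewrite /D; move: C0 (qn 2) => c0 q2; have := mulr_ge0 c0 q2; lra.
Qed.

End fixed.

(* With [p = n^{1/12}] the range [x <= del * p ^+ 2] is that of [x = o(n^{1/6})]. The
   smoothing has width [p^{-3}] and cut-off [M = p], and [lam = max(x, 0)] is the
   exponential tilt; all errors are then relative ones of order [p^{-1} + del]. *)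
Lemma moderate_deviation : exists2 K : R, 0 <= K &
  forall (n : nat) (p del x : R), 2 <= p -> b <= p -> n%:R = p ^+ 12 ->
  0 <= del -> del <= 1 -> - A <= x -> x <= del * p ^+ 2 ->
  let S := psum X (fun a => y a * p^-1 ^+ 6) n in
  fine (P [set w | x - C * p^-1 ^+ 2 < S w]) <=
    normal_tail x + K * (p^-1 + del) * normal_tail x /\
  normal_tail x <= fine (P [set w | x + C * p^-1 ^+ 2 < S w])
    + K * (p^-1 + del) * normal_tail x.
Proof.
have m0 := @mills_cst_gt0 R.
have K30 : 0 <= K3.
  have : 0 <= K1 by exact: expR_ge0.
  have : 0 <= D' by rewrite /D' /D !addr_ge0.
  have : 0 <= K2 by rewrite mulr_ge0 ?heat_cst_ge0// addr_ge0// mulr_ge0// exprn_ge0.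
  move=> ? ? ?; apply: addr_ge0; last exact: mulr_ge0.
  by apply: addr_ge0; apply: mulr_ge0 => //; exact: expR_ge0.
exists (K3 / mills_cst); first by rewrite divr_ge0// ltW.
move=> n p del x p2 pb np del0 del1 Ax xdel S.
have p0 : 0 < p by exact: lt_le_trans p2.
have pp0 : 0 < p ^+ 2 by rewrite exprn_gt0.
pose mu := Num.max x 0 / p ^+ 2.
have mu0 : 0 <= mu by rewrite divr_ge0 ?(ltW pp0)// le_max lexx orbT.
have mudel : mu <= del.
  by rewrite ler_pdivrMr// ge_max xdel mulr_ge0// ltW.
have muE : Num.max x 0 = mu * p ^+ 2 by rewrite divfK// gt_eqF.
have lam0 : 0 < 1 + Num.max x 0.
  by rewrite ltr_pwDl// le_max lexx orbT.
have ub := moderate_dev_ub p2 pb np mu0 (le_trans mudel del1) muE Ax.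
have lb := moderate_dev_lb p2 pb np mu0 (le_trans mudel del1) muE Ax.
(* The Mills-type bound trades [gauss_env] for the normal tail; its factor [1 + Num.max x 0] then
   cancels. *)
have key : K3 * (p^-1 + mu) * gauss_env x <=
    (1 + Num.max x 0) * (K3 / mills_cst * (p^-1 + del) * normal_tail x).
  have -> : K3 * (p^-1 + mu) * gauss_env x =
      K3 / mills_cst * (p^-1 + mu) * (mills_cst * gauss_env x).
    by field; rewrite !gt_eqF.
  rewrite [leRHS]mulrCA; apply: ler_pM.
  - apply: mulr_ge0; first by apply: divr_ge0 => //; exact: ltW.
    by apply: addr_ge0 => //; rewrite invr_ge0 ltW.
  - exact: (mulr_ge0 (ltW m0) (ltW (gauss_env_gt0 x))).
  - by rewrite ler_wpM2l ?divr_ge0 ?(ltW m0)// lerD2l.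
  - exact: normal_tail_lb.
have := le_trans ub key; have := le_trans lb key.
by rewrite !(ler_pM2l lam0) -/S => h1 h2; split; lra.
Qed.

End moderate_deviations.

(** * Uniform deviations of the empirical distribution function *)

Section quantile_theory.
Context d (T : measurableType d) (R : realType) (P : probability T R).
Variable X : {RV P >-> R}.
Implicit Types (u v t : R).

Definition rcdf t : R := fine (cdf X t).

Definition rquantile u : R := fine (quantile (cdf X) u).

Lemma rcdfE t : (rcdf t)%:E = cdf X t.
Proof. by rewrite fineK// fin_num_measure. Qed.

Lemma rcdf_ge0 t : 0 <= rcdf t.
Proof. exact: fine_ge0. Qed.

Lemma rcdf_le1 t : rcdf t <= 1.
Proof. by rewrite -lee_fin rcdfE cdf_le1. Qed.

Lemma rcdf_nd : {homo rcdf : s t / s <= t}.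
Proof. by move=> s t st; rewrite -lee_fin !rcdfE cdf_nondecreasing. Qed.

Lemma measurable_rcdf : measurable_fun setT rcdf.
Proof.
apply/measurable_EFinP.
rewrite (_ : EFin \o rcdf = cdf X); first exact: cdf_measurable.
by apply/funext => t /=; rewrite rcdfE.
Qed.

(** Right continuity of the distribution function makes the infimum attained. Later arguments use
    the quantile function through this Galois connection. *)
Lemma rquantile_le u t : 0 < u -> u < 1 -> (rquantile u <= t) = (u <= rcdf t).
Proof.
move=> u0 u1.
have qE : (rquantile u)%:E = ereal_inf [set x%:E | x in [set x : R | (u%:E <= cdf X x)%E]].
  rewrite /rquantile fineK ?quantile_fin_num// /quantile.
  by case: eqP u0 => [->|//]; rewrite ltxx.
apply/idP/idP => [qt|ut]; last first.
  rewrite -lee_fin qE; apply: ereal_inf_lbound; exists t => //=.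
  by rewrite -rcdfE lee_fin.
rewrite leNgt; apply/negP => tu.
have /cvgr_lt : rcdf s @[s --> t^'+] --> rcdf t.
  by apply: fine_cvg; rewrite rcdfE; exact: cdf_right_continuous.
move=> /(_ _ tu) tu'.
near t^'+ => s.
have ts : t < s by near: s; exact: nbhs_right_gt.
have su : rcdf s < u by near: s.
have : (s%:E <= (rquantile u)%:E)%E.
  rewrite qE; apply: le_ereal_inf_tmp => _ [z /= uz <-]; rewrite lee_fin leNgt.
  apply/negP => zs; move: uz; rewrite -rcdfE lee_fin leNgt => /negP; apply.
  exact: le_lt_trans (rcdf_nd (ltW zs)) su.
by rewrite lee_fin leNgt (le_lt_trans qt ts).
Unshelve. all: by end_near. Qed.

Lemma rquantile_gt u t : 0 < u -> u < 1 -> (t < rquantile u) = (rcdf t < u).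
Proof. by move=> u0 u1; rewrite ltNge rquantile_le// -ltNge. Qed.

Lemma rcdf_rquantile u : 0 < u -> u < 1 -> u <= rcdf (rquantile u).
Proof. by move=> u0 u1; rewrite -rquantile_le. Qed.

Lemma rquantile_nd u v : 0 < u -> u <= v -> v < 1 -> rquantile u <= rquantile v.
Proof.
move=> u0 uv v1; rewrite rquantile_le ?(le_lt_trans uv v1)//.
by rewrite (le_trans uv)// rcdf_rquantile// (lt_le_trans u0 uv).
Qed.

(** The open half-line is an increasing union of closed ones whose endpoints lie strictly below the
    quantile, where the distribution function is below [u]. *)
Lemma lt_rquantile_prob u : 0 < u -> u < 1 ->
  fine (P [set w | X w < rquantile u]) <= u.
Proof.
move=> u0 u1; set q := rquantile u.
pose F k := [set w | X w <= q - k.+1%:R^-1].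
have FE k : F k = X @^-1` `]-oo, q - k.+1%:R^-1].
  by apply/seteqP; split=> w /=; rewrite in_itv.
have mF k : measurable (F k).
  by rewrite FE -[X in measurable X]setTI; exact: measurable_funP.
have UF : [set w | X w < q] = \bigcup_k F k.
  apply/seteqP; split=> w /=.
    move=> /ltr_add_invr[k Xk]; exists k => //=.
    by rewrite /F/= lerBrDr ltW.
  by move=> [k _ /le_lt_trans]; apply; rewrite ltrBlDr ltrDl.
have ndF : nondecreasing_seq F.
  move=> i j ij; apply/subsetPset => w /= /le_trans; apply.
  by rewrite lerB// lef_pV2 ?posrE// ler_nat.
have := nondecreasing_cvg_mu (mu := P) mF (bigcup_measurable (fun k _ => mF k)) ndF.
rewrite -UF => cF.
rewrite -lee_fin fineK ?fin_num_measure//; last first.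
  by rewrite UF; exact: bigcup_measurable.
apply: (cvge_le _ cF).
apply: nearW => k /=; rewrite FE.
have -> : P (X @^-1` `]-oo, q - k.+1%:R^-1]) = cdf X (q - k.+1%:R^-1) by [].
by rewrite -rcdfE lee_fin ltW// -rquantile_gt// -/q ltrBlDr ltrDl.
Qed.

End quantile_theory.

(** * Exponential inequalities for counts *)

Section hoeffding.
Context d (T : measurableType d) (R : realType) (P : probability T R).
Variable X : nat -> {RV P >-> R}.
Hypothesis indX : mutually_independent X.
Hypothesis idX : identically_distributed X.

Let measurable_ge (f : T -> R) a : measurable_fun setT f -> measurable [set w | a <= f w].
Proof.
move=> mf; rewrite -[X in measurable X]setTI.
have -> : [set w | a <= f w] = f @^-1` `[a, +oo[.
  by apply/seteqP; split=> w /=; rewrite in_itv/= andbT.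
exact: mf.
Qed.

(** Chernoff's bound with tilt e / 10: the linear gain is n e^2 / 10, the quadratic and cubic terms
    cost at most n e^2 / 20. This is the origin of the 20 in all exceptional probabilities. *)
Let hoeffding1 (y : R -> R) n (e : R) : measurable_fun setT y ->
  (forall x, `|y x| <= 1) -> \int[P]_w y (X 0%N w) = 0 -> 0 <= e -> e <= 1 ->
  fine (P [set w | n%:R * e <= psum X y n w]) <= expR (- (n%:R * e ^+ 2 / 20)).
Proof.
move=> my y1 y0 e0 e1.
have e10 : 0 <= e / 10 by rewrite divr_ge0.
have h1 : e / 10 * 1 <= 1 by lra.
apply: le_trans (chernoff indX idX n (n%:R * e) my y1 y0 e10 h1) _.
rewrite ler_expR mulr1.
have by0 : bounded_rv (fun w => y (X 0%N w)).
  by apply: bounded_rv_comp; [exact: bounded_rv_of my y1|].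
have v1 : \int[P]_w (y (X 0%N w) ^+ 2) <= 1.
  rewrite -(@mean_cst _ _ _ P 1); apply: mean_le; first exact: bounded_rvX.
    exact: bounded_rv_cst.
  move=> w; rewrite -real_normK ?num_real// exprn_ile1//.
have h2 := ler_wpM2l (sqr_ge0 (e / 10)) v1.
have h3 : (e / 10) ^+ 3 <= (e / 10) ^+ 2.
  rewrite exprS ler_piMl ?sqr_ge0//; lra.
have : (e / 10) ^+ 2 * \int[P]_w (y (X 0%N w) ^+ 2) / 2 + 4 * (e / 10) ^+ 3 <= 5 * (e / 10) ^+ 2.
  by have := sqr_ge0 (e / 10); lra.
have n0 : 0 <= n%:R :> R by [].
move=> /(ler_wpM2l n0); lra.
Qed.

Let measurableU_le (A B : set T) : measurable A -> measurable B ->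
  fine (P (A `|` B)) <= fine (P A) + fine (P B).
Proof.
move=> mA mB; have mAB : measurable (A `|` B) by exact: measurableU.
rewrite -lee_fin EFinD !fineK ?fin_num_measure//.
exact: measureU2.
Qed.

Let bigsetU_prob_le (bad : nat -> set T) N (c : R) : (forall j, measurable (bad j)) ->
  (forall j, fine (P (bad j)) <= c) ->
  fine (P (\big[setU/set0]_(j < N) bad j)) <= N%:R * c.
Proof.
move=> mbad Pbad; elim: N => [|N ih].
  by rewrite big_ord0 measure0 mul0r.
rewrite big_ord_recr/= -natr1 mulrDl mul1r.
apply: le_trans (measurableU_le _ (mbad N)) _; first exact: bigsetU_measurable.
exact: lerD.
Qed.

Let count_dev (B : set R) n w := psum X (fun x => \1_B x - fine (P (X 0%N @^-1` B))) n w.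

Let count_devE (B : set R) n w : count_dev B n w = \sum_(i < n) \1_B (X i w) - n%:R * fine (P (X 0%N @^-1` B)).
Proof.
rewrite /count_dev /psum sumrB; congr (_ - _).
by rewrite sumr_const card_ord mulr_natl.
Qed.

Lemma hoeffding (B : set R) n (e : R) : measurable B -> 0 <= e -> e <= 1 ->
  measurable [set w | n%:R * e <= `|\sum_(i < n) \1_B (X i w) - n%:R * fine (P (X 0%N @^-1` B))| ] /\
  fine (P [set w | n%:R * e <= `|\sum_(i < n) \1_B (X i w) - n%:R * fine (P (X 0%N @^-1` B))| ])
  <= 2 * expR (- (n%:R * e ^+ 2 / 20)).
Proof.
move=> mB e0 e1; set p := fine _.
have mXB : measurable (X 0%N @^-1` B).
  by rewrite -[X in measurable X]setTI; exact: measurable_funP.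
have p0 : 0 <= p by exact: fine_ge0.
have p1 : p <= 1 by rewrite -lee_fin fineK ?fin_num_measure// probability_le1.
pose y := fun x : R => \1_B x - p.
pose y' := fun x : R => p - \1_B x.
have my : measurable_fun setT y by apply: measurable_funB => //; exact: measurable_indic.
have my' : measurable_fun setT y' by apply: measurable_funB => //; exact: measurable_indic.
have y1 x : `|y x| <= 1.
  by rewrite /y indicE ler_norml; case: (_ \in _) => /=; lra.
have y1' x : `|y' x| <= 1 by rewrite /y' distrC; exact: y1.
have bi : bounded_rv (fun w => \1_B (X 0%N w) : R).
  by apply: bounded_rv_comp => //; exact: bounded_rv_indic.
have Ei : \int[P]_w \1_B (X 0%N w) = p by rewrite /p -(mean_indic P mXB).
have c := @bounded_rv_cst _ T R.
have y0 : \int[P]_w y (X 0%N w) = 0 by rewrite /y meanB// mean_cst Ei subrr.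
have y0' : \int[P]_w y' (X 0%N w) = 0 by rewrite /y' meanB// mean_cst Ei subrr.
have yE w : psum X y n w = \sum_(i < n) \1_B (X i w) - n%:R * p by exact: count_devE.
have y'E w : psum X y' n w = - psum X y n w.
  by rewrite /psum -sumrN; apply: eq_bigr => i _; rewrite /y' /y opprB.
have -> : [set w | n%:R * e <= `|\sum_(i < n) \1_B (X i w) - n%:R * p| ] =
    [set w | n%:R * e <= psum X y n w] `|` [set w | n%:R * e <= psum X y' n w].
  apply/seteqP; split=> w /=; rewrite -yE y'E.
    by rewrite ler_normr => /orP[]; [left|right].
  by rewrite ler_normr => -[] ->//; rewrite orbT.
have m1 := measurable_ge (n%:R * e) (measurable_psum X n my).
have m2 := measurable_ge (n%:R * e) (measurable_psum X n my').
split; first exact: measurableU.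
apply: le_trans (measurableU_le m1 m2) _.
have h1 := hoeffding1 n my y1 y0 e0 e1; have h2 := hoeffding1 n my' y1' y0' e0 e1.
by move: h1 h2; lra.
Qed.


Definition ecount (w : T) n (t : R) : R := \sum_(i < n) (X i w <= t)%R%:R.

Let F := rcdf (X 0%N).
Let Q := rquantile (X 0%N).

Let ecountE w n t : ecount w n t = \sum_(i < n) \1_(`]-oo, t]) (X i w).
Proof.
apply: eq_bigr => i _; rewrite indicE; congr (_ %:R).
by rewrite mem_setE in_itv.
Qed.

Lemma ecount_nd w n : {homo ecount w n : s t / s <= t}.
Proof.
move=> s t st; apply: ler_sum => i _; rewrite ler_nat.
by case: (leP (X i w) s) => // Xs; rewrite (le_trans Xs).
Qed.

Lemma ecount_ge0 w n t : 0 <= ecount w n t.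
Proof. exact: sumr_ge0. Qed.

Lemma ecount_le w n t : ecount w n t <= n%:R.
Proof.
rewrite -[n in leRHS]card_ord -sum1_card natr_sum.
by apply: ler_sum => i _; rewrite ler_nat; case: (_ <= _).
Qed.

(* Hoeffding's inequality at the quantiles of order [j / N], for closed and for open
   half-lines as the distribution function may jump; monotonicity does the rest. *)
Lemma uniform_deviation n N (e : R) : (0 < n)%N -> (0 < N)%N -> 0 <= e -> e <= 1 ->
  exists bad : set T, [/\ measurable bad,
    fine (P bad) <= N%:R * (4 * expR (- (n%:R * e ^+ 2 / 20))) &
    forall w, ~ bad w -> forall t, `|ecount w n t / n%:R - F t| <= e + N%:R^-1].
Proof.
move=> n0 N0 e0 e1.
have n0' : 0 < n%:R :> R by rewrite ltr0n.
have N0' : 0 < N%:R :> R by rewrite ltr0n.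
(* [x 0] may be the default value of an infinite quantile; the comparisons below are made for
   [0 < j < N]. *)
pose x j := Q (j%:R / N%:R).
pose dev (B : set R) := [set w | n%:R * e <= `|\sum_(i < n) \1_B (X i w) - n%:R * fine (P (X 0%N @^-1` B))| ].
pose bad j := dev `]-oo, x j]%classic `|` dev `]-oo, x j[%classic.
have mdev j : measurable (dev `]-oo, x j]%classic) by have [] := hoeffding n (measurable_itv `]-oo, x j]) e0 e1.
have mdev' j : measurable (dev `]-oo, x j[%classic) by have [] := hoeffding n (measurable_itv `]-oo, x j[) e0 e1.
have mbad j : measurable (bad j) by exact: measurableU.
set E := expR _; have E0 : 0 <= E by exact: expR_ge0.
have Pbad j : fine (P (bad j)) <= 4 * E.
  apply: le_trans (measurableU_le (mdev j) (mdev' j)) _.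
  have [_ h1] := hoeffding n (measurable_itv `]-oo, x j]) e0 e1.
  have [_ h2] := hoeffding n (measurable_itv `]-oo, x j[) e0 e1.
  by move: h1 h2; rewrite -/E -/(dev _) -/(dev _); lra.
exists (\big[setU/set0]_(j < N) bad j); split.
- by apply: bigsetU_measurable.
- exact: bigsetU_prob_le.
move=> w nbad t.
have good j : (j < N)%N -> ~ bad j w.
  move=> jN bj; apply: nbad; rewrite -bigcup_mkord; exists j => //.
have devE (B : set R) : ~ dev B w -> `|(\sum_(i < n) \1_B (X i w)) / n%:R - fine (P (X 0%N @^-1` B))| <= e.
  rewrite /dev /= => /negP; rewrite -ltNge => /ltW h.
  rewrite -(ler_pM2l n0') -[X in X * `|_|](gtr0_norm n0') -normrM.
  by rewrite mulrBr mulrCA divff ?gt_eqF// mulr1.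
pose Fn s := ecount w n s / n%:R.
have Fn_nd s u : s <= u -> Fn s <= Fn u.
  by move=> su; rewrite ler_wpM2r ?invr_ge0// ecount_nd.
have Fn0 s : 0 <= Fn s by rewrite divr_ge0// ecount_ge0.
have Fn1 s : Fn s <= 1 by rewrite ler_pdivrMr// mul1r ecount_le.
have jN0 j : (0 < j)%N -> 0 < j%:R / N%:R :> R by move=> j0; rewrite divr_gt0// ltr0n.
have jN1 j : (j < N)%N -> j%:R / N%:R < 1 :> R by move=> jN; rewrite ltr_pdivrMr// mul1r ltr_nat.
have A1 j : (0 < j)%N -> (j < N)%N -> j%:R / N%:R - e <= Fn (x j).
  move=> j0 jN; have nb : ~ dev `]-oo, x j]%classic w by move=> h; apply: (good j jN); left.
  have := devE _ nb; rewrite -ecountE -/(Fn _) ler_distl => /andP[+ _].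
  have : j%:R / N%:R <= F (x j) by rewrite rcdf_rquantile// ?jN0// jN1.
  by rewrite /F /rcdf /cdf /distribution /pushforward; lra.
have A2 j s : (0 < j)%N -> (j < N)%N -> s < x j -> Fn s <= j%:R / N%:R + e.
  move=> j0 jN sx; have nb : ~ dev `]-oo, x j[%classic w by move=> h; apply: (good j jN); right.
  have := devE _ nb; rewrite ler_distl => /andP[_ +].
  have h1 : Fn s <= (\sum_(i < n) \1_(`]-oo, x j[) (X i w)) / n%:R.
    rewrite ler_wpM2r ?invr_ge0// ler_sum// => i _; rewrite indicE mem_setE in_itv/= ler_nat.
    by case: (leP (X i w) s) => // Xs; rewrite (le_lt_trans Xs).
  have : fine (P (X 0%N @^-1` `]-oo, x j[)) <= j%:R / N%:R.
    have <- : [set w | X 0%N w < x j] = X 0%N @^-1` `]-oo, x j[%classic.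
      by apply/seteqP; split=> z /=; rewrite in_itv.
    exact: lt_rquantile_prob (jN0 _ j0) (jN1 _ jN).
  by move: h1; lra.
have Ft0 : 0 <= F t by exact: rcdf_ge0.
have Ft1 : F t <= 1 by exact: rcdf_le1.
pose k := Num.truncn (N%:R * F t).
have /andP[k1 k2] : k%:R <= N%:R * F t < k.+1%:R.
  by apply: truncn_itv; rewrite mulr_ge0// ltW.
have k1' : k%:R / N%:R <= F t by rewrite ler_pdivrMr// mulrC.
have k2' : F t < k.+1%:R / N%:R by rewrite ltr_pdivlMr// mulrC.
rewrite -/(Fn t) ler_distl; apply/andP; split.
(* Lower bound, from the grid point below [t]; the minimum with [N.-1] covers [F t = 1]. At index 0
   one has [F t <= N^-1], and nonnegativity of the empirical function suffices. *)
- case: (posnP (minn k N.-1)) => [j0|j0].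
    have : F t <= N%:R^-1.
      move: j0; rewrite /minn; case: ifP => _ j0.
        by move: k2'; rewrite j0 div1r => /ltW.
      have -> : N%:R = 1 :> R by rewrite -(prednK N0) j0.
      by rewrite invr1.
    by have := Fn0 t; lra.
  set j := minn k N.-1 in j0.
  have jN : (j < N)%N by rewrite (leq_ltn_trans (geq_minr _ _))// prednK.
  have xt : x j <= t.
    rewrite /x /Q rquantile_le ?jN0 ?jN1//; apply: le_trans k1'.
    by rewrite ler_wpM2r ?invr_ge0 ?(ltW N0')// ler_nat geq_minl.
  have : F t <= j%:R / N%:R + N%:R^-1.
    rewrite -[X in _ + X]div1r -mulrDl natr1 /j /minn; case: ifP => _; first exact: ltW.
    by rewrite prednK// divff ?gt_eqF.
  by have := A1 j j0 jN; have := Fn_nd _ _ xt; lra.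
(* Upper bound, from the open half-line at the next grid point. In the last cell [F t >= 1 - N^-1],
   and the empirical function is at most 1. *)
case: (ltnP k.+1 N) => kN.
  have tx : t < x k.+1 by rewrite /x /Q rquantile_gt ?jN0 ?jN1.
  have := A2 k.+1 t isT kN tx; rewrite -natr1 mulrDl div1r; lra.
have : 1 - N%:R^-1 <= k%:R / N%:R :> R.
  by rewrite lerBlDr -[X in _ + X]div1r -mulrDl natr1 ler_pdivlMr// mul1r ler_nat.
by have := Fn1 t; lra.
Qed.

End hoeffding.

(** * Linearization of the trimmed L-statistic *)

Section order_statistics.
Context {R : realType}.
Implicit Types (x : nat -> R) (t : R).
Notation mu := (@lebesgue_measure R).

Lemma order_stat_le x n i t : (0 < i <= n)%N ->
  (order_stat x n i <= t) = (i <= \sum_(j < n) (x j <= t)%R)%N.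
Proof.
move=> /andP[i0 iN]; rewrite /order_stat.
set s := sort _ _.
have ss : sorted <=%O s by apply: sort_le_sorted.
have sz : size s = n by rewrite size_sort size_mkseq.
have -> : (\sum_(j < n) (x j <= t)%R)%N = count (fun z => z <= t) s.
  rewrite count_sort -sum1_count [RHS]big_mkcond/= /mkseq big_map.
  rewrite (_ : iota 0 n = index_iota 0 n) ?big_mkord; last by rewrite /index_iota subn0.
  by apply: eq_bigr => j _; case: (_ <= _).
case: i i0 iN => // i _ iN /=.
case: (ltnP i (count (fun z => z <= t) s)) => h.
  exact: nth_count_le.
apply/negbTE; rewrite -ltNge; apply: nth_count_gt => //.
by rewrite h sz.
Qed.

(** Writes a number as [hi] minus an integral of indicators; applied to order statistics and to
    quantiles, it puts the statistic and its centering in the same form. *)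
Lemma layer_cake (lo hi a : R) : lo <= a -> a <= hi ->
  \int[mu]_(t in `[lo, hi]) ((a <= t)%R%:R) = hi - a.
Proof.
move=> loa ahi.
have -> : (fun t : R => (a <= t)%R%:R : R) = \1_`[a, +oo[.
  by apply/funext => t; rewrite indicE mem_setE in_itv/= andbT.
rewrite /Rintegral integral_indic//= setIC.
rewrite (_ : `[lo, hi] `&` `[a, +oo[ = `[a, hi]%classic); last first.
  apply/seteqP; split=> t /=; rewrite !in_itv/= andbT.
    by move=> [/andP[_ ->] ->].
  by move=> /andP[h ->]; rewrite (le_trans loa h).
rewrite lebesgue_measure_itv/= lte_fin; move: ahi; rewrite le_eqVlt.
by move=> /predU1P[->|->//]; rewrite ltxx subrr.
Qed.

End order_statistics.

(** * Clipped antiderivative of the weight function *)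

Section antiderivative.
Context {R : realType}.
Notation mu := (@lebesgue_measure R).
Variables (j : R -> R) (CJ M : R).
Hypothesis jlip : forall u v, `|j u - j v| <= CJ * `|u - v|.
Hypothesis jM : forall u, `|j u| <= M.

Let CJ0 : 0 <= CJ.
Proof.
have := jlip 1 0; rewrite subr0 normr1 mulr1; exact: le_trans.
Qed.

Let M0 : 0 <= M. Proof. exact: le_trans (jM 0). Qed.

Lemma lipschitz_continuous (f : R -> R) (K : R) :
  (forall u v, `|f u - f v| <= K * `|u - v|) -> continuous f.
Proof.
move=> fK u; apply/cvgrPdist_le => e e0.
have K0 : 0 <= K by have := fK 1 0; rewrite subr0 normr1 mulr1; exact: le_trans.
near=> v; apply: le_trans (fK u v) _.
have h : `|u - v| <= e / (K + 1).
  near: v; apply/nbhs_ballP; exists (e / (K + 1)); first by rewrite /= divr_gt0// ltr_wpDl.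
  by move=> w; rewrite /ball/= => /ltW.
apply: (@le_trans _ _ ((K + 1) * (e / (K + 1)))).
  by apply: ler_pM => //; rewrite lerDl.
by rewrite mulrC divfK// gt_eqF// ltr_wpDl.
Unshelve. all: by end_near. Qed.

Let cj : continuous j. Proof. exact: lipschitz_continuous jlip. Qed.

Let mj : measurable_fun setT j. Proof. exact: continuous_measurable_fun. Qed.

Lemma bounded_itv_integrable (f : R -> R) (a b : R) : bounded_rv f ->
  mu.-integrable `[a, b] (EFin \o f).
Proof.
have abfin : (mu `[a, b]%classic < +oo)%E.
  by rewrite lebesgue_measure_itv/= lte_fin; case: ifP => _; rewrite -?EFinB ltry.
move=> [mf [K fK]]; apply: measurable_bounded_integrable => //.
- exact: measurable_funTS.
- by exists K; split; [exact: num_real|move=> N KN w _ /=; rewrite (le_trans (fK w))// ltW].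
Qed.

Let ij a b : mu.-integrable `[a, b] (EFin \o j).
Proof. by apply: bounded_itv_integrable; split => //; exists M. Qed.

(* Any base point far enough to the left of [[0, 1]] would do. *)
Definition antideriv (v : R) : R := \int[mu]_(u in `[-3, v]) j u.

Lemma antiderivB (a b : R) : -3 <= a -> a <= b ->
  \int[mu]_(u in `[a, b]) j u = antideriv b - antideriv a.
Proof.
move=> a3 ab; rewrite /antideriv (@Rintegral_itvB R j (BLeft (-3)) (BRight b) a).
- rewrite Rintegral_itv_obnd_cbnd//.
  by apply: integrableS (ij a b) => //; exact: subset_itv_oc_cc.
- exact: ij.
- by rewrite bnd_simp.
- by rewrite bnd_simp.
Qed.

Lemma is_derive_antideriv (v : R) : -3 < v -> is_derive v 1 antideriv (j v).
Proof.
move=> v3; have vv1 : v < v + 1 by rewrite ltrDl.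
have [h1 h2] := @continuous_FTC1_closed R j (-3) v (v + 1) vv1 (ij _ _) v3 (@cj v).
by split; [exact: h1|rewrite -derive1E; exact: h2].
Qed.


Lemma antideriv_lip (u v : R) : 0 <= u -> u <= 1 -> 0 <= v -> v <= 1 ->
  `|antideriv v - antideriv u| <= M * `|v - u|.
Proof.
move=> u0 u1 v0 v1; apply: (@mean_value_le R antideriv j) => t.
- move=> tu; apply: is_derive_antideriv.
  have : `|v - u| <= 1 by rewrite ler_norml; lra.
  by move=> /(le_trans tu); rewrite ler_norml; lra.
- by move=> _; exact: jM.
Qed.

Lemma antideriv_taylor (u v : R) : 0 <= u -> u <= 1 -> 0 <= v -> v <= 1 ->
  `|antideriv v - antideriv u - j u * (v - u)| <= CJ * `|v - u| ^+ 2.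
Proof.
move=> u0 u1 v0 v1.
have dd t : `|t - u| <= `|v - u| ->
    is_derive t 1 (fun t => antideriv t - j u * t) (j t - j u).
  move=> tu; have ht : is_derive t 1 antideriv (j t).
    apply: is_derive_antideriv.
    have : `|v - u| <= 1 by rewrite ler_norml; lra.
    by move=> /(le_trans tu); rewrite ler_norml; lra.
  by apply: is_derive_eq; rewrite /GRing.scale/=; ring.
have := @mean_value_le R _ _ u v (CJ * `|v - u|) dd.
rewrite -mulrA -expr2 => h.
rewrite (_ : _ - _ - _ = antideriv v - j u * v - (antideriv u - j u * u)); last by ring.
apply: h => t tu; apply: le_trans (jlip _ _) _.
by rewrite ler_wpM2l.
Qed.

Section clipped.
Variables (an bn : R).
Hypotheses (an0 : 0 <= an) (anbn : an <= bn) (bn1 : bn <= 1).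

Let clip (v : R) := Num.max an (Num.min bn v).

Let clip_ge v : an <= clip v. Proof. by rewrite le_max lexx. Qed.
Let clip_le v : clip v <= bn. Proof. by rewrite ge_max anbn ge_min lexx. Qed.
Let clip0 v : 0 <= clip v. Proof. exact: le_trans (clip_ge v). Qed.
Let clip1 v : clip v <= 1. Proof. exact: le_trans (clip_le v) _. Qed.

Let clip_id v : an <= v -> v <= bn -> clip v = v.
Proof. by move=> av vb; rewrite /clip (min_idPr vb) (max_idPr av). Qed.

Let clip_lo v : v <= an -> clip v = an.
Proof.
move=> va; apply/max_idPl; rewrite ge_min va orbT//.
Qed.

Let clip_hi v : bn <= v -> clip v = bn.
Proof. by move=> bv; rewrite /clip (min_idPl bv); apply/max_idPr. Qed.

Let clip_lip (u v : R) : `|clip v - clip u| <= `|v - u|.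
Proof.
have ab := anbn.
wlog uv : u v / u <= v.
  by move=> h; case: (leP u v) => [/h//|/ltW/h]; rewrite distrC [leRHS]distrC.
rewrite /clip; case: (leP bn v) => hv; case: (leP bn u) => hu;
  rewrite ?(max_r anbn) ?subrr ?normr0//.
- by case: (leP an u) => ?; rewrite !ger0_norm; lra.
- by exfalso; lra.
- by case: (leP an v) => ?; case: (leP an u) => ?; rewrite ?subrr ?normr0// !ger0_norm; lra.
Qed.

(** The mass that [j] gives to the part of [[an, bn]] below [v]. Composed with a distribution
    function and integrated, it yields the trimmed functional up to sign and an additive
    constant. *)
Definition clipped_antideriv v := antideriv (clip v) - antideriv an.

Lemma clipped_antideriv_lip u v :
  `|clipped_antideriv v - clipped_antideriv u| <= M * `|v - u|.
Proof.
rewrite /clipped_antideriv opprB addrA subrK.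
apply: le_trans (antideriv_lip _ _ _ _) _ => //.
by rewrite ler_wpM2l.
Qed.

Lemma measurable_clipped_antideriv : measurable_fun setT clipped_antideriv.
Proof.
apply: continuous_measurable_fun; apply: lipschitz_continuous.
by move=> u v; exact: clipped_antideriv_lip.
Qed.

Lemma clipped_antideriv_bounded v : `|clipped_antideriv v| <= M.
Proof.
apply: le_trans (antideriv_lip _ _ _ _) _ => //; first exact: le_trans bn1.
rewrite -[leRHS]mulr1 ler_wpM2l// ger0_norm ?subr_ge0//.
by have := clip1 v; have := an0; lra.
Qed.

Lemma integral_indic_antideriv (v : R) :
  \int[mu]_(u in `[an, bn]) (j u * (u <= v)%R%:R) = clipped_antideriv v.
Proof.
have -> : \int[mu]_(u in `[an, bn]) (j u * (u <= v)%R%:R) =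
          \int[mu]_(u in `[an, bn] `&` `]-oo, v]) j u.
  rewrite Rintegral_mkcondr; apply: eq_Rintegral => u _.
  by rewrite patchE mem_setE in_itv/=; case: ifP; rewrite ?mulr1 ?mulr0.
case: (ltP v an) => va.
  rewrite (_ : _ `&` _ = set0) ?Rintegral_set0; last first.
    apply/seteqP; split => // u /=; rewrite !in_itv/= => -[/andP[au _] uv].
    by have := le_lt_trans (le_trans au uv) va; rewrite ltxx.
  by rewrite /clipped_antideriv clip_lo ?subrr// ltW.
rewrite (_ : _ `&` _ = `[an, clip v]%classic); last first.
  have cE : clip v = Num.min bn v by apply/max_idPr; rewrite le_min anbn.
  apply/seteqP; split => u /=; rewrite !in_itv/= cE le_min.
    by move=> [/andP[-> ->] ->].
  by move=> /and3P[-> -> ->].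
rewrite antiderivB//; apply: le_trans an0; lra.
Qed.

Variables (al be lam rho : R).
Hypotheses (anal : `|an - al| <= rho) (bnbe : `|bn - be| <= rho).
Hypothesis lam0 : 0 <= lam.

(* Away from [al] and [be] the clipped antiderivative is smooth or constant;
   near them its increments are only of first order. *)
Lemma clipped_antideriv_linear (v v' : R) : 0 <= v -> v <= 1 -> 0 <= v' -> v' <= 1 ->
  `|v' - v| <= lam ->
  `|clipped_antideriv v' - clipped_antideriv v - j v * (al <= v < be)%R%:R * (v' - v)| <=
  CJ * lam ^+ 2 + 2 * M * lam *
    ((al - (rho + lam) <= v < al + (rho + lam))%R%:R + (be - (rho + lam) <= v < be + (rho + lam))%R%:R).
Proof.
move=> v0 v1 v'0 v'1 vv'.
have rho0 : 0 <= rho by exact: le_trans anal.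
have ab := anbn; have l0 := lam0.
have /andP[a1 a2] : al - rho <= an <= al + rho by rewrite -ler_distl.
have /andP[b1 b2] : be - rho <= bn <= be + rho by rewrite -ler_distl.
have /andP[w1 w2] : v - lam <= v' <= v + lam by rewrite -ler_distl.
have CJl : 0 <= CJ * lam ^+ 2 by rewrite mulr_ge0// sqr_ge0.
have Ml : 0 <= M * lam by rewrite mulr_ge0.
have crude : `|clipped_antideriv v' - clipped_antideriv v - j v * (al <= v < be)%R%:R * (v' - v)| <= 2 * M * lam.
  apply: le_trans (ler_normB _ _) _.
  have h1 := clipped_antideriv_lip v v'.
  have h2 : `|j v * (al <= v < be)%R%:R * (v' - v)| <= M * lam.
    rewrite normrM ler_pM// normrM -[leRHS]mulr1 ler_pM//.
    by case: (_ && _); rewrite ?normr1 ?normr0.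
  have h3 := ler_wpM2l M0 vv'; lra.
have [c1|c1] := boolP (al - (rho + lam) <= v < al + (rho + lam)).
  apply: le_trans crude _; rewrite -[X in X <= _]add0r lerD//.
  by rewrite -[X in X <= _]mulr1 ler_wpM2l ?mulr_ge0// lerDl.
have [c2|c2] := boolP (be - (rho + lam) <= v < be + (rho + lam)).
  apply: le_trans crude _; rewrite -[X in X <= _]add0r lerD//.
  by rewrite -[X in X <= _]mulr1 ler_wpM2l ?mulr_ge0// lerDr.
(* Outside both windows, [v] and [v'] are together below [an], above [bn], or between the two: the
   windows have half-width [rho + lam] for this purpose. *)
rewrite addr0 mulr0 addr0.
move: c1 c2; rewrite !negb_and -!ltNge -!leNgt => c1 c2.
case: (ltP v (al - (rho + lam))) c1 => [v_lo _|_ /= c1].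
  rewrite /clipped_antideriv !clip_lo; [|lra|lra].
  rewrite [al <= v]leNgt (_ : v < al); last lra.
  by rewrite mulr0 mul0r !subrr normr0.
case: (leP (be + (rho + lam)) v) c2 => [v_hi _|_].
  rewrite /clipped_antideriv !clip_hi; [|lra|lra].
  rewrite andbC [v < be]ltNge (_ : be <= v); last lra.
  by rewrite mulr0 mul0r !subrr normr0.
rewrite orbF => c2.
rewrite /clipped_antideriv !clip_id; [|lra|lra|lra|lra].
rewrite (_ : al <= v < be) ?mulr1; last lra.
rewrite (_ : _ - _ - _ - _ = antideriv v' - antideriv v - j v * (v' - v)); last by ring.
apply: le_trans (antideriv_taylor _ _ _ _) _ => //.
by rewrite ler_wpM2l// lerXn2r ?nnegrE.
Qed.

End clipped.
End antiderivative.

(** * Fubini for bounded functions on sets of finite measure *)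

Section bounded_fubini.
Context d1 d2 (T1 : measurableType d1) (T2 : measurableType d2) (R : realType).
Variables (m1 : {sigma_finite_measure set T1 -> \bar R}).
Variables (m2 : {sigma_finite_measure set T2 -> \bar R}).
Variables (D1 : set T1) (D2 : set T2).
Hypotheses (mD1 : measurable D1) (mD2 : measurable D2).
Hypotheses (D1fin : (m1 D1 < +oo)%E) (D2fin : (m2 D2 < +oo)%E).
Variables (f : T1 * T2 -> R) (K : R).
Hypothesis mf : measurable_fun setT f.
Hypothesis fK : forall z, `|f z| <= K.

Let K0 : 0 <= K. Proof. exact: le_trans (fK point). Qed.

Lemma bounded_on_integrable d (T : measurableType d) (mu : {measure set T -> \bar R})
    (D : set T) (g : T -> R) (C : R) : measurable D -> (mu D < +oo)%E ->
  measurable_fun setT g -> (forall x, `|g x| <= C) -> mu.-integrable D (EFin \o g).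
Proof.
move=> mD Dfin mg gC; apply: measurable_bounded_integrable => //.
  exact: measurable_funTS.
by exists C; split; [exact: num_real|move=> N CN w _ /=; rewrite (le_trans (gC w))// ltW].
Qed.

Let msec1 x : measurable_fun setT (fun y => f (x, y)).
Proof. exact: measurableT_comp. Qed.

Let msec2 y : measurable_fun setT (fun x => f (x, y)).
Proof. exact: measurableT_comp. Qed.

(** The indicators move the restricted integrals to the whole spaces, where Fubini's theorem
    applies. *)
Let cut (z : T1 * T2) : R := f z * (\1_D1 z.1 * \1_D2 z.2).

Let int_cut1 x : (\int[m2]_y (cut (x, y))%:E = (\1_D1 x * \int[m2]_(y in D2) f (x, y))%:E)%E.
Proof.
have i1 : m2.-integrable D2 (EFin \o (fun y => f (x, y))).
  exact: bounded_on_integrable (fun y => fK (x, y)).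
rewrite EFinM /Rintegral fineK; last exact: integrable_fin_num.
rewrite -integralZl// integral_mkcond; apply: eq_integral => y _.
rewrite patchE /cut/= !indicE; case: (y \in D2) => /=.
  by rewrite mulr1 -EFinM mulrC.
by rewrite !mulr0.
Qed.

Let int_cut2 y : (\int[m1]_x (cut (x, y))%:E = (\1_D2 y * \int[m1]_(x in D1) f (x, y))%:E)%E.
Proof.
have i1 : m1.-integrable D1 (EFin \o (fun x => f (x, y))).
  exact: bounded_on_integrable (fun x => fK (x, y)).
rewrite EFinM /Rintegral fineK; last exact: integrable_fin_num.
rewrite -integralZl// integral_mkcond; apply: eq_integral => x _.
rewrite patchE /cut/= !indicE; case: (x \in D1) => /=.
  by rewrite mul1r -EFinM mulrC.
by rewrite mul0r !mulr0.
Qed.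

Let integrable_cut : (m1 \x m2)%E.-integrable setT (EFin \o cut).
Proof.
have -> : EFin \o cut = (EFin \o f) \_ (D1 `*` D2).
  apply/funext => -[x y] /=; rewrite patchE /cut/= !indicE in_setX.
  by case: (x \in D1); case: (y \in D2) => /=; rewrite ?(mulr0, mulr1, mul0r).
apply/(integrable_mkcond _ (measurableX mD1 mD2)).1.
have D12 : ((m1 \x m2) (D1 `*` D2) < +oo)%E.
  by rewrite product_measure1E// lte_mul_pinfty// ge0_fin_numE.
exact: (bounded_on_integrable (measurableX mD1 mD2) D12 mf fK).
Qed.

Lemma Rintegral_fubini :
  \int[m1]_(x in D1) \int[m2]_(y in D2) f (x, y) =
  \int[m2]_(y in D2) \int[m1]_(x in D1) f (x, y).
Proof.
have e1 : (\int[m1]_x \int[m2]_y (cut (x, y))%:E)%E =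
    (\int[m1]_(x in D1) (\int[m2]_(y in D2) f (x, y))%:E)%E.
  rewrite [RHS]integral_mkcond; apply: eq_integral => x _.
  by rewrite int_cut1 patchE indicE; case: (x \in D1); rewrite ?mul1r ?mul0r.
have e2 : (\int[m2]_y \int[m1]_x (cut (x, y))%:E)%E =
    (\int[m2]_(y in D2) (\int[m1]_(x in D1) f (x, y))%:E)%E.
  rewrite [RHS]integral_mkcond; apply: eq_integral => y _.
  by rewrite int_cut2 patchE indicE; case: (y \in D2); rewrite ?mul1r ?mul0r.
by rewrite {1}/Rintegral -e1 [RHS]/Rintegral -e2 (Fubini integrable_cut).
Qed.

(** Adding the bound [K] makes the integrand nonnegative, so that Tonelli's measurability statement
    applies; the added constant integral is subtracted at the end. *)
Lemma measurable_Rintegral_section :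
  measurable_fun setT (fun x => \int[m2]_(y in D2) f (x, y)).
Proof.
pose g z : \bar R := (((f z + K) * \1_D2 z.2)%:E)%E.
have g0 z : (0 <= g z)%E.
  by rewrite lee_fin mulr_ge0// -lerBlDr sub0r; have := fK z; rewrite ler_norml => /andP[].
have mg : measurable_fun setT g.
  apply/measurable_EFinP; apply: measurable_funM; first exact: measurable_funD.
  by apply: measurableT_comp => //; exact: measurable_indic.
have mF := measurable_fun_fubini_tonelli_F (m2 := m2) g mg g0.
rewrite (_ : (fun x => _) = fun x => fine (fubini_F m2 g x) - K * fine (m2 D2)).
  apply: measurable_funB => //.
  exact: measurableT_comp.
apply/funext => x; rewrite /fubini_F.
have -> : (\int[m2]_y g (x, y) = \int[m2]_(y in D2) (f (x, y) + K)%:E)%E.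
  rewrite [RHS]integral_mkcond; apply: eq_integral => y _.
  by rewrite patchE /g indicE/=; case: (y \in D2); rewrite ?mulr1 ?mulr0.
rewrite -/(Rintegral m2 D2 (fun y => f (x, y) + K)) RintegralD//.
- by rewrite Rintegral_cst// addrK.
- exact: bounded_on_integrable (fun y => fK (x, y)).
- by apply: bounded_on_integrable => // y; exact: lexx.
Qed.

End bounded_fubini.

(** * Integral representation of trimmed sums *)

Section trimmed_sums.
Context {R : realType}.
Notation mu := (@lebesgue_measure R).
Variable j : R -> R.

Definition empirical (x : nat -> R) n (t : R) : R := (\sum_(i < n) (x i <= t)%R%:R) / n%:R.

Let Th := antideriv j.

Lemma bounded_rv_le (F : R -> R) (a : R) : measurable_fun setT F ->
  bounded_rv (fun t => (a <= F t)%R%:R : R).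
Proof.
move=> mF; split; last by exists 1 => t; case: (a <= F t); rewrite ?normr1 ?normr0.
have -> : (fun t => (a <= F t)%R%:R) = \1_(`[a, +oo[%classic : set R) \o F :> (R -> R).
  by apply/funext => t /=; rewrite indicE mem_setE in_itv/= andbT.
by apply: measurableT_comp => //; exact: measurable_indic.
Qed.

Lemma bounded_rv_empirical x n : bounded_rv (empirical x n).
Proof.
apply: bounded_rvM (bounded_rv_cst _ _); apply: bounded_rv_sum => i.
exact: (@bounded_rv_le id).
Qed.

Lemma empirical_ge0 x n t : 0 <= empirical x n t.
Proof. by rewrite divr_ge0// sumr_ge0. Qed.

Lemma empirical_le1 x n t : empirical x n t <= 1.
Proof.
case: n => [|n]; first by rewrite /empirical big_ord0 mul0r.
rewrite ler_pdivrMr// mul1r -[n.+1 in leRHS]card_ord -sum1_card natr_sum.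
by apply: ler_sum => i _; rewrite ler_nat; case: (_ <= _).
Qed.

(** The weights are increments of [Th]; those of index at most [N] telescope up to
    [maxn k (minn l N)], which is the clipping of N / n. *)
Let sum_weights n k l N : (0 < n)%N -> (k <= l)%N -> (l <= n)%N -> (N <= n)%N ->
  \sum_(k.+1 <= i < l.+1) (Th (i%:R / n%:R) - Th (i.-1%:R / n%:R)) * (i <= N)%N%:R =
  clipped_antideriv j (k%:R / n%:R) (l%:R / n%:R) (N%:R / n%:R).
Proof.
move=> n0 kl ln Nn.
have n0' : 0 < n%:R :> R by rewrite ltr0n.
have -> : clipped_antideriv j (k%:R / n%:R) (l%:R / n%:R) (N%:R / n%:R) =
    Th ((maxn k (minn l N))%:R / n%:R) - Th (k%:R / n%:R).
  rewrite /clipped_antideriv; congr (antideriv j _ - _).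
  have h a b : (a%:R / n%:R <= b%:R / n%:R :> R) = (a <= b)%N.
    by rewrite ler_pM2r ?invr_gt0// ler_nat.
  rewrite /maxn /minn; case: (ltnP l N) => lN.
    rewrite (min_idPl _) ?h ?(ltnW lN)//; case: (ltnP k l) => kl'.
      by rewrite (max_idPr _)// h ltnW.
    by rewrite (max_idPl _)// h.
  rewrite (min_idPr _) ?h//; case: (ltnP k N) => kN.
    by rewrite (max_idPr _)// h ltnW.
  by rewrite (max_idPl _)// h.
elim: l kl {ln} => [|l ih].
  by rewrite leqn0 => /eqP ->; rewrite big_geq// min0n max0n subrr.
rewrite leq_eqVlt => /predU1P[->|].
  by rewrite big_geq// (maxn_idPl (geq_minl _ _)) subrr.
move=> kl; rewrite big_nat_recr// ih// [l.+1.-1]/=.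
case: (leqP l.+1 N) => lN.
  rewrite [LHS]/= mulr1 (minn_idPl (ltnW lN)).
  have kl' : (k <= l)%N by [].
  by rewrite (maxn_idPr (ltnW kl)) (maxn_idPr kl'); ring.
by rewrite [LHS]/= mulr0 addr0 (minn_idPr _).
Qed.

Let sum_weights_total n k l : (0 < n)%N -> (k <= l)%N -> (l <= n)%N ->
  \sum_(k.+1 <= i < l.+1) (Th (i%:R / n%:R) - Th (i.-1%:R / n%:R)) =
  Th (l%:R / n%:R) - Th (k%:R / n%:R).
Proof.
move=> n0 kl ln; rewrite -(telescope_sumr (fun i => Th (i%:R / n%:R)) kl).
by rewrite big_add1.
Qed.

Lemma bounded_rv_itv_sum (I : Type) (s : seq I) (f : I -> R -> R) :
  (forall i, bounded_rv (f i)) -> bounded_rv (fun t => \sum_(i <- s) f i t).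
Proof.
move=> bf; elim: s => [|i s ih].
  by under eq_fun do rewrite big_nil; exact: bounded_rv_cst.
by under eq_fun do rewrite big_cons; exact: bounded_rvD.
Qed.

Lemma Rintegral_itv_sum (I : Type) (s : seq I) (f : I -> R -> R) (a b : R) :
  (forall i, bounded_rv (f i)) ->
  \int[mu]_(t in `[a, b]) \sum_(i <- s) f i t = \sum_(i <- s) \int[mu]_(t in `[a, b]) f i t.
Proof.
move=> bf; elim: s => [|i s ih].
  rewrite big_nil; under eq_Rintegral do rewrite big_nil.
  by rewrite Rintegral_cst// mul0r.
rewrite big_cons -ih; under eq_Rintegral do rewrite big_cons.
rewrite RintegralD//; apply: bounded_itv_integrable => //.
exact: bounded_rv_itv_sum.
Qed.

(** Summation by parts: apply [layer_cake] to each order statistic and exchange sum and integral. At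
    fixed [t] the indicators select the indices up to the number of observations at most [t], so the
    weights telescope. *)
Lemma L_representation (x : nat -> R) n k l (lo hi : R) : (0 < n)%N ->
  (k <= l)%N -> (l <= n)%N ->
  (forall i, (k < i <= l)%N -> lo <= order_stat x n i <= hi) ->
  \sum_(k.+1 <= i < l.+1) (Th (i%:R / n%:R) - Th (i.-1%:R / n%:R)) * order_stat x n i =
  hi * (Th (l%:R / n%:R) - Th (k%:R / n%:R)) -
  \int[mu]_(t in `[lo, hi]) clipped_antideriv j (k%:R / n%:R) (l%:R / n%:R) (empirical x n t).
Proof.
move=> n0 kl ln xlohi.
pose w i := Th (i%:R / n%:R) - Th (i.-1%:R / n%:R).
pose N t := (\sum_(i < n) (x i <= t)%R)%N.
have Nn t : (N t <= n)%N.
  by rewrite /N -[leqRHS]card_ord -sum1_card leq_sum// => i _; case: (_ <= _).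
have blei i : bounded_rv (fun t => w i * (order_stat x n i <= t)%R%:R).
  apply: bounded_rvM; first exact: bounded_rv_cst.
  exact: (@bounded_rv_le id).
have -> : \int[mu]_(t in `[lo, hi]) clipped_antideriv j (k%:R / n%:R) (l%:R / n%:R) (empirical x n t)
    = \int[mu]_(t in `[lo, hi]) \sum_(i <- index_iota k.+1 l.+1 | true) w i * (order_stat x n i <= t)%R%:R.
  apply: eq_Rintegral => t _.
  have -> : empirical x n t = (N t)%:R / n%:R by rewrite /empirical /N natr_sum.
  rewrite -sum_weights//; apply: eq_big_nat => i /andP[ki il].
  by rewrite order_stat_le// (leq_trans _ ki)//= (leq_trans _ ln).
rewrite (Rintegral_itv_sum _ _ _ blei) -sum_weights_total// mulr_sumr -sumrB.
apply: eq_big_nat => i /andP[ki il].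
have /andP[lox xhi] := xlohi i (introT andP (conj ki il)).
rewrite RintegralZl//; last exact/bounded_itv_integrable/(@bounded_rv_le id).
by rewrite layer_cake// /w; ring.
Qed.

End trimmed_sums.

(** * Influence function and linearization error *)

Section linearization.
Context d (T : measurableType d) (R : realType) (P : probability T R).
Variable X : {RV P >-> R}.
Notation mu := (@lebesgue_measure R).
Variables (j : R -> R) (CJ M : R).
Hypothesis jlip : forall u v, `|j u - j v| <= CJ * `|u - v|.
Hypothesis jM : forall u, `|j u| <= M.

Let F := rcdf X.
Let Q := rquantile X.
Let Th := antideriv j.

Let mF : measurable_fun setT F. Proof. exact: measurable_rcdf. Qed.

Let CJ0 : 0 <= CJ.
Proof.
have := jlip 1 0; rewrite subr0 normr1 mulr1; exact: le_trans.
Qed.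

Let M0 : 0 <= M. Proof. exact: le_trans (jM 0). Qed.

Let bj : bounded_rv j.
Proof.
split; last by exists M.
by apply: continuous_measurable_fun; exact: lipschitz_continuous jlip.
Qed.

Let itv_fin (a b : R) : (mu `[a, b]%classic < +oo)%E.
Proof.
by rewrite lebesgue_measure_itv/= lte_fin; case: ifP => _; rewrite -?EFinB ltry.
Qed.

Let bounded_comp (f g : R -> R) : bounded_rv f -> measurable_fun setT g -> bounded_rv (f \o g).
Proof. by move=> [mf [K fK]] mg; split; [exact: measurableT_comp|exists K => t; exact: fK]. Qed.

Let bclip (an bn : R) (g : R -> R) : 0 <= an -> an <= bn -> bn <= 1 -> measurable_fun setT g ->
  bounded_rv (fun t => clipped_antideriv j an bn (g t)).
Proof.
move=> an0 anbn bn1 mg; apply: (@bounded_comp (clipped_antideriv j an bn)) => //.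
split; first exact: (measurable_clipped_antideriv jlip jM).
by exists M => v; exact: (clipped_antideriv_bounded jlip jM).
Qed.

(** Continuous counterpart of [L_representation], by [layer_cake] for [Q u] and Fubini. The term in
    [hi] is the same, so it cancels in the difference. *)
Lemma quantile_integral_representation (an bn lo hi : R) : 0 < an -> an <= bn -> bn < 1 ->
  lo <= Q an -> Q bn <= hi ->
  \int[mu]_(u in `[an, bn]) (j u * Q u) =
  hi * (Th bn - Th an) - \int[mu]_(t in `[lo, hi]) clipped_antideriv j an bn (F t).
Proof.
move=> an0 anbn bn1 loQ Qhi.
pose f (z : R * R) : R := j z.1 * (z.1 <= F z.2)%R%:R.
have mf : measurable_fun setT f.
  apply: measurable_funM; first by apply: measurableT_comp => //; case: bj.
  have -> : (fun z : R * R => (z.1 <= F z.2)%R%:R : R) =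
      \1_(`[0, +oo[%classic : set R) \o (fun z : R * R => F z.2 - z.1).
    by apply/funext => z /=; rewrite indicE mem_setE in_itv/= andbT subr_ge0.
  apply: measurableT_comp; first exact: measurable_indic.
  by apply: measurable_funB => //; exact: measurableT_comp.
have fM z : `|f z| <= M.
  rewrite /f normrM -[leRHS]mulr1 ler_pM//.
  by case: (z.1 <= F z.2); rewrite ?normr1 ?normr0.
have QE u : an <= u -> u <= bn ->
    Q u = hi - \int[mu]_(t in `[lo, hi]) (u <= F t)%R%:R.
  move=> au ub; have u0 : 0 < u by exact: lt_le_trans au.
  have u1 : u < 1 by exact: le_lt_trans ub _.
  have loQu : lo <= Q u by rewrite (le_trans loQ)// rquantile_nd.
  have Quhi : Q u <= hi by rewrite (le_trans _ Qhi)// rquantile_nd.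
  rewrite -[LHS](subKr hi) -(layer_cake loQu Quhi); congr (_ - _).
  by apply: eq_Rintegral => t _; rewrite rquantile_le.
have -> : \int[mu]_(u in `[an, bn]) (j u * Q u) =
    \int[mu]_(u in `[an, bn]) (hi * j u - \int[mu]_(t in `[lo, hi]) f (u, t)).
  apply: eq_Rintegral => u; rewrite mem_setE in_itv/= => /andP[au ub].
  rewrite QE// mulrBr mulrC -RintegralZl//.
  by apply: bounded_itv_integrable; exact: bounded_rv_le.
rewrite RintegralB//.
- rewrite RintegralZl//; last exact: bounded_itv_integrable.
  rewrite (antiderivB jlip jM)//; last by lra.
  congr (_ - _).
  have -> : \int[mu]_(u in `[an, bn]) \int[mu]_(t in `[lo, hi]) f (u, t) =
            \int[mu]_(t in `[lo, hi]) \int[mu]_(u in `[an, bn]) f (u, t).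
    have h := @Rintegral_fubini _ _ (measurableTypeR R) (measurableTypeR R) R mu mu
      `[an, bn]%classic `[lo, hi]%classic (measurable_itv _) (measurable_itv _)
      (itv_fin _ _) (itv_fin _ _) f M mf fM.
    exact: h.
  apply: eq_Rintegral => t _.
  by rewrite -(integral_indic_antideriv jlip jM (ltW an0) anbn).
- by apply: bounded_itv_integrable; apply: bounded_rvM => //; exact: bounded_rv_cst.
- apply: (bounded_on_integrable (C := M * fine (mu `[lo, hi]%classic))) => //.
    exact: itv_fin.
    have h := @measurable_Rintegral_section _ _ (measurableTypeR R) (measurableTypeR R)
      R mu `[lo, hi]%classic (measurable_itv _) (itv_fin _ _) f M mf fM.
    exact: h.
  move=> u; apply: le_trans (le_normr_Rintegral _ _) _ => //.
    by apply: (bounded_on_integrable (C := M)) => //; [exact: itv_fin|exact: measurableT_comp].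
  rewrite -Rintegral_cst//; apply: le_Rintegral => //.
  + apply: (bounded_on_integrable (C := M)) => //; first exact: itv_fin.
      by apply: measurableT_comp => //; exact: measurableT_comp.
    by move=> t; rewrite normr_id.
  + apply: (bounded_on_integrable (C := M)) => //; first exact: itv_fin.
    by move=> t; rewrite ger0_norm.
Qed.

Variables (al be lo hi : R).

Let g t : R := j (F t) * (al <= F t < be)%R%:R.

(* The derivative of the trimmed L-functional at the distribution function [F], in
   the direction of the point mass at [x]. *)
Definition influence (x : R) : R :=
  - \int[mu]_(t in `[lo, hi]) (j (F t) * (al <= F t < be)%R%:R * ((x <= t)%R%:R - F t)).

Let bF : bounded_rv F.
Proof.
by split => //; exists 1 => t; rewrite ger0_norm ?rcdf_ge0 ?rcdf_le1.
Qed.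

Let bco (a b : R) : bounded_rv (fun t => (a <= F t < b)%R%:R : R).
Proof.
have -> : (fun t => (a <= F t < b)%R%:R) = \1_(`[a, b[%classic : set R) \o F :> (R -> R).
  by apply/funext => t /=; rewrite indicE mem_setE in_itv/=.
by apply: bounded_comp => //; exact: bounded_rv_indic.
Qed.

Let bg : bounded_rv g.
Proof. by apply: bounded_rvM => //; exact: (@bounded_comp j). Qed.

Lemma sum_influence (x : nat -> R) n : (0 < n)%N ->
  (\sum_(i < n) influence (x i)) / n%:R =
  - \int[mu]_(t in `[lo, hi]) (g t * (empirical x n t - F t)).
Proof.
move=> n0; have n0' : n%:R != 0 :> R by rewrite pnatr_eq0 -lt0n.
rewrite /influence sumrN mulNr; congr (- _).
have bi i : bounded_rv (fun t => g t * ((x i <= t)%R%:R - F t)).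
  apply: bounded_rvM => //; apply: bounded_rvB => //.
  exact: (@bounded_rv_le _ id).
rewrite -(@Rintegral_itv_sum R 'I_n (index_enum _) (fun i t => g t * ((x i <= t)%R%:R - F t)))//.
rewrite -RintegralZr//; last exact/bounded_itv_integrable/bounded_rv_itv_sum.
apply: eq_Rintegral => t _; rewrite -mulr_sumr sumrB sumr_const card_ord -[F t *+ n]mulr_natr.
by rewrite -mulrA mulrBl mulfK.
Qed.

(** The level set is the interval from [Q a] to [Q b], by the Galois connection. Through this bound
    the Lipschitz property of the quantile function near the trimming points enters. *)
Lemma level_set_measure (a b : R) : 0 < a -> a <= b -> b < 1 ->
  \int[mu]_(t in `[lo, hi]) ((a <= F t < b)%R%:R) <= Q b - Q a.
Proof.
move=> a0 ab b1.
have -> : (fun t => (a <= F t < b)%R%:R : R) = \1_(`[Q a, Q b[%classic).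
  apply/funext => t; rewrite indicE mem_setE in_itv/=.
  by rewrite rquantile_le ?(le_lt_trans ab)// rquantile_gt// (lt_le_trans a0).
have Qab : Q a <= Q b by exact: rquantile_nd.
rewrite /Rintegral integral_indic//= -[leRHS]/(fine (Q b - Q a)%:E).
have QE : mu `[Q a, Q b[%classic = (Q b - Q a)%:E.
  rewrite lebesgue_measure_itv/= lte_fin; move: Qab; rewrite le_eqVlt.
  by move=> /predU1P[->|->]; rewrite ?ltxx ?subrr// EFinB.
have le1 : (mu (`[Q a, Q b[%classic `&` `[lo, hi]%classic) <= (Q b - Q a)%:E)%E.
  rewrite -QE; apply: le_measure; rewrite ?inE//.
  exact: measurableI.
rewrite fine_le// ge0_fin_numE//; exact: le_lt_trans le1 (ltry _).
Qed.

(** [clipped_antideriv_linear] is applied pointwise in [t], at the values of the distribution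
    function and of the empirical one; the two windows integrate to quantile increments. *)
Lemma linearization_error (x : nat -> R) n k l (lam rho : R) :
  (0 < n)%N -> (0 < k)%N -> (k <= l)%N -> (l < n)%N ->
  lo <= hi ->
  (forall i, (k < i <= l)%N -> lo <= order_stat x n i <= hi) ->
  lo <= Q (k%:R / n%:R) -> Q (l%:R / n%:R) <= hi ->
  `|k%:R / n%:R - al| <= rho -> `|l%:R / n%:R - be| <= rho ->
  (forall t, `|empirical x n t - F t| <= lam) ->
  0 < al - (rho + lam) -> al + (rho + lam) < 1 ->
  0 < be - (rho + lam) -> be + (rho + lam) < 1 ->
  `|\sum_(k.+1 <= i < l.+1) (Th (i%:R / n%:R) - Th (i.-1%:R / n%:R)) * order_stat x n i
    - \int[mu]_(u in `[k%:R / n%:R, l%:R / n%:R]) (j u * Q u)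
    - (\sum_(i < n) influence (x i)) / n%:R| <=
  CJ * lam ^+ 2 * (hi - lo) + 2 * M * lam *
   ((Q (al + (rho + lam)) - Q (al - (rho + lam))) + (Q (be + (rho + lam)) - Q (be - (rho + lam)))).
Proof.
move=> n0 k0 kl ln lohi xlohi loQ Qhi kal lbe dev a0 a1 b0 b1.
have n0' : 0 < n%:R :> R by rewrite ltr0n.
set an := k%:R / n%:R; set bn := l%:R / n%:R.
have an0 : 0 < an by rewrite divr_gt0// ltr0n.
have anbn : an <= bn by rewrite ler_pM2r ?invr_gt0// ler_nat.
have bn1 : bn < 1 by rewrite ltr_pdivrMr// mul1r ltr_nat.
have lam0 : 0 <= lam by exact: le_trans (dev 0).
have rho0 : 0 <= rho by exact: le_trans kal.
rewrite (L_representation j n0 kl (ltnW ln) xlohi) -/an -/bn.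
rewrite (quantile_integral_representation an0 anbn bn1 loQ Qhi).
rewrite sum_influence//.
have bE := bounded_rv_empirical x n; have [mE _] := bE.
pose e t := clipped_antideriv j an bn (empirical x n t).
pose f t := clipped_antideriv j an bn (F t).
pose h t := g t * (empirical x n t - F t).
have be_ : bounded_rv e by apply: bclip => //; exact: ltW.
have bf : bounded_rv f by apply: bclip => //; exact: ltW.
have bh : bounded_rv h by apply: bounded_rvM => //; exact: bounded_rvB.
have bI u : bounded_rv u -> mu.-integrable `[lo, hi] (EFin \o u) by exact: bounded_itv_integrable.
have bef := bounded_rvB be_ bf.
have -> : hi * (Th bn - Th an) - (\int[mu]_(t in `[lo, hi]) e t)
    - (hi * (Th bn - Th an) - (\int[mu]_(t in `[lo, hi]) f t))
    - (- (\int[mu]_(t in `[lo, hi]) h t)) =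
    - (\int[mu]_(t in `[lo, hi]) (e t - f t - h t)).
  have -> : \int[mu]_(t in `[lo, hi]) (e t - f t - h t) =
      \int[mu]_(t in `[lo, hi]) (e t - f t) - \int[mu]_(t in `[lo, hi]) h t.
    by apply: RintegralB => //; exact: bI.
  have -> : \int[mu]_(t in `[lo, hi]) (e t - f t) =
      \int[mu]_(t in `[lo, hi]) e t - \int[mu]_(t in `[lo, hi]) f t.
    by apply: RintegralB => //; exact: bI.
  move: (hi * _) (\int[mu]_(t in `[lo, hi]) e t) (\int[mu]_(t in `[lo, hi]) f t)
    (\int[mu]_(t in `[lo, hi]) h t) => a b c e'.
  by ring.
rewrite normrN; apply: le_trans (le_normr_Rintegral _ _) _ => //.
  by apply: bI; exact: bounded_rvB.
pose c1 t : R := (al - (rho + lam) <= F t < al + (rho + lam))%R%:R.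
pose c2 t : R := (be - (rho + lam) <= F t < be + (rho + lam))%R%:R.
have bc1 : bounded_rv c1 by exact: bco.
have bc2 : bounded_rv c2 by exact: bco.
have bc12 : bounded_rv (fun t => c1 t + c2 t) by exact: bounded_rvD.
have cst := @bounded_rv_cst _ R R.
have bc12' : bounded_rv (fun t => 2 * M * lam * (c1 t + c2 t)) by exact: bounded_rvM.
apply: (@le_trans _ _ (\int[mu]_(t in `[lo, hi]) (CJ * lam ^+ 2 + 2 * M * lam * (c1 t + c2 t)))).
  apply: le_Rintegral => //.
  - by apply: bI; apply: bounded_rv_norm; exact: bounded_rvB.
  - by apply: bI; exact: bounded_rvD (cst _) bc12'.
  move=> t _; apply: (clipped_antideriv_linear jlip jM (ltW an0) anbn (ltW bn1) kal lbe lam0) => //;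
    [exact: rcdf_ge0|exact: rcdf_le1|exact: empirical_ge0|exact: empirical_le1].
have muE : fine (mu `[lo, hi]%classic) = hi - lo.
  rewrite lebesgue_measure_itv/= lte_fin; move: lohi; rewrite le_eqVlt.
  by move=> /predU1P[->|->]; rewrite ?ltxx ?subrr.
have -> : \int[mu]_(t in `[lo, hi]) (CJ * lam ^+ 2 + 2 * M * lam * (c1 t + c2 t)) =
    CJ * lam ^+ 2 * (hi - lo) + \int[mu]_(t in `[lo, hi]) (2 * M * lam * (c1 t + c2 t)).
  rewrite -muE -Rintegral_cst//.
  by apply: (@RintegralD _ _ _ _ _ (fun=> CJ * lam ^+ 2)) => //; apply: bI => //; exact: cst.
have -> : \int[mu]_(t in `[lo, hi]) (2 * M * lam * (c1 t + c2 t)) =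
    2 * M * lam * \int[mu]_(t in `[lo, hi]) (c1 t + c2 t).
  by apply: RintegralZl => //; exact: bI.
have -> : \int[mu]_(t in `[lo, hi]) (c1 t + c2 t) =
    (\int[mu]_(t in `[lo, hi]) c1 t) + \int[mu]_(t in `[lo, hi]) c2 t.
  by apply: RintegralD => //; exact: bI.
rewrite lerD2l ler_wpM2l ?mulr_ge0//.
apply: lerD; apply: level_set_measure => //; lra.
Qed.

End linearization.

(** * Moments of the influence function *)

Section quantile_measure_integral.
Context d (T : measurableType d) (R : realType) (P : probability T R).
Variable X : {RV P >-> R}.
Notation mu := (@lebesgue_measure R).
Variables (al be : R).
Hypotheses (al0 : 0 < al) (albe : al <= be) (be1 : be < 1).

Let F : measurableTypeR R -> measurableTypeR R := rcdf X.
Let Q := rquantile X.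

Let mF : measurable_fun setT F. Proof. exact: measurable_rcdf. Qed.

Let level_setE a b : al <= a -> a <= b -> b <= be ->
  [set t | a <= F t < b] = `[Q a, Q b[%classic.
Proof.
move=> ala ab bbe; have a0 := al0; have b1 := be1.
by apply/seteqP; split=> t /=; rewrite in_itv/= rquantile_le ?rquantile_gt//; lra.
Qed.

Let nu0 := mrestr mu (measurable_itv `[Q al, Q be[).

(* On [[al, be)] the measure dF^{-1} is the image of the Lebesgue measure by [F]. *)
Let nu' := pushforward (pushforward nu0 F) (-%R : measurableTypeR R -> measurableTypeR R).

Let Q_nd a b : al <= a -> a <= b -> b <= be -> Q a <= Q b.
Proof. by move=> ala ab bbe; apply: rquantile_nd => //; [exact: lt_le_trans ala|exact: le_lt_trans be1]. Qed.

Let lebesgue_co (a b : R) : a <= b -> mu `[a, b[%classic = (b - a)%:E.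
Proof.
move=> ab; rewrite lebesgue_measure_itv/= lte_fin; move: ab; rewrite le_eqVlt.
by move=> /predU1P[->|->]; rewrite ?ltxx ?subrr// EFinB.
Qed.

(** It suffices to compare on intervals ]s, t]. Reflection turns them into [- t, - s[, and the
    truncation inside [quantile_reflection] matches the restriction of Lebesgue measure to [[Q al, Q
    be[]. *)
Let stieltjesE A : measurable A ->
  lebesgue_stieltjes_measure (quantile_reflection X al be) A = nu' A.
Proof.
apply: lebesgue_stieltjes_measure_unique => _ [[s t] /= _ <-].
have [st|ts] := leP s t; last first.
  by rewrite set_itv_ge ?bnd_simp -?leNgt ?(ltW ts)// !measure0.
rewrite /lebesgue_stieltjes_measure /measure_extension/=.
rewrite measurable_mu_extE/=; last exact: is_ocitv.
rewrite wlength_itv_bnd// /quantile_reflection al0 albe be1/=.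
set a := Num.max al (Num.min be (- t)); set b := Num.max al (Num.min be (- s)).
have ala : al <= a by rewrite le_max lexx.
have bbe : b <= be by rewrite ge_max albe ge_min lexx.
have ab : a <= b.
  rewrite /a /b ge_max le_max lexx/= le_max; apply/orP; right.
  by rewrite le_min !ge_min lexx/= lerN2 st orbT.
rewrite /nu' /nu0 /pushforward /mrestr.
rewrite (_ : _ `&` _ = `[Q a, Q b[%classic); last first.
  rewrite -(level_setE ala ab bbe) -(level_setE (lexx al) albe (lexx be)).
  apply/seteqP; split=> x /=; rewrite in_itv/=.
    move=> [/andP[xs tx] /andP[alx xbe]].
    have tx' : - t <= F x by rewrite lerNl.
    have xs' : F x < - s by rewrite ltrNr.
    by rewrite ge_max alx ge_min tx' orbT/= lt_max lt_min xbe xs' orbT.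
  rewrite ge_max lt_max lt_min ge_min => /andP[/andP[alx h1] h2].
  move: h2; rewrite ltNge alx/= => /andP[xbe xs].
  move: h1; rewrite leNgt xbe/= => tx.
  by split; rewrite ?alx ?xbe// ltrNr xs lerNl tx.
rewrite lebesgue_co ?Q_nd// -?EFinN -?EFinD.
by congr (_%:E); rewrite opprK addrC.
Qed.

Let quantile_measureE A : measurable A -> A `<=` `[al, be[ ->
  quantile_measure X al be A = pushforward mu F A.
Proof.
move=> mA Aco; rewrite /quantile_measure {1}/pushforward stieltjesE; last first.
  by rewrite -[X in measurable X]setTI; exact: (@oppr_measurable R).
rewrite /nu' /nu0 /pushforward /mrestr; congr (mu _).
rewrite -(level_setE (lexx _) albe (lexx _)).
apply/seteqP; split=> x /=; rewrite opprK; first by case.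
by move=> Ax; split => //; have := Aco _ Ax; rewrite /= in_itv.
Qed.

Lemma Rintegral_quantile_measure (f : R -> R) : bounded_rv f ->
  \int[quantile_measure X al be]_(u in `[al, be[) f u =
  \int[mu]_(t in `[Q al, Q be[) f (F t).
Proof.
move=> bf; have [mf [K fK]] := bf; rewrite /Rintegral; apply: (congr1 fine).
transitivity (\int[pushforward mu F]_(u in `[al, be[) (f u)%:E)%E.
  by apply: eq_measure_integral => A mA Aco; exact: quantile_measureE.
have fin : (mu `[Q al, Q be[%classic < +oo)%E by rewrite lebesgue_co ?Q_nd// ltry.
rewrite integral_pushforward//=.
- rewrite -(level_setE (lexx _) albe (lexx _)).
  by congr (integral _ _ _); apply/seteqP; split=> x /=; rewrite in_itv.
- exact/measurable_EFinP.
- have -> : F @^-1` `[al, be[ = `[Q al, Q be[%classic.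
    rewrite -(level_setE (lexx _) albe (lexx _)).
    by apply/seteqP; split=> x /=; rewrite in_itv.
  apply: (bounded_on_integrable (C := K)) => //.
  exact: measurableT_comp.
Qed.

End quantile_measure_integral.

(** * Mean and variance of the influence function *)

Section influence_moments.
Context d (T : measurableType d) (R : realType) (P : probability T R).
Variable X : {RV P >-> R}.
Notation mu := (@lebesgue_measure R).
Variables (j : R -> R) (CJ M : R).
Hypothesis jlip : forall u v, `|j u - j v| <= CJ * `|u - v|.
Hypothesis jM : forall u, `|j u| <= M.
Variables (al be lo hi : R).
Hypothesis lohi : lo <= hi.

Let F := rcdf X.
Let Q := rquantile X.
Let Y := influence X j al be lo hi.
Let g t : R := j (F t) * (al <= F t < be)%R%:R.
Let ker x t : R := g t * ((x <= t)%R%:R - F t).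

Let M0 : 0 <= M. Proof. exact: le_trans (jM 0). Qed.

Let mF : measurable_fun setT F. Proof. exact: measurable_rcdf. Qed.

Let mg : measurable_fun setT g.
Proof.
apply: measurable_funM.
  apply: measurableT_comp mF; apply: continuous_measurable_fun.
  exact: lipschitz_continuous jlip.
have -> : (fun t => (al <= F t < be)%R%:R) = \1_(`[al, be[%classic : set R) \o F :> (R -> R).
  by apply/funext => t /=; rewrite indicE mem_setE in_itv/=.
by apply: measurableT_comp => //; exact: measurable_indic.
Qed.

Let gM t : `|g t| <= M.
Proof.
rewrite normrM -[leRHS]mulr1 ler_pM//.
by case: (al <= F t < be); rewrite ?normr1 ?normr0.
Qed.

Let mker : measurable_fun setT (fun z : R * R => ker z.1 z.2).
Proof.
apply: measurable_funM; first exact: measurableT_comp.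
apply: measurable_funB; last exact: measurableT_comp.
have -> : (fun z : R * R => (z.1 <= z.2)%R%:R : R) =
    \1_(`[0, +oo[%classic : set R) \o (fun z : R * R => z.2 - z.1).
  by apply/funext => z /=; rewrite indicE mem_setE in_itv/= andbT subr_ge0.
apply: measurableT_comp; first exact: measurable_indic.
exact: measurable_funB.
Qed.

Let dev_le1 (x t : R) : `|(x <= t)%R%:R - F t| <= 1.
Proof.
have := rcdf_ge0 X t; have := rcdf_le1 X t; rewrite -/(F t) ler_norml.
by case: (x <= t) => /=; lra.
Qed.

Let kerM x t : `|ker x t| <= M.
Proof. by rewrite /ker normrM -[leRHS]mulr1 ler_pM. Qed.

Let itv_fin : (mu `[lo, hi]%classic < +oo)%E.
Proof.
by rewrite lebesgue_measure_itv/= lte_fin; case: ifP => _; rewrite -?EFinB ltry.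
Qed.

Let mu_lohi : fine (mu `[lo, hi]%classic) = hi - lo.
Proof.
rewrite lebesgue_measure_itv/= lte_fin; move: lohi; rewrite le_eqVlt.
by move=> /predU1P[->|->]; rewrite ?ltxx ?subrr.
Qed.

Lemma measurable_influence : measurable_fun setT Y.
Proof.
apply: measurableT_comp => //.
exact: (@measurable_Rintegral_section _ _ (measurableTypeR R) (measurableTypeR R) R mu
  `[lo, hi]%classic (measurable_itv _) itv_fin (fun z => ker z.1 z.2) M mker (fun z => kerM _ _)).
Qed.

Lemma influence_le x : `|Y x| <= M * (hi - lo).
Proof.
have mk : measurable_fun setT (ker x).
  exact: (measurableT_comp mker (pair1_measurable x)).
have ik : mu.-integrable `[lo, hi] (EFin \o ker x).
  by apply: (bounded_on_integrable (C := M)).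
rewrite /Y /influence normrN; apply: le_trans (le_normr_Rintegral _ ik) _ => //.
rewrite -mu_lohi -Rintegral_cst//; apply: le_Rintegral => //.
- apply: (bounded_on_integrable (C := M)) => //; first exact: measurableT_comp.
  by move=> t; rewrite normr_id.
- by apply: (bounded_on_integrable (C := M)) => // t; rewrite ger0_norm.
Qed.

Let bY : bounded_rv (fun w => Y (X w)).
Proof.
split; first exact: (measurableT_comp measurable_influence).
by exists (M * (hi - lo)) => w; exact: influence_le.
Qed.

Let P_fin : (P setT < +oo)%E.
Proof. by rewrite (le_lt_trans (probability_le1 P measurableT))// ltry. Qed.

Let bind t : bounded_rv (fun w => (X w <= t)%R%:R : R).
Proof.
split; last by exists 1 => w; case: (X w <= t); rewrite ?normr1 ?normr0.
have -> : (fun w => (X w <= t)%R%:R : R) = \1_(`]-oo, t]%classic : set R) \o X.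
  by apply/funext => w /=; rewrite indicE mem_setE in_itv.
by apply: measurableT_comp => //; exact: measurable_indic.
Qed.

Let mean_ind t : \int[P]_w ((X w <= t)%R%:R) = F t.
Proof.
have mX : measurable (X @^-1` `]-oo, t]) by rewrite -[X in measurable X]setTI; exact: measurable_funP.
rewrite /F /rcdf /cdf /distribution /pushforward -(mean_indic P mX).
apply: eq_Rintegral => w _; rewrite indicE.
have -> // : (X w <= t) = (w \in X @^-1` `]-oo, t]).
by apply/idP/idP; rewrite inE /= in_itv.
Qed.

(** Fubini, stated for a general factor so that three choices suffice: [V = 1] gives the mean,
    [V = - Y] starts the second moment, and [V] a centred indicator evaluates its inner
    expectation. *)
Let mean_mul_influence (V : T -> R) : bounded_rv V ->
  \int[P]_w (V w * Y (X w)) =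
  - \int[mu]_(t in `[lo, hi]) (g t * \int[P]_w (V w * ((X w <= t)%R%:R - F t))).
Proof.
move=> bV; have [mV [K VK]] := bV.
have K0 : 0 <= K by exact: le_trans (VK point).
pose f (z : T * R) := V z.1 * ker (X z.1) z.2.
have mf : measurable_fun setT f.
  apply: measurable_funM; first exact: measurableT_comp.
  have -> : (fun z : T * R => ker (X z.1) z.2) =
    (fun z : R * R => ker z.1 z.2) \o (fun z => (X z.1, z.2)) by [].
  apply: measurableT_comp => //; apply/measurable_fun_pair => //=.
  exact: measurableT_comp.
have fK z : `|f z| <= K * M by rewrite normrM ler_pM.
have fub := @Rintegral_fubini _ _ T (measurableTypeR R) R P mu setT `[lo, hi]%classic
  measurableT (measurable_itv _) P_fin itv_fin f (K * M) mf fK.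
have -> : \int[P]_w (V w * Y (X w)) = - \int[P]_w \int[mu]_(t in `[lo, hi]) f (w, t).
  have bI : bounded_rv (fun w => \int[mu]_(t in `[lo, hi]) f (w, t)).
    have -> : (fun w => \int[mu]_(t in `[lo, hi]) f (w, t)) = fun w => - (V w * Y (X w)).
      apply/funext => w; rewrite /Y /influence mulrN opprK -RintegralZl//.
      apply: (bounded_on_integrable (C := M)) => //; last by move=> t; exact: kerM.
      exact: (measurableT_comp mker (pair1_measurable (X w))).
    by apply: bounded_rvN; exact: bounded_rvM.
  have -> : - (\int[P]_w \int[mu]_(t in `[lo, hi]) f (w, t)) =
      \int[P]_w (- 1 * \int[mu]_(t in `[lo, hi]) f (w, t)) by rewrite meanZ// mulN1r.
  apply: eq_Rintegral => w _; rewrite /Y /influence mulrN mulN1r -RintegralZl//.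
  apply: (bounded_on_integrable (C := M)) => //; last by move=> t; exact: kerM.
  exact: (measurableT_comp mker (pair1_measurable (X w))).
rewrite fub; congr (- _); apply: eq_Rintegral => t _.
rewrite -meanZ; last first.
  by apply: bounded_rvM => //; apply: bounded_rvB => //; exact: bounded_rv_cst.
by apply: eq_Rintegral => w _; rewrite /f/= /ker; ring.
Qed.

Lemma mean_influence : \int[P]_w Y (X w) = 0.
Proof.
have := mean_mul_influence (bounded_rv_cst T 1).
under eq_Rintegral do rewrite mul1r.
move=> ->; under eq_Rintegral => t _.
  rewrite (_ : \int[P]_w _ = 0) ?mulr0; last first.
    under eq_Rintegral do rewrite mul1r.
    by rewrite meanB// ?mean_cst ?mean_ind ?subrr//; exact: bounded_rv_cst.
  over.
by rewrite Rintegral_cst// mul0r oppr0.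
Qed.

(** The Brownian bridge covariance at [F s] and [F t]: the product of the two indicators is the
    indicator at [Num.min s t]. *)
Let cov_ind s t : \int[P]_w (((X w <= t)%R%:R - F t) * ((X w <= s)%R%:R - F s)) =
  Num.min (F s) (F t) - F s * F t.
Proof.
have c := @bounded_rv_cst _ T R.
have bt := bind t; have bs := bind s; have bm := bind (Num.min s t).
have bts : bounded_rv (fun w => F s * (X w <= t)%R%:R + F t * (X w <= s)%R%:R).
  by apply: bounded_rvD; exact: bounded_rvM.
have -> : \int[P]_w (((X w <= t)%R%:R - F t) * ((X w <= s)%R%:R - F s)) =
  \int[P]_w ((X w <= Num.min s t)%R%:R - (F s * (X w <= t)%R%:R + F t * (X w <= s)%R%:R) + F s * F t).
  apply: eq_Rintegral => w _; rewrite le_min.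
  by case: (X w <= t); case: (X w <= s) => /=; ring.
rewrite meanD//; last exact: bounded_rvB.
rewrite meanB// meanD ?meanZ ?mean_ind ?mean_cst//; [|exact: bounded_rvM|exact: bounded_rvM].
have -> : F (Num.min s t) = Num.min (F s) (F t).
  case: (leP s t) => st; first by rewrite (min_idPl _)// rcdf_nd.
  by rewrite (min_idPr _)// rcdf_nd// ltW.
by ring.
Qed.

Lemma mean_influence_sqr : \int[P]_w (Y (X w) ^+ 2) =
  \int[mu]_(t in `[lo, hi]) (g t * \int[mu]_(s in `[lo, hi])
    (g s * (Num.min (F s) (F t) - F s * F t))).
Proof.
have c := @bounded_rv_cst _ T R.
have devY t : \int[P]_w (- Y (X w) * ((X w <= t)%R%:R - F t)) =
    \int[mu]_(s in `[lo, hi]) (g s * (Num.min (F s) (F t) - F s * F t)).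
  have bd : bounded_rv (fun w => (X w <= t)%R%:R - F t) by exact: bounded_rvB.
  have -> : \int[P]_w (- Y (X w) * ((X w <= t)%R%:R - F t)) =
      \int[P]_w (- 1 * (((X w <= t)%R%:R - F t) * Y (X w))).
    by apply: eq_Rintegral => w _; ring.
  rewrite meanZ ?mulN1r; last exact: bounded_rvM.
  rewrite mean_mul_influence// opprK.
  by apply: eq_Rintegral => s _; rewrite cov_ind.
have := mean_mul_influence (bounded_rvN bY).
have -> : \int[P]_w (- Y (X w) * Y (X w)) = - (\int[P]_w (Y (X w) ^+ 2)).
  rewrite -mulN1r -meanZ; last exact: bounded_rvX.
  by apply: eq_Rintegral => w _; ring.
move=> /oppr_inj ->; apply: eq_Rintegral => t _.
by rewrite devY.
Qed.

End influence_moments.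

(** * The scale as a standard deviation *)

Section scale_representation.
Context d (T : measurableType d) (R : realType) (P : probability T R).
Variable X : {RV P >-> R}.
Notation mu := (@lebesgue_measure R).
Variables (j : R -> R) (CJ M : R).
Hypothesis jlip : forall u v, `|j u - j v| <= CJ * `|u - v|.
Hypothesis jM : forall u, `|j u| <= M.
Variables (al be lo hi : R).
Hypotheses (al0 : 0 < al) (albe : al <= be) (be1 : be < 1).
Hypothesis loQ : lo <= rquantile X al.
Hypothesis Qhi : rquantile X be <= hi.

Let F := rcdf X.
Let Q := rquantile X.
Let g t : R := j (F t) * (al <= F t < be)%R%:R.

Let M0 : 0 <= M. Proof. exact: le_trans (jM 0). Qed.

Let Qalbe : Q al <= Q be. Proof. exact: rquantile_nd. Qed.

Let lohi : lo <= hi.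
Proof. exact: le_trans loQ (le_trans Qalbe Qhi). Qed.

Let mF : measurable_fun setT F. Proof. exact: measurable_rcdf. Qed.

Let mj : measurable_fun setT j.
Proof. by apply: continuous_measurable_fun; exact: lipschitz_continuous jlip. Qed.

Let mco : measurable_fun setT (fun u : R => (al <= u < be)%R%:R : R).
Proof.
have -> : (fun u => (al <= u < be)%R%:R) = \1_(`[al, be[%classic : set R) :> (R -> R).
  by apply/funext => t /=; rewrite indicE mem_setE in_itv/=.
exact: measurable_indic.
Qed.

Let itv_fin : (mu `[lo, hi]%classic < +oo)%E.
Proof.
by rewrite lebesgue_measure_itv/= lte_fin; case: ifP => _; rewrite -?EFinB ltry.
Qed.

Let restrict_level (f : R -> R) :
  \int[mu]_(t in `[Q al, Q be[) f t = \int[mu]_(t in `[lo, hi]) (f t * (al <= F t < be)%R%:R).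
Proof.
have -> : `[Q al, Q be[%classic = `[lo, hi] `&` `[Q al, Q be[.
  apply/esym/setIidr => t /=; rewrite !in_itv/= => /andP[h1 h2].
  by rewrite (le_trans loQ h1) (ltW (lt_le_trans h2 Qhi)).
rewrite Rintegral_mkcondr; apply: eq_Rintegral => t _.
rewrite patchE mem_setE in_itv/= rquantile_le ?rquantile_gt//.
- by rewrite -/F; case: (al <= F t < be); rewrite ?mulr1 ?mulr0.
- exact: lt_le_trans albe.
- exact: le_lt_trans be1.
Qed.

(** Keeps the covariance kernel bounded for all real arguments, as [Rintegral_quantile_measure] asks
    of its integrands. *)
Let unit_clip (v : R) := Num.max 0 (Num.min 1 v).

Let unit_clip01 v : 0 <= unit_clip v <= 1.
Proof. by rewrite le_max lexx/= ge_max ler01 ge_min lexx. Qed.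

Let unit_clip_id v : 0 <= v <= 1 -> unit_clip v = v.
Proof. by move=> /andP[v0 v1]; rewrite /unit_clip (min_idPr v1) (max_idPr v0). Qed.

Let measurable_unit_clip : measurable_fun setT unit_clip.
Proof. by apply: measurable_maxr => //; exact: measurable_minr. Qed.

Let cov (u v : R) := Num.min u v - u * v.

Let cov_le1 u v : 0 <= u <= 1 -> 0 <= v <= 1 -> `|cov u v| <= 1.
Proof.
move=> /andP[u0 u1] /andP[v0 v1]; rewrite /cov.
have uv0 : 0 <= u * v by exact: mulr_ge0.
have uvm : u * v <= Num.min u v by rewrite le_min ler_piMr// ler_piMl.
rewrite ger0_norm ?subr_ge0// lerBlDr; have : Num.min u v <= 1 by rewrite ge_min u1.
by move=> /le_trans; apply; rewrite lerDl.
Qed.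

Let F01 t : 0 <= F t <= 1. Proof. by rewrite rcdf_ge0 rcdf_le1. Qed.

Let mg : measurable_fun setT g.
Proof.
apply: measurable_funM; first exact: measurableT_comp.
exact: (measurableT_comp mco mF).
Qed.

Let gM t : `|g t| <= M.
Proof.
rewrite normrM -[leRHS]mulr1 ler_pM//.
by case: (al <= F t < be); rewrite ?normr1 ?normr0.
Qed.

Let mcov (f h : R * R -> R) : measurable_fun setT f -> measurable_fun setT h ->
  measurable_fun setT (fun z => cov (f z) (h z)).
Proof.
move=> mf mh; apply: measurable_funB; first exact: measurable_minr.
exact: measurable_funM.
Qed.

Let inner (v : R) := \int[mu]_(s in `[lo, hi]) (g s * cov (F s) (unit_clip v)).

Let minner_ker : measurable_fun setT (fun z : R * R => g z.2 * cov (F z.2) (unit_clip z.1)).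
Proof.
apply: measurable_funM; first exact: measurableT_comp.
by apply: mcov; exact: measurableT_comp.
Qed.

Let inner_ker_le (z : R * R) : `|g z.2 * cov (F z.2) (unit_clip z.1)| <= M.
Proof. by rewrite normrM -[leRHS]mulr1 ler_pM// cov_le1. Qed.

Let minner : measurable_fun setT inner.
Proof.
exact: (@measurable_Rintegral_section _ _ (measurableTypeR R) (measurableTypeR R) R mu
  `[lo, hi]%classic (measurable_itv _) itv_fin _ M minner_ker inner_ker_le).
Qed.

Let inner_le v : `|inner v| <= M * (hi - lo).
Proof.
have muE : fine (mu `[lo, hi]%classic) = hi - lo.
  rewrite lebesgue_measure_itv/= lte_fin; move: lohi; rewrite le_eqVlt.
  by move=> /predU1P[->|->]; rewrite ?ltxx ?subrr.
have mk := measurableT_comp minner_ker (pair1_measurable v).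
have ik : mu.-integrable `[lo, hi] (EFin \o (fun s => g s * cov (F s) (unit_clip v))).
  by apply: (bounded_on_integrable (C := M)) => // s; exact: (inner_ker_le (v, s)).
apply: le_trans (le_normr_Rintegral _ ik) _ => //.
rewrite -muE -Rintegral_cst//; apply: le_Rintegral => //.
- apply: (bounded_on_integrable (C := M)) => //; first exact: measurableT_comp.
  by move=> s; rewrite normr_id; exact: (inner_ker_le (v, s)).
- by apply: (bounded_on_integrable (C := M)) => // s; rewrite ger0_norm.
- by move=> s _; exact: (inner_ker_le (v, s)).
Qed.

Let co01 u : al <= u < be -> 0 <= u <= 1.
Proof.
move=> /andP[h1 h2]; rewrite (le_trans (ltW al0) h1)/=.
exact: le_trans (ltW h2) (ltW be1).
Qed.

(** The substitution u = F(t) in both Stieltjes integrals gives the double integral of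
    [mean_influence_sqr]; [restrict_level] passes to [[lo, hi]], where the level indicator is part
    of the integrand. *)
Lemma scale_representation (J : R -> R) :
  (forall u, al <= u < be -> J u = j u) ->
  scale X J al be = Num.sqrt (\int[P]_w (influence X j al be lo hi (X w) ^+ 2)).
Proof.
move=> Jj; rewrite /scale; congr Num.sqrt.
rewrite (mean_influence_sqr X jlip jM al be lohi).
pose h v u := (al <= u < be)%R%:R * (j u * cov u (unit_clip v)).
have bh v : bounded_rv (h v).
  split.
    apply: measurable_funM => //; apply: measurable_funM => //.
    by apply: measurable_funB; [exact: measurable_minr|exact: measurable_funM].
  exists M => u; rewrite /h; case: (boolP (al <= u < be)) => [/co01 u01|_].
    by rewrite mul1r normrM -[leRHS]mulr1 ler_pM// cov_le1.
  by rewrite mul0r normr0.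
have innerE v : al <= v < be ->
    \int[quantile_measure X al be]_(u in `[al, be[) (J u * J v * (Num.min u v - u * v)) =
    j v * inner v.
  move=> vco; have v01 := co01 vco.
  have -> : \int[quantile_measure X al be]_(u in `[al, be[) (J u * J v * (Num.min u v - u * v)) =
      \int[quantile_measure X al be]_(u in `[al, be[) (j v * h v u).
    apply: eq_Rintegral => u; rewrite mem_setE in_itv/= => uco.
    by rewrite !Jj// /h uco unit_clip_id// mul1r /cov; ring.
  rewrite (Rintegral_quantile_measure X al0 albe be1 (f := fun u => j v * h v u)); last first.
    by apply: bounded_rvM => //; exact: bounded_rv_cst.
  rewrite restrict_level -RintegralZl//; last first.
    by apply: (bounded_on_integrable (C := M)) => //;
      [exact: (measurableT_comp minner_ker (pair1_measurable v))|move=> s; exact: (inner_ker_le (v, s))].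
  apply: eq_Rintegral => s _; rewrite /h /g.
  by case: (al <= F s < be) => /=; rewrite -/F; ring.
have -> : \int[quantile_measure X al be]_(v in `[al, be[)
      \int[quantile_measure X al be]_(u in `[al, be[) (J u * J v * (Num.min u v - u * v)) =
    \int[quantile_measure X al be]_(v in `[al, be[) (j v * inner v).
  by apply: eq_Rintegral => v; rewrite mem_setE in_itv/= => vco; rewrite innerE.
rewrite (Rintegral_quantile_measure X al0 albe be1 (f := fun v => j v * inner v)); last first.
  split; first exact: measurable_funM.
  by exists (M * (M * (hi - lo))) => v; rewrite normrM ler_pM.
rewrite restrict_level; apply: eq_Rintegral => t _.
rewrite mulrAC; congr (_ * _); apply: eq_Rintegral => s _.
by rewrite unit_clip_id.
Qed.

End scale_representation.

(** * Trimmed L-statistics *)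

Section trimmed_L_approximation.
Context d (T : measurableType d) (R : realType) (P : probability T R).
Variable X : {RV P >-> R}.
Notation mu := (@lebesgue_measure R).
Variables (J j : R -> R) (CJ M : R).
Hypothesis jlip : forall u v, `|j u - j v| <= CJ * `|u - v|.
Hypothesis jM : forall u, `|j u| <= M.
Variables (alpha beta e0 : R).
Hypotheses (alpha0 : 0 < alpha) (beta0 : 0 < beta) (alphabeta : alpha < 1 - beta).
Hypothesis Jj : forall u, alpha - e0 <= u <= 1 - beta + e0 -> J u = j u.

Let F := rcdf X.
Let Q := rquantile X.
Let Th := antideriv j.

(** Levels strictly outside the limiting trimmed range: on the good event all retained order
    statistics lie between these two finite quantiles. *)
Definition trim_lo := rquantile X (alpha / 2).
Definition trim_hi := rquantile X (1 - beta / 2).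

Let lo := trim_lo.
Let hi := trim_hi.

Variables (k m : nat -> nat) (c : nat -> nat -> R) (n : nat) (x : nat -> R).
Variables (lam rho KQ Sc : R).
Hypotheses (k0 : (0 < k n)%N) (m0 : (0 < m n)%N) (kn : (k n < n - m n)%N).
Hypothesis k_alpha : `|(k n)%:R / n%:R - alpha| <= rho.
Hypothesis m_beta : `|(m n)%:R / n%:R - beta| <= rho.
Hypothesis rho_e0 : rho <= e0.
Hypothesis dev : forall t, `|empirical x n t - F t| <= lam.
Hypotheses (r_alpha : rho + lam <= alpha / 2) (r_beta : rho + lam <= beta / 2).
Hypothesis Q_alpha : Q (alpha + (rho + lam)) - Q (alpha - (rho + lam)) <= KQ * (rho + lam).
Hypothesis Q_beta : Q (1 - beta + (rho + lam)) - Q (1 - beta - (rho + lam)) <= KQ * (rho + lam).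
Hypothesis c_close : \sum_((k n).+1 <= i < (n - m n).+1) `|c i n - weight0 J i n| <= Sc.

Let l := (n - m n)%N.
Let n0 : (0 < n)%N. Proof. by move: kn; case: (n) => //; rewrite sub0n. Qed.
Let n0' : 0 < n%:R :> R. Proof. by rewrite ltr0n. Qed.
Let kl : (k n <= l)%N. Proof. exact: ltnW. Qed.
Let mn : (m n <= n)%N.
Proof.
move: kn; rewrite ltnNge; apply: contraNT; rewrite -ltnNge => /ltnW.
by rewrite -subn_eq0 => /eqP ->.
Qed.
Let ln : (l < n)%N. Proof. by rewrite /l ltn_subrL m0. Qed.
Let an := (k n)%:R / n%:R : R.
Let bn := l%:R / n%:R : R.

Let bnE : bn = 1 - (m n)%:R / n%:R.
Proof. by rewrite /bn /l natrB// mulrBl divff// gt_eqF. Qed.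

Let lam0 : 0 <= lam. Proof. exact: le_trans (dev 0). Qed.
Let rho0 : 0 <= rho. Proof. exact: le_trans k_alpha. Qed.
Let an_bounds : alpha - rho <= an <= alpha + rho. Proof. by rewrite -ler_distl. Qed.
Let m_bounds : beta - rho <= (m n)%:R / n%:R <= beta + rho. Proof. by rewrite -ler_distl. Qed.

Let context := (alpha0, beta0, alphabeta, lam0, rho0, rho_e0, r_alpha, r_beta).

Let lo_le_hi : lo <= hi.
Proof.
have := (alpha0, beta0, alphabeta) => -[[a b] ab].
by apply: rquantile_nd; lra.
Qed.

(** More than k n observations are at most the order statistic, so the empirical function there
    exceeds alpha - rho; below [lo] it would be less than alpha / 2 + lam. The upper bound is
    similar. *)
Let order_stat_bounds i : (k n < i <= l)%N -> lo <= order_stat x n i <= hi.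
Proof.
have [[[[[[[a b] ab] l0] r0] re] ra] rb] := context.
have /andP[an1 an2] := an_bounds; have /andP[m1 m2] := m_bounds.
move=> /andP[ki il].
have i_range : (0 < i <= n)%N by rewrite (leq_trans _ ki)//= (leq_trans il (ltnW ln)).
have countE t : (\sum_(i0 < n) (x i0 <= t)%R)%:R / n%:R = empirical x n t :> R.
  by rewrite /empirical natr_sum.
apply/andP; split.
- rewrite leNgt; apply/negP; set t := order_stat x n i => tlo.
  have : (i <= \sum_(i0 < n) (x i0 <= t)%R)%N by rewrite -order_stat_le.
  move=> /(leq_trans ki); rewrite -(ltr_nat R) -(ltr_pM2r (_ : 0 < n%:R^-1)) ?invr_gt0//.
  rewrite countE -/an => h.
  have : F t < alpha / 2 by rewrite -rquantile_gt//; lra.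
  by have := dev t; rewrite ler_distl => /andP[_]; lra.
- rewrite order_stat_le//; apply: (leq_trans il).
  rewrite -(ler_nat R) -(ler_pM2r (_ : 0 < n%:R^-1)) ?invr_gt0// countE -/bn bnE.
  have : 1 - beta / 2 <= F hi by apply: rcdf_rquantile; lra.
  by have := dev hi; rewrite ler_distl => /andP[+ _]; lra.
Qed.

Let centeringE : centering (cdf X) J an (1 - (m n)%:R / n%:R) =
  \int[mu]_(u in `[an, bn]) (j u * Q u).
Proof.
have [[[[[[[a b] ab] l0] r0] re] ra] rb] := context.
have /andP[an1 an2] := an_bounds; have /andP[m1 m2] := m_bounds.
rewrite /centering -bnE; congr fine; apply: eq_integral => u.
rewrite mem_setE in_itv/= bnE => /andP[u1 u2].
rewrite EFinM Jj; last lra.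
by rewrite /Q /rquantile fineK// quantile_fin_num//; lra.
Qed.

Let weight0E i : (k n < i <= l)%N ->
  weight0 J i n = n%:R * (Th (i%:R / n%:R) - Th (i.-1%:R / n%:R)).
Proof.
have [[[[[[[a b] ab] l0] r0] re] ra] rb] := context.
have /andP[an1 an2] := an_bounds; have /andP[m1 m2] := m_bounds.
move=> /andP[ki il]; rewrite /weight0; congr (_ * _).
have h1 : an <= i.-1%:R / n%:R.
  by rewrite ler_pM2r ?invr_gt0// ler_nat; move: ki; case: i {il}.
have h2 : i%:R / n%:R <= bn by rewrite ler_pM2r ?invr_gt0// ler_nat.
have h3 : i.-1%:R / n%:R <= i%:R / n%:R :> R.
  by rewrite ler_pM2r ?invr_gt0// ler_nat leq_pred.
rewrite -(antiderivB jlip jM) //; last by lra.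
apply: eq_Rintegral => u; rewrite mem_setE in_itv/= => /andP[u1 u2].
by apply: Jj; move: h1 h2; rewrite bnE; lra.
Qed.

(** [L0] carries the exact weights. Replacing [c] by them costs the total weight error times a bound
    on the order statistics; the rest is [linearization_error]. *)
Lemma trimmed_L_approx :
  `|trimmed_L k m c x n
    - centering (cdf X) J ((k n)%:R / n%:R) (1 - (m n)%:R / n%:R)
    - (\sum_(i < n) influence X j alpha (1 - beta) lo hi (x i)) / n%:R| <=
  n%:R^-1 * (Sc * (`|lo| + `|hi|)) + CJ * lam ^+ 2 * (hi - lo)
  + 2 * M * lam * (2 * (KQ * (rho + lam))).
Proof.
have [[[[[[[a b] ab] l0] r0] re] ra] rb] := context.
have /andP[an1 an2] := an_bounds; have /andP[m1 m2] := m_bounds.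
have M0 : 0 <= M by exact: le_trans (jM 0).
set L0 := \sum_((k n).+1 <= i < l.+1) (Th (i%:R / n%:R) - Th (i.-1%:R / n%:R)) * order_stat x n i.
have LL0 : `|trimmed_L k m c x n - L0| <= n%:R^-1 * (Sc * (`|lo| + `|hi|)).
  have -> : trimmed_L k m c x n - L0 =
      n%:R^-1 * \sum_((k n).+1 <= i < l.+1) (c i n - weight0 J i n) * order_stat x n i.
    rewrite /trimmed_L -/l.
    have -> : L0 = n%:R^-1 * \sum_((k n).+1 <= i < l.+1) weight0 J i n * order_stat x n i.
      rewrite mulr_sumr; apply: eq_big_nat => i /andP[ki il].
      by rewrite weight0E ?ki// !mulrA mulVf ?mul1r// gt_eqF.
    by rewrite -mulrBr -sumrB; congr (_ * _); apply: eq_bigr => i _; rewrite mulrBl.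
  rewrite normrM gtr0_norm ?invr_gt0// ler_wpM2l ?invr_ge0 ?(ltW n0')//.
  apply: le_trans (ler_norm_sum _ _ _) _.
  apply: (@le_trans _ _ (\sum_((k n).+1 <= i < l.+1) `|c i n - weight0 J i n| * (`|lo| + `|hi|))).
    rewrite big_nat_cond [leRHS]big_nat_cond; apply: ler_sum => i /andP[/andP[ki il] _].
    rewrite normrM ler_wpM2l//.
    have /andP[h1 h2] := order_stat_bounds (introT andP (conj ki il)).
    have := ler_norm hi; have := ler_norm (- lo); rewrite normrN.
    have := normr_ge0 lo; have := normr_ge0 hi.
    by rewrite ler_norml; lra.
  by rewrite -mulr_suml ler_wpM2r// addr_ge0.
have lin : `|L0 - \int[mu]_(u in `[an, bn]) (j u * Q u)
    - (\sum_(i < n) influence X j alpha (1 - beta) lo hi (x i)) / n%:R| <=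
    CJ * lam ^+ 2 * (hi - lo) + 2 * M * lam * (2 * (KQ * (rho + lam))).
  have loQ : lo <= Q an by apply: rquantile_nd; [lra|lra|move: an2; lra].
  have Qhi : Q bn <= hi by rewrite bnE; apply: rquantile_nd; lra.
  have lbe : `|bn - (1 - beta)| <= rho.
    by rewrite bnE ler_distl; lra.
  apply: le_trans (linearization_error jlip jM n0 k0 kl ln lo_le_hi order_stat_bounds
    loQ Qhi k_alpha lbe dev _ _ _ _) _; try lra.
  rewrite lerD2l ler_wpM2l ?mulr_ge0//.
  by move: Q_alpha Q_beta; rewrite -/Q; lra.
rewrite -/an centeringE.
have split3 (t v w z : R) : t - w - z = (t - v) + (v - w - z) by ring.
rewrite (split3 _ L0); apply: le_trans (ler_normD _ _) _.
by move: (lerD LL0 lin); rewrite !addrA.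
Qed.

End trimmed_L_approximation.

(** * Negligibility of the exceptional event *)

Section exp_small.
Context {R : realType}.

(** For x <= p^2 / 10 the tail is at least of order p^{-2} exp(- p^4 / 200), whereas the left side
    decays like exp(- p^4 / 20). A spare factor exp(p^4 / 25) is left to absorb the powers of
    [p]. *)
Lemma exp_small_normal_tail (p del x : R) : 1 <= p -> 0 <= del -> del <= 10^-1 ->
  x <= del * p ^+ 2 ->
  8 * p ^+ 4 * expR (- (p ^+ 4 / 20)) <= 200 ^+ 2 / mills_cst * p^-1 * normal_tail x.
Proof.
move=> p1 d0 d1 xp.
have p0 : 0 < p by lra.
have m0 := @mills_cst_gt0 R.
set z := Num.max x 0.
have p2 : 1 <= p ^+ 2 by rewrite exprn_ege1.
have zp : z <= p ^+ 2 / 10.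
  rewrite ge_max; apply/andP; split; last by rewrite divr_ge0// sqr_ge0.
  apply: le_trans xp _; rewrite mulrC ler_wpM2l// ?sqr_ge0//.
have z0 : 0 <= z by rewrite le_max lexx orbT.
have env : expR (- (p ^+ 4 / 200)) <= gauss_env x.
  rewrite ler_expR lerN2 -/z.
  have : z ^+ 2 <= (p ^+ 2 / 10) ^+ 2 by rewrite lerXn2r// nnegrE// (le_trans z0).
  rewrite (_ : (p ^+ 2 / 10) ^+ 2 = p ^+ 4 / 100); last by field.
  by lra.
have lb := normal_tail_lb x; rewrite -/z in lb.
have t0 := normal_tail_gt0 x.
have lb' : mills_cst * expR (- (p ^+ 4 / 200)) <= (2 * p ^+ 2) * normal_tail x.
  apply: (le_trans (ler_wpM2l (ltW m0) env)); apply: (le_trans lb).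
  by rewrite ler_wpM2r ?(ltW t0)//; lra.
have sq : (p ^+ 4 / 50) ^+ 2 <= expR (p ^+ 4 / 25).
  rewrite (_ : p ^+ 4 / 25 = p ^+ 4 / 50 + p ^+ 4 / 50); last by field.
  rewrite expRD.
  have h : p ^+ 4 / 50 <= expR (p ^+ 4 / 50).
    by have := expR_ge1Dx (p ^+ 4 / 50); lra.
  have q0 : 0 <= p ^+ 4 / 50 by rewrite divr_ge0// exprn_ge0// ltW.
  by rewrite expr2; exact: ler_pM.
have e1 : expR (- (p ^+ 4 / 20)) * expR (p ^+ 4 / 25) <= expR (- (p ^+ 4 / 200)).
  by rewrite -expRD ler_expR; have := exprn_ge0 4 (ltW p0); lra.
have E0 := expR_gt0 (- (p ^+ 4 / 20)).
have h1 : expR (- (p ^+ 4 / 20)) * (p ^+ 4 / 50) ^+ 2 <= expR (- (p ^+ 4 / 200)).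
  by apply: le_trans (ler_wpM2l (ltW E0) sq) e1.
have h2 := le_trans (ler_wpM2l (ltW m0) h1) lb'.
set e := expR _ in h2 E0 *.
set t := normal_tail x in h2 t0 *.
have p20 : 0 < p ^+ 2 by lra.
have h3 : mills_cst * e * p ^+ 5 / 50 ^+ 2 <= 2 * t.
  apply: (@le_trans _ _ (mills_cst * e * p ^+ 6 / 50 ^+ 2)).
    rewrite ler_wpM2r ?invr_ge0 ?exprn_ge0// ler_wpM2l ?(ltW (mulr_gt0 _ _))//.
    by rewrite ler_weXn2l.
  rewrite -(ler_pM2r p20); move: h2; clear.
  move: mills_cst e t => M e t.
  rewrite (_ : M * (e * (p ^+ 4 / 50) ^+ 2) = M * e * p ^+ 6 / 50 ^+ 2 * p ^+ 2).
    by rewrite (_ : 2 * p ^+ 2 * t = 2 * t * p ^+ 2) //; ring.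
  by field.
have w0 : 0 <= 8 * 50 ^+ 2 / mills_cst / p.
  by do 2![apply: divr_ge0; last exact: ltW]; apply: mulr_ge0 => //; apply: exprn_ge0.
have := ler_wpM2l w0 h3; move: m0 p0; clear.
move: mills_cst e t => M e t M0 p0.
have -> : 8 * 50 ^+ 2 / M / p * (M * e * p ^+ 5 / 50 ^+ 2) = 8 * p ^+ 4 * e.
  by field; rewrite ?gt_eqF.
have -> // : 8 * 50 ^+ 2 / M / p * (2 * t) = 200 ^+ 2 / M / p * t.
by field; rewrite ?gt_eqF.
Qed.

End exp_small.

Section perturbed_moderate_deviations.
Context d (T : measurableType d) (R : realType) (P : probability T R).
Variable X : nat -> {RV P >-> R}.
Hypothesis indX : mutually_independent X.
Hypothesis idX : identically_distributed X.
Variables (y : R -> R) (b : R).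
Hypothesis my : measurable_fun setT y.
Hypothesis yb : forall x, `|y x| <= b.
Hypothesis mean_y : \int[P]_w y (X 0%N w) = 0.
Hypothesis mean_y2 : \int[P]_w (y (X 0%N w) ^+ 2) = 1.
Variables (A C : R).
Hypotheses (A0 : 0 <= A) (C0 : 0 <= C).

(** Off [bad], the event [E] is sandwiched between tail events of [S] at shifted thresholds. Keeping
    [E] abstract allows strict and non-strict events, hence both tails of the statistic. *)
Lemma moderate_deviation_perturbed :
  exists2 K, 0 <= K & forall n p del x (E bad : set T),
    2 <= p -> b <= p -> n%:R = p ^+ 12 -> 0 <= del -> del <= 10^-1 ->
    - A <= x -> x <= del * p ^+ 2 ->
    let S := psum X (fun a => y a * p^-1 ^+ 6) n in
    measurable E -> measurable bad ->
    fine (P bad) <= 8 * p ^+ 4 * expR (- (p ^+ 4 / 20)) ->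
    (forall w, E w -> ~ bad w -> x - C * p^-1 ^+ 2 < S w) ->
    (forall w, x + C * p^-1 ^+ 2 < S w -> ~ bad w -> E w) ->
    `|fine (P E) - normal_tail x| <= K * (p^-1 + del) * normal_tail x.
Proof.
have [K K0 KP] := moderate_deviation indX idX my yb mean_y mean_y2 A0 C0.
have c0 : 0 <= 200 ^+ 2 / @mills_cst R.
  by rewrite divr_ge0 ?exprn_ge0// ltW// mills_cst_gt0.
exists (K + 200 ^+ 2 / @mills_cst R); first exact: addr_ge0.
move=> n p del x E bad p2 pb np d0 d1 Ax xp S mE mbad Pbad EB BE.
have p0 : 0 < p by lra.
have q0 : 0 < p^-1 by rewrite invr_gt0.
have p1 : 1 <= p by lra.
have small := exp_small_normal_tail p1 d0 d1 xp.
have d1' : del <= 1 by lra.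
have [] := KP n p del x p2 pb np d0 d1' Ax xp; rewrite -/S => ub lb.
have mS : measurable_fun setT S.
  by apply: measurable_psum; exact: measurable_funM.
have prob_le (U V W : set T) : measurable U -> measurable V -> measurable W ->
    U `<=` V `|` W -> fine (P U) <= fine (P V) + fine (P W).
  move=> mU mV mW UVW.
  rewrite -fineD ?fin_num_measure// fine_le ?fin_num_measure//.
    by rewrite fin_numD !fin_num_measure.
  apply: (@le_trans _ _ (P (V `|` W))).
    by apply: le_measure => //; rewrite inE//; exact: measurableU.
  exact: measureU2.
have h1 : fine (P E) <= fine (P [set w | x - C * p^-1 ^+ 2 < S w]) + fine (P bad).
  apply: prob_le => //; first exact: measurable_lt_rv.
  by move=> w Ew; have [|/(EB _ Ew)] := pselect (bad w); [right|left].
have h2 : fine (P [set w | x + C * p^-1 ^+ 2 < S w]) <= fine (P E) + fine (P bad).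
  apply: prob_le => //; first exact: measurable_lt_rv.
  by move=> w Sw; have [|/(BE _ Sw)] := pselect (bad w); [right|left].
have t0 := normal_tail_gt0 x.
move: c0 small ub lb h1 h2 Pbad t0.
move: (200 ^+ 2 / _) (normal_tail x) (8 * _ * _) => k t e k0 small ub lb h1 h2 Pbad t0.
have -> : (K + k) * (p^-1 + del) * t = K * (p^-1 + del) * t + k * p^-1 * t + k * del * t by ring.
have kd : 0 <= k * del * t by rewrite !mulr_ge0// ltW.
by rewrite ler_norml; lra.
Qed.

End perturbed_moderate_deviations.

(** * Consequences of the local Lipschitz hypotheses *)

Section local_lipschitz.
Context {R : realType}.
Implicit Types (f J : R -> R) (I : set R).

Lemma lipschitz_inP f I : [lipschitz f u | u in I] ->
  exists2 C, 0 <= C & forall u v, I u -> I v -> `|f u - f v| <= C * `|u - v|.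
Proof.
move=> /pinfty_ex_gt0[C C0 CP]; exists C; first exact: ltW.
by move=> u v Iu Iv; exact: (CP (u, v)).
Qed.

Lemma lipschitz_near f (a : R) :
  (exists2 U, nbhs a U & [lipschitz f u | u in U]) ->
  exists r0 K, [/\ 0 < r0, 0 <= K & forall r, 0 <= r -> r <= r0 ->
    f (a + r) - f (a - r) <= K * r].
Proof.
move=> [U /nbhs_ballP[r0/= r00 aU] /lipschitz_inP[C C0 CP]].
exists (r0 / 2), (2 * C); split; [by rewrite divr_gt0|by rewrite mulr_ge0|].
move=> r r_ge0 rr0; apply: le_trans (ler_norm _) _.
have inU s : `|s| <= r -> U (a + s).
  move=> sr; apply: aU; rewrite /ball/= opprD addNKr normrN.
  by rewrite (le_lt_trans sr)//; lra.
apply: (le_trans (CP _ _ (inU r _) (inU (- r) _))).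
- by rewrite ger0_norm.
- by rewrite normrN ger0_norm.
- by rewrite ger0_norm; lra.
Qed.

Lemma open_itv_widen I (a b : R) : open I -> a <= b -> `[a, b] `<=` I ->
  exists2 e, 0 < e & forall u, a - e <= u <= b + e -> I u.
Proof.
move=> oI ab abI.
have [e1/= e10 h1] : exists2 e, 0 < e & ball a e `<=` I.
  by apply/nbhs_ballP; apply: open_nbhs_nbhs; split=> //; apply: abI; rewrite /= in_itv/= lexx.
have [e2/= e20 h2] : exists2 e, 0 < e & ball b e `<=` I.
  by apply/nbhs_ballP; apply: open_nbhs_nbhs; split=> //; apply: abI; rewrite /= in_itv/= lexx andbT.
exists (Num.min e1 e2 / 2); first by rewrite divr_gt0// lt_min e10.
move=> u; have m1 : Num.min e1 e2 <= e1 by rewrite ge_min lexx.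
have m2 : Num.min e1 e2 <= e2 by rewrite ge_min lexx orbT.
move: (Num.min _ _) m1 m2 => e m1 m2 /andP[u1 u2].
have [ua|au] := ltP u a; first by apply: h1; rewrite /ball/= gtr0_norm; lra.
have [ub|bu] := leP u b; first by apply: abI; rewrite /= in_itv/= au.
by apply: h2; rewrite /ball/= distrC gtr0_norm; lra.
Qed.

(* [J] is extended by constants outside of [[a, b]]. *)
Lemma lipschitz_extension J I (a b : R) : a <= b -> (forall u, a <= u <= b -> I u) ->
  [lipschitz J u | u in I] ->
  exists j C M, [/\ forall u v, `|j u - j v| <= C * `|u - v|, forall u, `|j u| <= M
    & forall u, a <= u <= b -> J u = j u].
Proof.
move=> ab abI /lipschitz_inP[C C0 CP].
pose cl u := Num.max a (Num.min b u).
have clab u : a <= cl u <= b.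
  by rewrite /cl le_max lexx/= ge_max ab/= ge_min lexx.
have cl1 u v : `|cl u - cl v| <= `|u - v|.
  have h1 := ler_norm (u - v); have h2 := ler_norm (- (u - v)).
  rewrite normrN in h2; rewrite /cl ler_norml.
  case: (leP b u) => bu; case: (leP b v) => bv;
    rewrite ?(max_r ab); try lra.
  - by case: (leP a v) => ?; lra.
  - by case: (leP a u) => ?; lra.
  - by case: (leP a u) => ?; case: (leP a v) => ?; lra.
exists (J \o cl), C, (`|J a| + C * (b - a)); split => /=.
- move=> u v; apply: (le_trans (CP _ _ (abI _ (clab u)) (abI _ (clab v)))).
  exact: ler_wpM2l.
- move=> u; rewrite -[J (cl u)](subrK (J a)) addrC; apply: le_trans (ler_normD _ _) _.
  rewrite lerD2l; apply: (le_trans (CP _ _ (abI _ (clab u)) (abI a _))).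
    by rewrite lexx.
  rewrite ler_wpM2l//; have /andP[h1 h2] := clab u.
  by rewrite ger0_norm ?subr_ge0// lerD2r.
- by move=> u /andP[au ub]; rewrite /cl min_r// max_r.
Qed.

End local_lipschitz.

Section measurable_trimmed_L.
Context d (T : measurableType d) (R : realType) (P : probability T R).
Variable X : nat -> {RV P >-> R}.

Lemma measurable_order_stat n i : (0 < i <= n)%N ->
  measurable_fun setT (fun w => order_stat (fun i => X i w) n i).
Proof.
move=> i_range; apply: (measurability _ (RGenOInfty.measurableE R)).
move=> _ [_ [t ->] <-]; rewrite setTI.
pose f w := - \sum_(l < n) \1_[set w | X l w <= t] w : R.
have mf : measurable_fun setT f.
  apply: measurable_funN; apply: measurable_sum => l; apply: measurable_indic.
  by rewrite -[X in measurable X]setTI; exact: measurable_fun_le.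
rewrite (_ : _ @^-1` _ = [set w | - i%:R < f w]); first exact: measurable_lt_rv.
have fE w : (t < order_stat (fun i => X i w) n i) = (- i%:R < f w).
  rewrite [LHS]ltNge order_stat_le// -ltnNge -(ltr_nat R) natr_sum /f ltrN2.
  congr (_ < _); apply: eq_bigr => l _; rewrite indicE; congr (_ %:R).
  by case: leP => h; [rewrite mem_set|rewrite memNset//= leNgt h].
by apply/seteqP; split => w /=; rewrite in_itv/= andbT fE.
Qed.

Lemma measurable_trimmed_L k m c n : (k n < n - m n)%N ->
  measurable_fun setT (fun w => trimmed_L k m c (fun i => X i w) n).
Proof.
move=> kn; apply: measurable_funM => //.
(* Measurability of a sum is asked for every index, so terms out of range are set to 0. *)
pose f i w := if (0 < i <= n)%N then c i n * order_stat (fun i => X i w) n i else 0.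
rewrite (_ : (fun w => _) = fun w => \sum_((k n).+1 <= i < (n - m n).+1) f i w).
  apply: measurable_sum => i; rewrite /f.
  case: (boolP (0 < i <= n)%N) => [i_range|_]; last exact: measurable_cst.
  by apply: measurable_funM => //; exact: measurable_order_stat.
apply/funext => w; apply: eq_big_nat => i /andP[ki il].
rewrite ltnS in il.
by rewrite /f (leq_trans _ ki)//= (leq_trans il (leq_subr _ _)).
Qed.

End measurable_trimmed_L.

(** * Powers of the twelfth root of n *)

Section twelfth_root.
Context {R : realType}.

(** The orders n^{1/2}, n^{1/3}, n^{1/4} and n^{1/6} all become integer powers of it, which reduces
    the bookkeeping of exponents to field identities. *)
Definition root12 (n : nat) : R := n%:R `^ 12^-1.

Lemma root12_gt0 n : (0 < n)%N -> 0 < root12 n.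
Proof. by move=> n0; rewrite powR_gt0// ltr0n. Qed.

Lemma powR_root12 n l : n%:R `^ (12^-1 * l%:R) = root12 n ^+ l.
Proof. by rewrite powRrM powR_mulrn// powR_ge0. Qed.

Lemma root12X12 n : root12 n ^+ 12 = n%:R.
Proof. by rewrite -powR_root12 mulVf// powRr1. Qed.

Lemma sqrt_root12 n : Num.sqrt n%:R = root12 n ^+ 6.
Proof. by rewrite -root12X12 (exprM _ 6 2) sqrtr_sqr ger0_norm// exprn_ge0// powR_ge0. Qed.

Lemma root12X4 n : n%:R `^ 3^-1 = root12 n ^+ 4.
Proof. by rewrite -powR_root12; congr (_ `^ _); field. Qed.

Lemma root12X2 n : n%:R `^ 6^-1 = root12 n ^+ 2.
Proof. by rewrite -powR_root12; congr (_ `^ _); field. Qed.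

Lemma root12VX4 n : n%:R `^ (- 3^-1) = (root12 n)^-1 ^+ 4.
Proof. by rewrite powRN root12X4 exprVn. Qed.

Lemma mul12_V8 (p : R) : 0 < p -> p ^+ 12 * (p^-1 ^+ 4) ^+ 2 = p ^+ 4.
Proof. by move=> p0; field; rewrite gt_eqF. Qed.

Lemma V12_mul4 (p a b : R) : 0 < p -> (p ^+ 12)^-1 * (a * p ^+ 4 * b) = a * b * p^-1 ^+ 8.
Proof. by move=> p0; field; rewrite gt_eqF. Qed.

Lemma root12_ge_near (B : R) : \forall n \near \oo, B <= root12 n.
Proof.
exists (Num.truncn (`|B| ^+ 12)).+1 => //= n /= Bn.
apply: le_trans (ler_norm B) _.
have : `|B| ^+ 12 <= root12 n ^+ 12.
  rewrite root12X12; apply/ltW/(lt_le_trans (truncnS_gt _)).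
  by rewrite ler_nat.
by rewrite ler_pXn2r// nnegrE// powR_ge0.
Qed.

End twelfth_root.

(** * Approximation of the statistic by a sum of independent variables *)

Section approximation.
Context d (T : measurableType d) (R : realType) (P : probability T R).
Variable X : nat -> {RV P >-> R}.
Hypothesis indX : mutually_independent X.
Hypothesis idX : identically_distributed X.
Variables (k m : nat -> nat) (c : nat -> nat -> R) (alpha beta : R).
Variables (I : set R) (J : R -> R).
Let Finv := quantile (cdf (X 0%N)).
Hypothesis kmn : forall n, (0 < n)%N -> (k n < n - m n)%N.
Hypotheses (alpha0 : 0 < alpha) (alphabeta : alpha < 1 - beta) (beta0 : 0 < beta).
Hypothesis lip_alpha :
  exists2 U, nbhs alpha U & [lipschitz fine (Finv u) | u in U].
Hypothesis lip_beta :
  exists2 U, nbhs (1 - beta) U & [lipschitz fine (Finv u) | u in U].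
Hypothesis trimming_rate :
  (fun n => Num.max `|(k n)%:R / n%:R - alpha| `|(m n)%:R / n%:R - beta|) =O_\oo
    (fun n => n%:R `^ (- 3^-1)).
Hypotheses (oI : open I) (abI : `[alpha, 1 - beta] `<=` I).
Hypothesis lip_J : [lipschitz J u | u in I].
Hypothesis weights_rate :
  (fun n => \sum_((k n).+1 <= i < (n - m n).+1) `|c i n - weight0 J i n|)
    =O_\oo (fun n => n%:R `^ 3^-1).

Lemma trimmed_L_sum_approx : exists Y : R -> R, exists b K : R,
  [/\ measurable_fun setT Y /\ (forall x, `|Y x| <= b),
      \int[P]_w Y (X 0%N w) = 0,
      scale (X 0%N) J alpha (1 - beta) =
        Num.sqrt (\int[P]_w (Y (X 0%N w) ^+ 2)),
      0 <= K &
      \forall n \near \oo, exists bad, [/\ measurable bad,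
        fine (P bad) <= 8 * root12 n ^+ 4 * expR (- (root12 n ^+ 4 / 20)) &
        forall w, ~ bad w ->
          `|trimmed_L k m c (fun i => X i w) n
            - centering (cdf (X 0%N)) J ((k n)%:R / n%:R) (1 - (m n)%:R / n%:R)
            - (\sum_(i < n) Y (X i w)) / n%:R| <= K * (root12 n)^-1 ^+ 8]].
Proof.
have [[a0 ab] b0] := (alpha0, alphabeta, beta0).
have [e0 e00 e0I] := open_itv_widen oI (ltW alphabeta) abI.
have e0ab : alpha - e0 <= 1 - beta + e0 by lra.
have [j [CJ [M [jlip jM Jj]]]] := lipschitz_extension e0ab e0I lip_J.
have [r1 [K1 [r10 K10 Qa]]] := lipschitz_near lip_alpha.
have [r2 [K2 [r20 K20 Qb]]] := lipschitz_near lip_beta.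
have /eqO_exP[Kr [Kr0 Kr_near]] := trimming_rate.
have /eqO_exP[Kc [Kc0 Kc_near]] := weights_rate.
have CJ0 : 0 <= CJ by have := le_trans (normr_ge0 _) (jlip 1 0); rewrite subr0 normr1 mulr1.
have M0 : 0 <= M by exact: le_trans (jM 0).
set lo := trim_lo (X 0%N) alpha; set hi := trim_hi (X 0%N) beta.
have lohi : lo <= hi by apply: rquantile_nd; lra.
have loQ : lo <= rquantile (X 0%N) alpha by apply: rquantile_nd; lra.
have Qhi : rquantile (X 0%N) (1 - beta) <= hi by apply: rquantile_nd; lra.
(* A common radius within which [J] equals [j], both Lipschitz bounds hold, and the quantile levels
   stay inside the range of [lo] and [hi]. *)
have [s [s0 [se0 [sa [sb [sr1 sr2]]]]]] : exists s, 0 < s /\ s <= e0 /\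
    s <= alpha / 2 /\ s <= beta / 2 /\ s <= r1 /\ s <= r2.
  exists (Num.min (Num.min e0 (Num.min (alpha / 2) (beta / 2))) (Num.min r1 r2)).
  by rewrite !lt_min e00 r10 r20/= !divr_gt0// !ge_min !lexx !orbT.
(* The three terms of the constant are the weight error, the second-order Taylor error and the two
   windows; 4 and 8 come from [lam = 2 * q ^+ 4]. *)
exists (influence (X 0%N) j alpha (1 - beta) lo hi), (M * (hi - lo)),
  (Kc * (`|lo| + `|hi|) + 4 * CJ * (hi - lo) + 8 * M * (K1 + K2) * (Kr + 2)).
split.
- split; first exact: measurable_influence jlip jM _ _ _ _.
  exact: influence_le jlip jM _ _ _ _ lohi.
- exact: mean_influence jlip jM _ _ _ _ lohi.
- apply: (scale_representation jlip jM) => //; [lra|lra|].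
  by move=> u u_range; apply: Jj; lra.
- have [Kc0' Kr0'] := (ltW Kc0, ltW Kr0).
  have hl : 0 <= hi - lo by rewrite subr_ge0.
  have K12 : 0 <= K1 + K2 by rewrite addr_ge0.
  have Kr2 : 0 <= Kr + 2 by rewrite addr_ge0.
  have hl' : 0 <= `|lo| + `|hi| by rewrite addr_ge0.
  by apply: addr_ge0; [apply: addr_ge0|]; rewrite !mulr_ge0.
have near1 := @root12_ge_near R 1; have near_s := root12_ge_near ((Kr + 2) / s).
near=> n.
have n0 : (0 < n)%N by near: n; exists 1%N.
have p1 : (1 : R) <= root12 n by near: n.
have ps : (Kr + 2) / s <= root12 n by near: n.
set p := root12 n in p1 ps *; set q := p^-1.
have p0 : 0 < p by exact: root12_gt0.
have q0 : 0 < q by rewrite invr_gt0.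
have q1 : q <= 1 by rewrite invf_le1.
have q4 : 0 <= q ^+ 4 by rewrite exprn_ge0// ltW.
have qs : (Kr + 2) * q ^+ 4 <= s.
  apply: (@le_trans _ _ ((Kr + 2) * q)).
    by rewrite ler_wpM2l//; [rewrite addr_ge0// ltW|rewrite -[leRHS]expr1 ler_wiXn2l// ltW].
  by rewrite ler_pdivrMr// mulrC -ler_pdivrMr.
have k_rate : Num.max `|(k n)%:R / n%:R - alpha| `|(m n)%:R / n%:R - beta| <= Kr * q ^+ 4.
  have : `|Num.max `|(k n)%:R / n%:R - alpha| `|(m n)%:R / n%:R - beta| | <=
      Kr * `|n%:R `^ (- 3^-1) : R| by near: n.
  rewrite root12VX4 -/p -/q (ger0_norm q4) => h.
  exact: le_trans (ler_norm _) h.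
have c_rate : \sum_((k n).+1 <= i < (n - m n).+1) `|c i n - weight0 J i n| <= Kc * p ^+ 4.
  have : `|\sum_((k n).+1 <= i < (n - m n).+1) `|c i n - weight0 J i n| | <=
      Kc * `|n%:R `^ 3^-1 : R| by near: n.
  rewrite root12X4 -/p (ger0_norm (exprn_ge0 _ (ltW p0))) => h.
  exact: le_trans (ler_norm _) h.
(* About n^{1/3} grid points: the grid step is then at most the deviation [q ^+ 4], so that [lam] is
   twice [q ^+ 4], and the union bound costs only [4 * N <= 8 * p ^+ 4]. *)
pose N := (Num.truncn (p ^+ 4)).+1.
have p4 : 1 <= p ^+ 4 by exact: exprn_ege1.
have N1 : N%:R <= 2 * p ^+ 4.
  by rewrite /N -natr1 mulr_natl mulr2n lerD// truncn_le; lra.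
have N2 : N%:R^-1 <= q ^+ 4.
  by rewrite exprVn lef_pV2 ?posrE ?ltr0n ?exprn_gt0//; exact/ltW/truncnS_gt.
have q41 : q ^+ 4 <= 1 by rewrite exprn_ile1// ltW.
have [bad [mbad Pbad badP]] := uniform_deviation indX idX n0 (ltn0Sn _ : (0 < N)%N) q4 q41.
exists bad; split => //.
  apply: (le_trans Pbad).
  have -> : n%:R * (q ^+ 4) ^+ 2 = p ^+ 4 by rewrite -root12X12; exact: mul12_V8.
  by rewrite mulrA ler_wpM2r ?expR_ge0//; lra.
move=> w /badP dev.
have [rho rhoE] : exists rho, rho = Kr * q ^+ 4 by eexists.
have [lam lamE] : exists lam, lam = 2 * q ^+ 4 by eexists.
have rl : rho + lam = (Kr + 2) * q ^+ 4 by rewrite rhoE lamE -mulrDl.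
have rho0 : 0 <= rho by rewrite rhoE mulr_ge0// ltW.
have lam0 : 0 <= lam by rewrite lamE mulr_ge0.
have rls : rho + lam <= s by rewrite rl.
have /andP[ka mb] : (`|(k n)%:R / n%:R - alpha| <= rho) && (`|(m n)%:R / n%:R - beta| <= rho).
  by rewrite -ge_max rhoE.
have k0 : (0 < k n)%N.
  rewrite lt0n; apply/eqP => kn0; move: ka; rewrite kn0 mul0r sub0r normrN gtr0_norm//.
  by lra.
have m0 : (0 < m n)%N.
  rewrite lt0n; apply/eqP => mn0; move: mb; rewrite mn0 mul0r sub0r normrN gtr0_norm//.
  by lra.
have dev' t : `|empirical (fun i => X i w) n t - rcdf (X 0%N) t| <= lam.
  by apply: (le_trans (dev t)); rewrite lamE mulr2n mulrDl !mul1r lerD2l.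
have rho_le : rho <= rho + lam by rewrite lerDl.
have rhoe0 : rho <= e0 := le_trans rho_le (le_trans rls se0).
have ra := le_trans rls sa.
have rb := le_trans rls sb.
have rl0 : 0 <= rho + lam by exact: addr_ge0.
have Qa' : rquantile (X 0%N) (alpha + (rho + lam)) - rquantile (X 0%N) (alpha - (rho + lam))
    <= (K1 + K2) * (rho + lam).
  by apply: le_trans (Qa _ rl0 (le_trans rls sr1)) _; rewrite ler_wpM2r// lerDl.
have Qb' : rquantile (X 0%N) (1 - beta + (rho + lam)) - rquantile (X 0%N) (1 - beta - (rho + lam))
    <= (K1 + K2) * (rho + lam).
  by apply: le_trans (Qb _ rl0 (le_trans rls sr2)) _; rewrite ler_wpM2r// lerDr.
apply: le_trans (trimmed_L_approx jlip jM alpha0 beta0 alphabeta Jj k0 m0 (kmn n0)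
  ka mb rhoe0 dev' ra rb Qa' Qb' c_rate) _.
rewrite -/lo -/hi rl lamE -(@root12X12 R n) -/p.
have -> : (p ^+ 12)^-1 * (Kc * p ^+ 4 * (`|lo| + `|hi|)) = Kc * (`|lo| + `|hi|) * q ^+ 8.
  exact: V12_mul4.
by rewrite le_eqVlt; apply/orP; left; apply/eqP; ring.
Unshelve. all: by end_near. Qed.

End approximation.

Section uniform_equivalence.
Context {R : realType}.

Lemma unif_equivalent_relative_error (D : nat -> set R) (f g : nat -> R -> R) :
  (forall n x, 0 < g n x) ->
  (forall e, 0 < e -> \forall n \near \oo, forall x, D n x ->
    `|f n x - g n x| <= e * g n x) ->
  unif_equivalent D f g.
Proof.
move=> g0 fg; exists (fun n x => f n x / g n x - 1); split.
- move=> e e0; apply: filterS (fg _ e0) => n fgn x Dx.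
  rewrite -[1](divff (lt0r_neq0 (g0 n x))) -mulrBl normrM normfV (gtr0_norm (g0 n x)).
  by rewrite ler_pdivrMr// fgn.
- by near=> n => x _; rewrite addrC subrK mulrC divfK// lt0r_neq0.
Unshelve. all: by end_near. Qed.

End uniform_equivalence.

Section tail_equivalence.
Context d (T : measurableType d) (R : realType) (P : probability T R).
Variable X : nat -> {RV P >-> R}.
Hypothesis indX : mutually_independent X.
Hypothesis idX : identically_distributed X.
Variables (y : R -> R) (b : R).
Hypothesis my : measurable_fun setT y.
Hypothesis yb : forall x, `|y x| <= b.
Hypothesis mean_y : \int[P]_w y (X 0%N w) = 0.
Hypothesis mean_y2 : \int[P]_w (y (X 0%N w) ^+ 2) = 1.

Lemma tail_relative_error (A C : R) (a : nat -> R) (E : nat -> R -> set T) :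
  0 <= A -> 0 <= C -> a @ \oo --> 0 ->
  (forall n x, (0 < n)%N -> measurable (E n x)) ->
  (\forall n \near \oo, exists bad, [/\ measurable bad,
    fine (P bad) <= 8 * root12 n ^+ 4 * expR (- (root12 n ^+ 4 / 20)) &
    forall x w, ~ bad w ->
      let S := psum X (fun a => y a * (root12 n)^-1 ^+ 6) n w in
      (E n x w -> x - C * (root12 n)^-1 ^+ 2 < S) /\
      (x + C * (root12 n)^-1 ^+ 2 < S -> E n x w)]) ->
  forall e, 0 < e -> \forall n \near \oo, forall x,
    - A <= x <= a n * n%:R `^ 6^-1 ->
    `|fine (P (E n x)) - normal_tail x| <= e * normal_tail x.
Proof.
move=> A0 C0 a0 mE badE e e0.
have [K K0 KP] := moderate_deviation_perturbed indX idX my yb mean_y mean_y2 A0 C0.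
pose h := e / (2 * (K + 1)).
have K10 : 0 < 2 * (K + 1) by rewrite mulr_gt0//; lra.
have h0 : 0 < h by rewrite divr_gt0.
(* A fixed level eventually above [|a n|]: at most [h] to make the relative error small, at most
   1/10 to keep the exceptional event negligible. *)
pose del := Num.min h 10^-1.
have del0 : 0 < del by rewrite lt_min h0 invr_gt0 ltr0n.
have near2 := @root12_ge_near R 2; have nearb := root12_ge_near b.
have nearh := root12_ge_near h^-1.
have neara : \forall n \near \oo, `|a n| <= del.
  by move/cvgrPdist_le : a0 => /(_ _ del0); apply: filterS => n; rewrite sub0r normrN.
near=> n => x /andP[Ax xa].
have n0 : (0 < n)%N by near: n; exists 1%N.
have [bad [mbad Pbad badP]] : exists bad, [/\ measurable bad,
    fine (P bad) <= 8 * root12 n ^+ 4 * expR (- (root12 n ^+ 4 / 20)) &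
    forall x w, ~ bad w ->
      let S := psum X (fun a => y a * (root12 n)^-1 ^+ 6) n w in
      (E n x w -> x - C * (root12 n)^-1 ^+ 2 < S) /\
      (x + C * (root12 n)^-1 ^+ 2 < S -> E n x w)].
  by near: n.
have p2 : (2 : R) <= root12 n by near: n.
have pb : b <= root12 n by near: n.
have ph : h^-1 <= root12 n by near: n.
have an : `|a n| <= del by near: n.
have p0 := @root12_gt0 R n n0.
have xd : x <= del * root12 n ^+ 2.
  apply: (le_trans xa); rewrite root12X2 ler_wpM2r ?exprn_ge0// ?(ltW p0)//.
  exact: le_trans (ler_norm _) an.
have del1 : del <= 10^-1 by rewrite ge_min lexx orbT.
apply: le_trans (KP n (root12 n) del x (E n x) bad p2 pb _ (ltW del0) del1 Ax xd _ mbad Pbad _ _) _.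
- by rewrite root12X12.
- exact: mE.
- by move=> w Ew bw; have [+ _] := badP x w bw; apply.
- by move=> w Sw bw; have [_ +] := badP x w bw; apply.
rewrite ler_wpM2r ?(ltW (normal_tail_gt0 _))//.
have delh : del <= h by rewrite ge_min lexx.
have qh : (root12 n)^-1 <= h by rewrite -[h]invrK lef_pV2 ?posrE ?invr_gt0.
have -> : e = 2 * (K + 1) * h by rewrite mulrC divfK// gt_eqF.
have : K * ((root12 n)^-1 + del) <= K * (h + h) by rewrite ler_wpM2l// lerD.
have -> : 2 * (K + 1) * h = K * (h + h) + 2 * h by ring.
by move: h0; lra.
Unshelve. all: by end_near. Qed.

End tail_equivalence.

Theorem corollary1p1 (d : measure_display) (T : measurableType d)
    (R : realType) (P : probability T R) (X : nat -> {RV P >-> R})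
    (k m : nat -> nat) (c : nat -> nat -> R) (alpha beta : R)
    (I : set R) (J : R -> R) :
  let alpha_ n : R := (k n)%:R / n%:R in
  let beta_ n : R := (m n)%:R / n%:R in
  let Finv := quantile (cdf (X 0%N)) in
  let mu n := centering (cdf (X 0%N)) J (alpha_ n) (1 - beta_ n) in
  let sigma := scale (X 0%N) J alpha (1 - beta) in
  let FL n x := fine (P [set w |
    Num.sqrt n%:R * (trimmed_L k m c (fun i => X i w) n - mu n) / sigma <= x])
  in
  mutually_independent X ->
  identically_distributed X ->
  (forall n, (0 < n)%N -> (k n < n - m n)%N) ->
  alpha_ @ \oo --> alpha ->
  beta_ @ \oo --> beta ->
  0 < alpha -> alpha < 1 - beta -> 0 < beta ->
  (exists2 U, nbhs alpha U & [lipschitz fine (Finv u) | u in U]) ->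
  (exists2 U, nbhs (1 - beta) U & [lipschitz fine (Finv u) | u in U]) ->
  (fun n => Num.max `|alpha_ n - alpha| `|beta_ n - beta|) =O_\oo
    (fun n => n%:R `^ (- 3^-1)) ->
  open I -> `[alpha, 1 - beta] `<=` I -> I `<=` `]0, 1[ ->
  [lipschitz J u | u in I] ->
  (fun n => \sum_((k n).+1 <= i < (n - m n).+1) `|c i n - weight0 J i n|)
    =O_\oo (fun n => n%:R `^ 3^-1) ->
  0 < sigma ->
  forall (a : nat -> R) (A : R), a @ \oo --> 0 -> 0 < A ->
    let D n := [set x | - A <= x <= a n * n%:R `^ 6^-1] in
    unif_equivalent D (fun n x => 1 - FL n x) (fun _ x => 1 - normal_cdf x) /\
    unif_equivalent D (fun n x => FL n (- x)) (fun _ x => normal_cdf (- x)).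
Proof.
move=> alpha_ beta_ Finv mu sigma FL indX idX kmn _ _ a0 ab b0 lipa lipb rate oI abI _
  lipJ wrate sigma0 a A acvg A0 D.
have [Y [b [K [[mY Yb] EY sE K0 approx]]]] := trimmed_L_sum_approx indX idX kmn
  a0 ab b0 lipa lipb rate oI abI lipJ wrate.
rewrite -/sigma in sE.
pose y u := Y u / sigma.
have my : measurable_fun setT y by exact: measurable_funM.
have yb u : `|y u| <= b / sigma.
  by rewrite normrM normfV (gtr0_norm sigma0) ler_wpM2r// invr_ge0 ltW.
have bY : bounded_rv (fun w => Y (X 0%N w)).
  by apply: bounded_rv_comp; [exact: bounded_rv_of mY Yb|].
have Ey : \int[P]_w y (X 0%N w) = 0.
  by under eq_Rintegral do rewrite /y mulrC; rewrite meanZ// EY mulr0.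
have Ey2 : \int[P]_w (y (X 0%N w) ^+ 2) = 1.
  under eq_Rintegral do rewrite /y exprMn mulrC.
  rewrite meanZ; last exact: bounded_rvX.
  have EY2 : 0 <= \int[P]_w (Y (X 0%N w) ^+ 2).
    by apply: Rintegral_ge0 => w _; exact: sqr_ge0.
  by rewrite exprVn sE sqr_sqrtr// mulVf// gt_eqF// -sqrtr_gt0 -sE.
pose V n w := Num.sqrt n%:R * (trimmed_L k m c (fun i => X i w) n - mu n) / sigma.
have mV n : (0 < n)%N -> measurable_fun setT (V n).
  move=> n0; apply: measurable_funM => //; apply: measurable_funM => //.
  by apply: measurable_funB => //; apply: measurable_trimmed_L; exact: kmn.
pose C := K / sigma.
have C0 : 0 <= C by rewrite divr_ge0// ltW.
have psumE n : psum X (fun u => y u * (root12 n)^-1 ^+ 6) n =1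
    fun w => (root12 n)^-1 ^+ 6 / sigma * \sum_(i < n) Y (X i w).
  by move=> w; rewrite /psum mulr_sumr; apply: eq_bigr => i _; rewrite /y; ring.
(* Multiplying the error K n^{-2/3} by sqrt(n) / sigma gives C n^{-1/6}, the size of shift that the
   tail estimates tolerate. *)
have Vy : \forall n \near \oo, exists bad, [/\ measurable bad,
    fine (P bad) <= 8 * root12 n ^+ 4 * expR (- (root12 n ^+ 4 / 20)) &
    forall w, ~ bad w ->
      `|V n w - psum X (fun u => y u * (root12 n)^-1 ^+ 6) n w| <= C * (root12 n)^-1 ^+ 2].
  near=> n.
  have n0 : (0 < n)%N by near: n; exists 1%N.
  have [bad [mbad Pbad badP]] : exists bad, [/\ measurable bad,
        fine (P bad) <= 8 * root12 n ^+ 4 * expR (- (root12 n ^+ 4 / 20)) &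
        forall w, ~ bad w ->
          `|trimmed_L k m c (fun i => X i w) n - mu n
            - (\sum_(i < n) Y (X i w)) / n%:R| <= K * (root12 n)^-1 ^+ 8].
    by near: n.
  exists bad; split=> // w /badP.
  have := @root12_gt0 R n n0; rewrite psumE /V sqrt_root12 -(@root12X12 R n).
  rewrite /C; move: (root12 n) (_ - mu n) (\sum_(i < n) _) sigma0 => p t z sg0 p0 h.
  have -> : p ^+ 6 * t / sigma - p^-1 ^+ 6 / sigma * z = (p ^+ 6 / sigma) * (t - z / p ^+ 12).
    by field; rewrite !gt_eqF.
  have w0 : 0 <= p ^+ 6 / sigma by rewrite divr_ge0 ?exprn_ge0 ?(ltW p0) ?(ltW sg0).
  rewrite normrM (ger0_norm w0).
  have -> : K / sigma * p^-1 ^+ 2 = p ^+ 6 / sigma * (K * p^-1 ^+ 8).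
    by field; rewrite !gt_eqF.
  by rewrite ler_wpM2l.
have tail0 (n : nat) x : 0 < 1 - normal_cdf x :> R by exact: normal_tail_gt0.
have FLE n x : (0 < n)%N -> 1 - FL n x = fine (P [set w | x < V n w]).
  move=> n0.
  have mVx : measurable [set w | V n w <= x].
    by rewrite -[X in measurable X]setTI; apply: measurable_fun_le => //; exact: mV.
  rewrite (_ : [set w | x < V n w] = ~` [set w | V n w <= x]).
    by rewrite probability_setC// fineB ?fin_num_measure.
  by apply/seteqP; split => w /=; [rewrite ltNge => /negP|move/negP; rewrite -ltNge].
have pos : \forall n \near \oo, (0 < n)%N by exists 1%N.
split; apply: unif_equivalent_relative_error => //.
- move=> e e0.
  have E1 : \forall n \near \oo, exists bad, [/\ measurable bad,
    fine (P bad) <= 8 * root12 n ^+ 4 * expR (- (root12 n ^+ 4 / 20)) &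
    forall x w, ~ bad w ->
      let S := psum X (fun u => y u * (root12 n)^-1 ^+ 6) n w in
      (x < V n w -> x - C * (root12 n)^-1 ^+ 2 < S) /\
      (x + C * (root12 n)^-1 ^+ 2 < S -> x < V n w)].
    apply: filterS Vy => n [bad [mbad Pbad badP]]; exists bad; split=> // x w /badP.
    by rewrite ler_distl => /andP[]; move: (_ * _ ^+ 2) (psum _ _ _ _) (V n w); split; lra.
  have mE n x : (0 < n)%N -> measurable [set w | x < V n w].
    by move=> n0; apply: measurable_lt_rv; exact: mV.
  have := tail_relative_error indX idX my yb Ey Ey2 (ltW A0) C0 acvg mE E1 e0.
  apply: filterS2 pos => n n0 h x Dx; rewrite FLE//; exact: h.
- by move=> n x; rewrite normal_cdfN; exact: normal_tail_gt0.
move=> e e0.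
(* The left tail is a right tail for [- y]. The additional 1 in [C + 1] gives room to pass from the
   non-strict event to a strict inequality. *)
have E2 : \forall n \near \oo, exists bad, [/\ measurable bad,
    fine (P bad) <= 8 * root12 n ^+ 4 * expR (- (root12 n ^+ 4 / 20)) &
    forall x w, ~ bad w ->
      let S := psum X (fun u => - y u * (root12 n)^-1 ^+ 6) n w in
      (V n w <= - x -> x - (C + 1) * (root12 n)^-1 ^+ 2 < S) /\
      (x + (C + 1) * (root12 n)^-1 ^+ 2 < S -> V n w <= - x)].
  apply: filterS2 pos Vy => n n0 [bad [mbad Pbad badP]]; exists bad; split=> // x w /badP.
  have -> : psum X (fun u => - y u * (root12 n)^-1 ^+ 6) n w =
      - psum X (fun u => y u * (root12 n)^-1 ^+ 6) n w.
    by rewrite /psum -sumrN; apply: eq_bigr => i _; rewrite mulNr.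
  have : 0 < (root12 n : R)^-1 ^+ 2 by rewrite exprn_gt0// invr_gt0 root12_gt0.
  rewrite ler_distl mulrDl mul1r.
  move: (psum _ _ _ _) (V n w) (_^-1 ^+ 2) => S v q q0; move: (C * q) => r /andP[h1 h2].
  by split; lra.
have mE n x : (0 < n)%N -> measurable [set w | V n w <= - x].
  move=> n0; rewrite -[X in measurable X]setTI; apply: measurable_fun_le => //; exact: mV.
have mNy : measurable_fun setT (fun u => - y u) by exact: measurable_funN.
have Nyb u : `|- y u| <= b / sigma by rewrite normrN.
have ENy : \int[P]_w (- y (X 0%N w)) = 0.
  under eq_Rintegral do rewrite -mulN1r.
  have bry : bounded_rv (fun w => y (X 0%N w)).
    by apply: bounded_rv_comp; [exact: bounded_rv_of my yb|].
  by rewrite (meanZ _ _ bry) Ey mulr0.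
have ENy2 : \int[P]_w ((- y (X 0%N w)) ^+ 2) = 1.
  by under eq_Rintegral do rewrite sqrrN.
have C1 : 0 <= C + 1 by rewrite addr_ge0.
have := tail_relative_error indX idX mNy Nyb ENy ENy2 (ltW A0) C1 acvg mE E2 e0.
by apply: filterS => n h x Dx; rewrite normal_cdfN; exact: h.
Unshelve. all: by end_near. Qed.
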